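(* There exists an absolute constant $c_0>0$ such that for every $1<p\le\infty$, every $n\in\mathbb{N}$ and every $n$-dimensional quotient space $F$ of $L_p$, $$|B_F|^{\frac{n-1}{n}}\le c_0\,p'\,\sup_{H}|B_F\cap H|,$$ where the supremum runs over all hyperplanes $H$ of $F$ and $\frac1p+\frac1{p'}=1$.
   Context: All Banach spaces are real. $L_p=L_p(\Omega,\mu)$ for a measure space $(\Omega,\mu)$. $B_F$ is the closed unit ball of $F$; $F$ is identified with $\mathbb{R}^n$ by a linear isomorphism (any such identification), $|\cdot|$ denotes Lebesgue measure of the appropriate dimension ($n$-dimensional for $B_F$, $(n-1)$-dimensional for $B_F\cap H$), and hyperplanes are linear subspaces of codimension one. *)

(* Defs.v *)
From HB Require Import structures.
From mathcomp Require Import all_boot all_order all_algebra.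
From mathcomp Require Import all_classical all_reals all_analysis.
From mathcomp Require Import ess_sup_inf measurable_realfun.

Set Implicit Arguments.
Unset Strict Implicit.
Unset Printing Implicit Defensive.

Import Order.TTheory GRing.Theory Num.Theory.
Import numFieldNormedType.Exports.

Local Open Scope classical_set_scope.
Local Open Scope ring_scope.
Local Open Scope quotient_scope.

Section QuotientModule.
Context (R : pzRingType) (V : lmodType R) (E : submodClosed V).

(* [submodClosed] only records stability under sums and scaling; the quotient
   of a zmodule asks for a [zmodClosed] predicate. *)
Definition submod_pred : {pred V} := fun x => x \in E.

Lemma submod_pred_zmod_closed : zmod_closed submod_pred.
Proof. exact: GRing.submod_closedB (submodClosedP E). Qed.

HB.instance Definition _ := GRing.isZmodClosed.Build V submod_pred
  submod_pred_zmod_closed.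

Definition quot_mod : Type := Quotient.quot submod_pred.

HB.instance Definition _ := GRing.Zmodule.on quot_mod.

Definition quot_proj (x : V) : quot_mod := \pi_(Quotient.quot submod_pred) x.

Definition quot_scale (a : R) (u : quot_mod) : quot_mod :=
  quot_proj (a *: repr (u : Quotient.quot submod_pred)).

Lemma quot_projE (x y : V) : quot_proj x = quot_proj y <-> x - y \in E.
Proof. by rewrite (Quotient.idealrBE submod_pred x y); split => /eqP. Qed.

Lemma quot_proj_surj (u : quot_mod) : exists x, quot_proj x = u.
Proof. by exists (repr (u : Quotient.quot submod_pred)); rewrite /quot_proj reprK. Qed.

Lemma quot_projD (x y : V) :
  quot_proj (x + y) = quot_proj x + quot_proj y.
Proof. exact: (@Quotient.pi_add V submod_pred). Qed.

Lemma quot_projZ a x : quot_proj (a *: x) = quot_scale a (quot_proj x).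
Proof.
apply/quot_projE; rewrite -scalerBr rpredZ//.
by apply/quot_projE; rewrite /quot_proj reprK.
Qed.

Let scaleA a b u : quot_scale a (quot_scale b u) = quot_scale (a * b) u.
Proof.
by have [x <-] := quot_proj_surj u; rewrite -!quot_projZ scalerA.
Qed.

Let scale1 : left_id 1 quot_scale.
Proof. by move=> u; have [x <-] := quot_proj_surj u; rewrite -quot_projZ scale1r. Qed.

Let scaleDr : right_distributive quot_scale +%R.
Proof.
move=> a u v; have [x <-] := quot_proj_surj u; have [y <-] := quot_proj_surj v.
by rewrite -quot_projD -!quot_projZ -quot_projD scalerDr.
Qed.

Let scaleDl u : {morph quot_scale^~ u : a b / a + b}.
Proof.
move=> a b; have [x <-] := quot_proj_surj u.
by rewrite -!quot_projZ -quot_projD scalerDl.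
Qed.

HB.instance Definition _ := GRing.Zmodule_isLmodule.Build R quot_mod
  scaleA scale1 scaleDr scaleDl.

Lemma quot_proj_linear : linear quot_proj.
Proof. by move=> a x y; rewrite quot_projD quot_projZ. Qed.

HB.instance Definition _ := GRing.isLinear.Build R V quot_mod *:%R quot_proj
  quot_proj_linear.

End QuotientModule.

Section QuotientSpace.
Context (R : realType) (X : normedModType R).

Record closed_subspace := ClosedSubspace {
  subspace_pred :> submodClosed X ;
  subspace_closed : closed [set x : X | x \in subspace_pred] }.

Variable E : closed_subspace.

Definition quot_space : Type := quot_mod E.

HB.instance Definition _ := GRing.Lmodule.on quot_space.

Local Notation q := (quot_proj E : X -> quot_space).

(* The quotient norm |u| = inf { |x| : x in the coset u }. *)
Definition quot_norm (u : quot_space) : R := inf [set `|x| | x in q @^-1` [set u]].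

Let fiber_norm_inf u : has_inf [set `|x| | x in q @^-1` [set u]].
Proof.
split; first by have [x xu] := quot_proj_surj u; exists `|x|, x.
by exists 0 => _ [x _ <-].
Qed.

Let quot_norm_le x : quot_norm (q x) <= `|x|.
Proof. by apply: ge_inf; [case: (fiber_norm_inf (q x))|exists x]. Qed.

Let quot_norm_ge0 u : 0 <= quot_norm u.
Proof.
apply: lb_le_inf; first by case: (fiber_norm_inf u).
by move=> _ [x _ <-].
Qed.

Let quot_norm_adh u e : 0 < e -> exists2 x, q x = u & `|x| < quot_norm u + e.
Proof.
move=> e0; have [_ [x xu <-] xe] := inf_adherent e0 (fiber_norm_inf u).
by exists x.
Qed.

Let quot_normD u v : quot_norm (u + v) <= quot_norm u + quot_norm v.
Proof.
apply/ler_addgt0Pr => e e0.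
have [x <- xe] := quot_norm_adh u (divr_gt0 e0 (ltr0n R 2)).
have [y <- ye] := quot_norm_adh v (divr_gt0 e0 (ltr0n R 2)).
rewrite -[X in quot_norm X](linearD q x y).
apply: (le_trans (quot_norm_le _)); apply: (le_trans (ler_normD _ _)).
rewrite [e]splitr addrACA; apply: lerD; exact: ltW.
Qed.

Let quot_normZ_le a u : quot_norm (a *: u) <= `|a| * quot_norm u.
Proof.
apply/ler_addgt0Pr => e e0.
have a0 : 0 < `|a| + 1 by rewrite ltr_wpDl.
have [x <- xe] := quot_norm_adh u (divr_gt0 e0 a0).
rewrite -[X in quot_norm X](linearZ_LR q a x).
apply: (le_trans (quot_norm_le _)); rewrite normrZ.
apply: (le_trans (ler_wpM2l (normr_ge0 a) (ltW xe))).
rewrite mulrDr lerD2l mulrCA ger_pMr// ler_pdivrMr// mul1r lerDl ler01 //.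
Qed.

Let quot_normZ a u : quot_norm (a *: u) = `|a| * quot_norm u.
Proof.
apply/eqP; rewrite eq_le quot_normZ_le /=.
have [->|a0] := eqVneq a 0; first by rewrite normr0 mul0r quot_norm_ge0.
rewrite -ler_pdivlMl ?normr_gt0// -normfV.
by apply: le_trans (quot_normZ_le _ _); rewrite scalerA mulVf// scale1r.
Qed.

Let quot_norm_eq0 u : quot_norm u = 0 -> u = 0.
Proof.
have [x <-] := quot_proj_surj u => qx0.
rewrite -(linear0 q); apply/quot_projE; rewrite subr0.
apply: (@subspace_closed E x) => B /nbhs_ballP[e /= e0 xeB].
have [y yx ye] := quot_norm_adh (q x) e0.
move: ye; rewrite [quot_norm _]qx0 add0r => ye.
exists (x - y); split; first by apply/quot_projE.
by apply: xeB; rewrite -ball_normE /= opprB addrC subrK.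
Qed.

HB.instance Definition _ := Lmodule_isNormed.Build R quot_space
  quot_normD quot_normZ quot_norm_eq0.

Lemma quot_normE (u : quot_space) :
  `|u| = inf [set `|x| | x in q @^-1` [set u]].
Proof. by []. Qed.

End QuotientSpace.

Definition unit_ball (R : realType) (F : normedModType R) : set F :=
  [set u | `|u| <= 1].
Arguments unit_ball {R} F.

(* [LfunType mu p1] is the module of measurable functions with finite p-norm
   (p = +oo being the essential supremum norm); functions equal almost
   everywhere are not identified there. [LspaceType] identifies them but carries
   no algebraic structure, hence the explicit quotient below. *)
Section LpSpace.
Context d (T : measurableType d) (R : realType).
Variables (mu : {measure set T -> \bar R}) (p : \bar R) (p1 : (1 <= p)%E).

Definition ae_null : {pred LfunType mu p1} :=
  fun f => `[< (f : T -> R) = cst 0 %[ae mu] >].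

Lemma ae_null_submod_closed : submod_closed ae_null.
Proof.
split; first by apply/asboolP; exact: aeW.
move=> a f g /asboolP f0 /asboolP g0; apply/asboolP.
apply: filterS2 f0 g0 => x /= f0 g0 _.
by rewrite -[LHS]/(a * f x + g x) f0// g0// addr0 mulr0.
Qed.

HB.instance Definition _ := GRing.isSubmodClosed.Build R (LfunType mu p1)
  ae_null (GRing.submod_closed_semi ae_null_submod_closed).

Definition Lp : Type := quot_mod ae_null.

HB.instance Definition _ := GRing.Lmodule.on Lp.

Definition Lp_class (f : LfunType mu p1) : Lp := quot_proj ae_null f.

Local Notation nm f := (fine ('N[mu]_p[EFin \o (f : LfunType mu p1)])%E).

Definition Lp_norm (u : Lp) : R :=
  nm (repr (u : Quotient.quot (submod_pred ae_null))).

Let p_neq0 : p != 0%E.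
Proof. by rewrite gt_eqF// (lt_le_trans _ p1). Qed.

Let ae_null_norm (f : LfunType mu p1) : f \in ae_null -> nm f = 0.
Proof.
move=> /asboolP f0; rewrite unlock; move: p p_neq0 p1 f f0 => [r||]//= r0 r1 f f0.
- have rn0 : r != 0 by [].
  rewrite (ae_eq_integral (cst 0)%E)//.
  + by rewrite integral0 poweR0r// invr_neq0.
  + apply/measurable_EFinP.
    apply: (@measurableT_comp _ _ _ _ _ _ (@powR R ^~ r)) => //.
    exact: measurableT_comp.
  + by apply: filterS f0 => x /= f0 _; rewrite f0// normr0 powR0.
- case: ifPn => // mu0; rewrite (@ess_sup_ae_cst _ _ _ _ _ 0%E)//.
  by apply: filterS f0 => x /= /(_ I) ->; rewrite normr0.
Qed.

Lemma Lp_norm_class (f : LfunType mu p1) : Lp_norm (Lp_class f) = nm f.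
Proof.
rewrite /Lp_norm; set g := repr _.
have fg : f - g \in ae_null.
  by apply/quot_projE; rewrite /Lp_class [RHS]/quot_proj reprK.
have gf : g - f \in ae_null by rewrite -opprB rpredN.
apply/eqP; rewrite eq_le; apply/andP; split.
  by rewrite -[g](subrK f) (le_trans (ler_LnormD _ _))// (ae_null_norm gf) add0r.
by rewrite -[f](subrK g) (le_trans (ler_LnormD _ _))// (ae_null_norm fg) add0r.
Qed.

Let Lp_normD u v : Lp_norm (u + v) <= Lp_norm u + Lp_norm v.
Proof.
have [f <-] := quot_proj_surj u; have [g <-] := quot_proj_surj v.
by rewrite -[X in Lp_norm X](linearD (quot_proj ae_null) f g) !Lp_norm_class ler_LnormD.
Qed.

Let Lp_normZ a u : Lp_norm (a *: u) = `|a| * Lp_norm u.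
Proof.
have [f <-] := quot_proj_surj u.
rewrite -[X in Lp_norm X](linearZ_LR (quot_proj ae_null) a f) !Lp_norm_class.
by apply/EFin_inj; rewrite EFinM !finite_norm_fine LnormZ.
Qed.

Let Lp_norm_eq0 u : Lp_norm u = 0 -> u = 0.
Proof.
have [f <-] := quot_proj_surj u; rewrite Lp_norm_class => /fine_Lnormr_eq0 f0.
rewrite -(linear0 (quot_proj ae_null)); apply/quot_projE; rewrite subr0.
exact/asboolP.
Qed.

HB.instance Definition _ := Lmodule_isNormed.Build R Lp
  Lp_normD Lp_normZ Lp_norm_eq0.

Lemma normr_Lp_class (f : LfunType mu p1) :
  `|Lp_class f| = fine ('N[mu]_p[EFin \o f])%E.
Proof. exact: Lp_norm_class. Qed.

End LpSpace.

(* n-dimensional Lebesgue measure of a Borel set, as the n-fold product of the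
   one-dimensional one: m.+1 coordinates are handled by integrating the measures
   of the sections at fixed first coordinate, as in [product_measure1]. In
   dimension 0 it is the counting measure on the single point. *)
Fixpoint lebesgue_rV (R : realType) (n : nat) : set 'rV[R]_n -> \bar R :=
  match n with
  | 0 => fun A => (\1_A 0)%:E
  | m.+1 => fun A => (\int[lebesgue_measure]_x
      lebesgue_rV [set v : 'rV[R]_m | A (row_mx (const_mx x : 'rV[R]_1) v)])%E
  end.

Section Subspaces.
Context (R : realType) (n : nat).

(* Bases of H that are orthonormal for the standard dot product of R^n, stored
   as the rows of a matrix: the dim H orthonormal rows lie in H, so span it. *)
Definition orthonormal_frames (H : {vspace 'rV[R]_n}) : set 'M[R]_(\dim H, n) :=
  [set U | U *m U^T = 1%:M /\ forall i, row i U \in H].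
Arguments orthonormal_frames : clear implicits.

Lemma orthonormal_frames_neq0 (H : {vspace 'rV[R]_n}) :
  orthonormal_frames H !=set0.
Proof.
suff P k : (k <= \dim H)%N -> exists U : 'M[R]_(k, n),
    U *m U^T = 1%:M /\ forall i, row i U \in H by exact: P.
elim: k => [_|k IHk kH].
  by exists 0; split; [apply/matrixP => -[]|case].
have [U [UU UH]] := IHk (ltnW kH).
have [v vH v0] : exists2 v, v \in H & v - v *m U^T *m U != 0.
  apply: contrapT => noV.
  suff : (H <= <<[seq row i U | i <- enum 'I_k]>>)%VS.
    move=> /dimvS /leq_trans /(_ (dim_span _)).
    by rewrite size_map size_enum_ord leqNgt kH.
  apply/subvP => v vH; have [|v0] := eqVneq (v - v *m U^T *m U) 0; last first.
    by exfalso; apply: noV; exists v.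
  move=> /eqP; rewrite subr_eq0 => /eqP ->.
  rewrite mulmx_sum_row rpred_sum// => i _; rewrite rpredZ// memv_span//.
  by apply: map_f; rewrite mem_enum.
set w := v - _ in v0.
have wU : w *m U^T = 0 by rewrite mulmxBl -(mulmxA _ U) UU mulmx1 subrr.
have wH : w \in H.
  rewrite rpredB// mulmx_sum_row rpred_sum// => i _.
  by rewrite rpredZ.
clearbody w.
have ww : (w *m w^T) 0 0 = \sum_j w 0 j ^+ 2.
  by rewrite mxE; apply: eq_bigr => j _; rewrite !mxE expr2.
have ww0 : 0 < (w *m w^T) 0 0.
  rewrite ww lt_def; apply/andP; split; last by apply: sumr_ge0 => j _; exact: sqr_ge0.
  apply: contraNneq v0 => wj0.
  apply/eqP/rowP => j; rewrite [RHS]mxE; apply/eqP; rewrite -sqrf_eq0; apply/eqP.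
  by apply: (psumr_eq0P _ wj0) => // i _; exact: sqr_ge0.
pose c := (Num.sqrt ((w *m w^T) 0 0))^-1.
rewrite -[k.+1]/(1 + k)%N; exists (col_mx (c *: w) U); split.
  rewrite tr_col_mx mul_col_row linearZ /= -!scalemxAl -!scalemxAr wU.
  have -> : U *m w^T = 0 by rewrite -[U]trmxK -trmx_mul wU trmx0.
  have -> : c *: (c *: (w *m w^T)) = 1%:M.
    rewrite [w *m w^T]mx11_scalar scalerA scale_scalar_mx -expr2 exprVn.
    by rewrite sqr_sqrtr ?ltW// mulVf ?gt_eqF.
  by rewrite !scaler0 UU -scalar_mx_block.
move=> i; rewrite -(splitK i); case: fintype.split => j /=.
  by rewrite rowKu row_id memvZ.
by rewrite rowKd.
Qed.

(* (dim H)-dimensional Lebesgue measure of A `&` H for the Euclidean structure H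
   inherits from R^n, transported along the isometry y |-> y *m U from
   R^(dim H) onto H. By rotation invariance it does not depend on U. *)
Definition lebesgue_on (H : {vspace 'rV[R]_n}) (A : set 'rV[R]_n) : \bar R :=
  lebesgue_rV [set y | A (y *m xget 0 (orthonormal_frames H))].

End Subspaces.

(* Main.v *)
Require Import Defs.
From HB Require Import structures.
From mathcomp Require Import all_boot all_order all_algebra.
From mathcomp Require Import all_classical all_reals all_analysis.
From mathcomp Require Import measurable_realfun ess_sup_inf ring lra.

Set Implicit Arguments.
Unset Strict Implicit.
Unset Printing Implicit Defensive.

Import Order.TTheory GRing.Theory Num.Theory.
Import numFieldNormedType.Exports.

Local Open Scope classical_set_scope.
Local Open Scope ring_scope.

(** Let K be the unit ball of F, seen in R^n, let V be its volume and beta the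
largest volume of a hyperplane section. The claim is V^n <= (c p' beta)^n V,
and it comes from a zonotope inside K whose volume is controlled from below by
the covariance of K.

As F is a quotient of L_p, there are vectors z_1, ..., z_N, the images of
normalised indicator functions, such that sum_j b_j z_j is in K as soon as
sum_j |b_j|^p <= 1, while every x in K is sum_j a_j(x) z_j for coefficients
that depend measurably on x and have l_p norm at most 8
([Lp_has_lr_sections], [slicing_reduction]). For p = oo the cube of R^N is
replaced by the ball of l_r for a large r, which costs a factor 2.

Let avg be the mean over K and write the covariance matrix M = avg (x^T x) as
S S^T. Inserting x = sum_j a_j(x) z_j gives S = sum_j z_j^T y_j, where
y_j = avg (a_j(x) x) S^-T, so that |y_j| = avg (a_j(x) <x, w_j>) for a linear
form <., w_j> of variance one. The marginals of K are log-concave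
([brunn_minkowski]), hence the L_q norm of such a form is at most C q for
q = p' ([direction_moments]), and Hoelder's inequality yields
sum_j |y_j|^p <= mu^p with mu = 8 C q. Therefore K contains the zonotope
spanned by the vectors (|y_j| / mu) z_j, whose volume is at least
(2 / mu)^n det S ([vol_zono]). Finally a body whose central sections are small
is spread out: the variance of K in every direction is at least
(V / (6 beta))^2 ([direction_variance]), so that det S >= (V / (6 beta))^n
([cholesky]). Together, V >= (V / (3 beta mu))^n ([slicing_finite]). *)

(** * The Borel sets of R^n *)

(** [lebesgue_rV] is only a set function; it becomes a measure on the Borel
sigma-algebra. *)
Notation mV R n := (g_sigma_algebraType (@open 'rV[R]_n)).

Section Borel_rV.
Context {R : realType}.

(** The [row_mx] of the definition of [lebesgue_rV], so that its sections are
sections along [consr] by conversion. *)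
Definition consr n (t : R) (v : 'rV[R]_n) : 'rV[R]_n.+1 :=
  row_mx (const_mx t : 'rV_1) v.

Definition tailr n (x : 'rV[R]_n.+1) : 'rV[R]_n := \row_j x 0 (lift 0 j).

Lemma consr0 n t (v : 'rV[R]_n) : consr t v 0 0 = t.
Proof.
rewrite /consr; have -> : (0 : 'I_n.+1) = lshift n (0 : 'I_1) by apply/val_inj.
by transitivity ((const_mx t : 'rV_1) 0 0); [exact: row_mxEl|rewrite mxE].
Qed.

Lemma consrS n t (v : 'rV[R]_n) j : consr t v 0 (lift 0 j) = v 0 j.
Proof.
rewrite /consr; have -> : lift 0 j = rshift 1 j by apply/val_inj.
exact: row_mxEr.
Qed.

Lemma tailrK n (x : 'rV[R]_n.+1) : consr (x 0 0) (tailr x) = x.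
Proof.
apply/rowP => i; case: (unliftP 0 i) => [j ->|->]; last by rewrite consr0.
by rewrite consrS mxE.
Qed.

Lemma tailr_consr n t (v : 'rV[R]_n) : tailr (consr t v) = v.
Proof. by apply/rowP => j; rewrite mxE consrS. Qed.

Lemma consr_lin n a s t (v w : 'rV[R]_n) :
  consr (a * s + t) (a *: v + w) = a *: consr s v + consr t w.
Proof.
have E (x y : 'rV[R]_n.+1) j : (a *: x + y) 0 j = a * x 0 j + y 0 j.
  by rewrite mxE [X in X + _]mxE.
apply/rowP => i; rewrite [RHS]E.
case: (unliftP 0 i) => [j ->|->]; last by rewrite !consr0.
by rewrite !consrS !mxE.
Qed.

Lemma continuous_rV (T : topologicalType) n (f : T -> 'rV[R]_n) :
  (forall j, continuous (fun x => f x 0 j)) -> continuous f.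
Proof.
move=> cf x A [P MP sPA].
have : \forall y \near x, forall j, P 0 j (f y 0 j).
  by apply: filter_forall => j; exact: cf (MP 0 j).
by apply: filterS => y Py; apply: sPA => i j; rewrite (ord1 i).
Qed.

Lemma mV_open n (A : set 'rV[R]_n) : open A -> measurable (A : set (mV R n)).
Proof. by move=> oA; apply: sub_sigma_algebra. Qed.

Lemma mV_closed n (A : set 'rV[R]_n) : closed A -> measurable (A : set (mV R n)).
Proof. by move=> cA; rewrite -(setCK A); apply: measurableC; apply: mV_open; exact: closed_openC. Qed.

Lemma continuous_mV n (f : 'rV[R]_n -> R) :
  continuous f -> measurable_fun [set: mV R n] f.
Proof.
move=> cf; apply: (measurability _ (RGenOInfty.measurableE R)) => //.
move=> _ [_ [r ->] <-].
rewrite setTI; apply: mV_open.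
by apply: open_comp => [x _|]; [exact: cf|rewrite set_itvE; exact: open_gt].
Qed.

Lemma coord_mV n j : measurable_fun [set: mV R n] (fun x : 'rV[R]_n => x 0 j).
Proof. apply: continuous_mV; exact: coord_continuous. Qed.

(** Second countability: the boxes with rational corners inside an open set
cover it. This is what reduces measurability of maps into R^n to coordinates. *)
Lemma open_ratbox n (A : set 'rV[R]_n) : open A ->
  A = \bigcup_(ab : 'rV[rat]_n * 'rV[rat]_n) ((fun B => if `[< B `<=` A >] then B else set0)
     [set y | forall j, ratr (ab.1 0 j) < y 0 j < ratr (ab.2 0 j)]).
Proof.
move=> oA; apply/seteqP; split=> [x Ax|x [ab _]]; last first.
  by case: asboolP => // BA /BA.
have /nbhs_ballP[e /= e0 xeA] : nbhs x A by exact: open_nbhs_nbhs.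
have ra j : {q : rat | x 0 j - e < ratr q < x 0 j}.
  by apply: cid; have := @rat_in_itvoo R (x 0 j - e) (x 0 j); rewrite gtrBl => /(_ e0).
have rb j : {q : rat | x 0 j < ratr q < x 0 j + e}.
  by apply: cid; have := @rat_in_itvoo R (x 0 j) (x 0 j + e); rewrite ltrDl => /(_ e0).
exists (\row_j sval (ra j), \row_j sval (rb j)) => //=.
case: asboolP => [_ j|[]]; last first.
  move=> y yab; apply: xeA; split => // i j; rewrite (ord1 i).
  have := yab j; rewrite !mxE => /andP[].
  case: (ra j) => q /= /andP[q1 q2]; case: (rb j) => q' /= /andP[q3 q4].
  rewrite /ball /= => y1 y2; rewrite ltr_norml; apply/andP; split; lra.
by rewrite !mxE; case: (ra j) => q /= /andP[_ ->]; case: (rb j) => q' /= /andP[-> _].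
Qed.

Lemma measurable_fun_mV d (T : measurableType d) n (f : T -> mV R n) :
  (forall j, measurable_fun setT (fun x => (f x : 'rV[R]_n) 0 j : R)) ->
  measurable_fun setT f.
Proof.
move=> mf; apply: (@measurability _ _ T (mV R n) setT f open erefl) => // _ [A oA <-].
rewrite setTI (open_ratbox oA) preimage_bigcup.
apply: countable_bigcupT_measurable; first exact: countableP.
move=> -[a b]; case: asboolP => _; last by rewrite preimage_set0.
have -> : f @^-1` [set y | forall j, ratr ((a, b).1 0 j) < y 0 j < ratr ((a, b).2 0 j)]
  = \bigcap_j (fun x => (f x : 'rV[R]_n) 0 j) @^-1` `]ratr (a 0 j), ratr (b 0 j)[%classic.
  by apply/seteqP; split=> [x /= xab j _|x xab j] /=; have := xab j; rewrite /= in_itv/=;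
    [exact|exact].
apply: fin_bigcap_measurable => // j _.
by rewrite -[X in measurable X]setTI; exact: mf.
Qed.

Lemma continuous_mVV m n (f : 'rV[R]_m -> 'rV[R]_n) :
  continuous f -> measurable_fun [set: mV R m] (f : mV R m -> mV R n).
Proof.
move=> cf; apply: (@measurability _ _ (mV R m) (mV R n) setT f open erefl) => // _ [A oA <-].
rewrite setTI; apply: mV_open; by apply: open_comp => // x _; exact: cf.
Qed.

Lemma measurable_consr n :
  measurable_fun setT (fun z : R * mV R n => consr z.1 z.2 : mV R n.+1).
Proof.
apply: measurable_fun_mV => i; case: (unliftP 0 i) => [j ->|->].
  under eq_fun do rewrite consrS.
  exact: (measurableT_comp (coord_mV j) (@measurable_snd _ _ R (mV R n))).
under eq_fun do rewrite consr0; exact: measurable_fst.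
Qed.

End Borel_rV.

(** * Lebesgue measure on R^n and its behaviour under linear maps *)

Section Lebesgue_rV.
Context {R : realType}.
Notation leb1 := (@lebesgue_measure R).

(** The pushforward packaged as a measure, which integrals and products ask for. *)
Definition push d d' (T : measurableType d) (T' : measurableType d')
   (m : {measure set T -> \bar R}) (f : T -> T') (mf : measurable_fun setT f) :
   {measure set T' -> \bar R} := measure_function_pushforward__canonical__measure_function_Measure m mf.

Definition cubeV n (r : R) : set 'rV[R]_n := [set x | forall j, `|x 0 j| <= r].

Arguments cubeV n r : clear implicits.

Lemma compact_cubeV n r : compact (cubeV n r).
Proof.
rewrite (_ : cubeV n r = [set v : 'rV[R]_n | forall i, (`[-r, r]%classic : set R) (v ord0 i)]).
  by apply: (@rV_compact R n (fun=> `[-r, r]%classic)) => _; exact: segment_compact.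
by apply/seteqP; split => x xr j; have := xr j; rewrite /= in_itv/= ler_norml.
Qed.

Lemma norm_cubeV n (x : 'rV[R]_n) r : 0 <= r -> (`|x| <= r) = `[<cubeV n r x>].
Proof.
move=> r0; rewrite [X in X <= _ = _]/Num.norm/= mx_normrE; apply/idP/asboolP.
  by move=> /bigmax_leP[_ xr] j; exact: (xr (0,j)).
by move=> xr; apply/bigmax_leP; split=> // -[i j] _ /=; rewrite (ord1 i).
Qed.

Lemma measurable_cubeV n r : measurable (cubeV n r : set (mV R n)).
Proof.
by apply: mV_closed; apply: compact_closed; [exact: norm_hausdorff|exact: compact_cubeV].
Qed.

(** The successor step is the image under [consr] of the product of the line
with R^n. Finiteness on cubes is part of the induction because it provides the
sigma-finiteness that the next product needs. *)
Lemma leb_exists n : exists m : {sigma_finite_measure set (mV R n) -> \bar R},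
  (forall A, measurable A -> m A = lebesgue_rV (A : set 'rV[R]_n)) /\
  (forall r : R, m (cubeV n r) < +oo)%E.
Proof.
elim: n => [|n [m [mE mfin]]].
  by exists (\d_(0 : mV R 0)); split => [A mA//|r]; rewrite /= diracE ltry.
pose f := fun z : measurableTypeR R * mV R n => (consr z.1 z.2 : mV R n.+1).
have mf : measurable_fun setT f by exact: measurable_consr.
pose m' := push (leb1 \x m)%E mf.
have m'E A : measurable A -> m' A = (\int[leb1]_t m [set v | A (consr t v)])%E.
  move=> mA; rewrite /m' /= /pushforward/= /product_measure1; apply: eq_integral => t _ /=.
  by congr (m _); apply/seteqP; split=> v; rewrite /xsection/= inE.
have m'fin (r : R) : (m' (cubeV n.+1 r) < +oo)%E.
  have -> : m' (cubeV n.+1 r) = ((leb1 \x m)%E (`[-r, r]%classic `*` cubeV n r)).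
    rewrite /m' /= /pushforward; congr product_measure1; apply/seteqP; split=> -[t v]/=.
      move=> tv; split; first by have := tv 0; rewrite consr0 in_itv/= ler_norml.
      by move=> j; have := tv (lift 0 j); rewrite consrS.
    move=> [tr vr] j; case: (unliftP 0 j) => [i ->|->].
      by rewrite consrS; exact: vr.
    by rewrite consr0; move: tr; rewrite in_itv/= ler_norml.
  rewrite product_measure1E//; last exact: measurable_cubeV.
  apply: (lte_mul_pinfty _ _ (mfin r)); first exact: measure_ge0.
  suff : leb1 `[-r, r]%classic \is a fin_num by [].
  by rewrite lebesgue_measure_itv/=; case: ifP.
have sf : sigma_finite setT m'.
  exists (fun k : nat => cubeV n.+1 k%:R) => [|k]; last first.
    by split; [exact: measurable_cubeV|exact: m'fin].
  apply/esym/seteqP; split=> // x _.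
  exists (Num.truncn `|x|).+1 => //=.
  by apply/asboolP; rewrite -norm_cubeV// ltW// truncnS_gt.
pose m'' : {sigma_finite_measure set (mV R n.+1) -> \bar R} :=
  HB.pack (m' : set (mV R n.+1) -> \bar R) (Measure.class m') (Measure_isSigmaFinite.Build _ _ _ m' sf).
exists m''; split=> // A mA; rewrite -[LHS]/(m' A) m'E//=.
apply: eq_integral => t _; rewrite mE//.
have := measurable_fun_pair2 t mf => /(_ measurableT _ mA); rewrite setTI.
exact.
Qed.

Definition leb n : {sigma_finite_measure set (mV R n) -> \bar R} :=
  sval (cid (leb_exists n)).

Lemma lebE n (A : set (mV R n)) : measurable A -> leb n A = lebesgue_rV (A : set 'rV[R]_n).
Proof. by rewrite /leb; case: cid => m [mE _] /=; exact: mE. Qed.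

Lemma leb_cube_fin n r : (leb n (cubeV n r) < +oo)%E.
Proof. by rewrite /leb; case: cid => m [_ +] /=; exact. Qed.

Lemma leb_bounded_fin n (A : set 'rV[R]_n) r :
  measurable (A : set (mV R n)) -> A `<=` cubeV n r -> (leb n A < +oo)%E.
Proof.
move=> mA AC; apply: le_lt_trans (leb_cube_fin n r).
by apply: le_measure; rewrite ?inE//; exact: measurable_cubeV.
Qed.

Lemma leb0 (A : set 'rV[R]_0) : leb 0 A = (\1_A 0)%:E.
Proof.
rewrite lebE//.
have [/asboolP A0|/asboolP A0] := boolP `[<A 0>].
  suff -> : A = setT by exact: measurableT.
  by apply/seteqP; split=> // x _; rewrite (thinmx0 x) -(thinmx0 0).
suff -> : A = set0 by exact: measurable0.
by apply/seteqP; split=> // x; rewrite (thinmx0 x).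
Qed.

Definition consp n (z : measurableTypeR R * mV R n) : mV R n.+1 := consr z.1 z.2.

Lemma measurable_consp n : measurable_fun setT (@consp n).
Proof. exact: measurable_consr. Qed.

Lemma measurable_sect n (A : set 'rV[R]_n.+1) t : measurable (A : set (mV R n.+1)) ->
  measurable ([set v | A (consr t v)] : set (mV R n)).
Proof.
move=> mA; have := measurable_fun_pair2 t (@measurable_consp n).
by move=> /(_ measurableT _ mA); rewrite setTI.
Qed.

Lemma measurable_fiber n (A : set 'rV[R]_n.+1) v : measurable (A : set (mV R n.+1)) ->
  measurable ([set t | A (consr t v)] : set (measurableTypeR R)).
Proof.
move=> mA; have := measurable_fun_pair1 (v : mV R n) (@measurable_consp n).
by move=> /(_ measurableT _ mA); rewrite setTI.
Qed.

Lemma lebS n (A : set 'rV[R]_n.+1) : measurable (A : set (mV R n.+1)) ->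
  leb n.+1 A = (\int[leb1]_t leb n [set v | A (consr t v)])%E.
Proof.
move=> mA; rewrite lebE//=; apply: eq_integral => t _.
by rewrite lebE//; exact: measurable_sect.
Qed.

Lemma leb_prod n (A : set 'rV[R]_n.+1) : measurable (A : set (mV R n.+1)) ->
  leb n.+1 A = push (leb1 \x leb n)%E (@measurable_consp n) A.
Proof.
move=> mA; rewrite lebS// /push/= /pushforward/= /product_measure1.
apply: eq_integral => t _ /=; congr (leb n _).
by apply/seteqP; split=> v; rewrite /xsection/= inE.
Qed.

(** The fibres here are lines, whereas [lebesgue_rV] integrates the sections at
fixed first coordinate; the two agree by uniqueness of the product measure. *)
Lemma lebS2 n (A : set 'rV[R]_n.+1) : measurable (A : set (mV R n.+1)) ->
  leb n.+1 A = (\int[leb n]_v leb1 [set t | A (consr t v)])%E.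
Proof.
move=> mA; rewrite leb_prod// /push/= /pushforward.
have mA' : measurable (@consp n @^-1` A).
  by rewrite -[X in measurable X]setTI; exact: measurable_consp.
rewrite (product_measure_unique (m' := (leb1 \x^ leb n)%E))//; last first.
  by move=> B C mB mC; exact: product_measure2E.
rewrite /product_measure2; apply: eq_integral => v _ /=; congr (leb1 _).
by apply/seteqP; split=> t; rewrite /ysection/= inE.
Qed.

Lemma integral_leb_prod n (F : 'rV[R]_n.+1 -> \bar R) :
  measurable_fun [set: mV R n.+1] F -> (forall x, 0 <= F x)%E ->
  (\int[leb n.+1]_x F x = \int[leb1 \x leb n]_z F (consp z))%E.
Proof.
move=> mF F0; rewrite (eq_measure_integral (push (leb1 \x leb n)%E (@measurable_consp n))).
  by rewrite ge0_integral_pushforward//; exact: measurable_consp.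
by move=> A mA _; exact: leb_prod.
Qed.

Lemma measurable_Fconsp n (F : 'rV[R]_n.+1 -> \bar R) :
  measurable_fun [set: mV R n.+1] F -> measurable_fun setT (fun z => F (@consp n z)).
Proof. by move=> mF; exact: (measurableT_comp mF (@measurable_consp n)). Qed.

Lemma integral_lebS n (F : 'rV[R]_n.+1 -> \bar R) :
  measurable_fun [set: mV R n.+1] F -> (forall x, 0 <= F x)%E ->
  (\int[leb n.+1]_x F x = \int[leb1]_t \int[leb n]_v F (consr t v))%E.
Proof.
move=> mF F0; rewrite integral_leb_prod// (fubini_tonelli1 (fun z => F (consp z)))//.
exact: measurable_Fconsp.
Qed.

Lemma leb1_shift (a : R) (A : set R) : measurable A ->
  leb1 [set t | A (t + a)] = leb1 A.
Proof.
move=> mA.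
have mf : measurable_fun setT (fun t : measurableTypeR R => t + a : measurableTypeR R).
  exact: measurable_funD.
rewrite -[LHS]/(push leb1 mf A).
apply/esym/lebesgue_measure_unique => // _ [[x y] _ <-].
rewrite /push/= /pushforward.
rewrite [X in _ = leb1 X](_ : _ = `]x - a, y - a]%classic); last first.
  by apply/seteqP; split=> t; rewrite /= !in_itv/= ltrBlDr lerBrDr.
rewrite !lebesgue_measure_itv/= !lte_fin ltrD2r; case: ifP => // _.
by rewrite -!EFinD; congr EFin; ring.
Qed.

Lemma leb1_scale (a : R) (A : set R) : a != 0 -> measurable A ->
  leb1 [set t | A (a * t)] = ((`|a|^-1)%:E * leb1 A)%E.
Proof.
move=> a0 mA.
have a0' : 0 < `|a| by rewrite normr_gt0.
have mf : measurable_fun setT (fun t : measurableTypeR R => a * t : measurableTypeR R).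
  exact: measurable_funM.
suff -> : leb1 A = mscale (NngNum (normr_ge0 a)) (push leb1 mf) A.
  by rewrite /mscale/= muleA -EFinM mulVf ?gt_eqF// mul1e.
apply: lebesgue_measure_unique => // _ [[x y] _ <-].
rewrite -[RHS]/(((`|a|)%:E * leb1 ((fun t : R => (a * t)%R) @^-1` `]x, y]%classic))%E).
have [ap|an] := ltP 0 a.
  rewrite [X in (_ * leb1 X)%E](_ : _ = `](x / a), (y / a)]%classic); last first.
    by apply/seteqP; split=> t; rewrite /= !in_itv/= ltr_pdivrMr// ler_pdivlMr// mulrC.
  rewrite !lebesgue_measure_itv/= !lte_fin ltr_pM2r ?invr_gt0//; case: ifP => // _; last by rewrite mule0.
  by rewrite -!EFinD -EFinM; congr EFin; rewrite gtr0_norm//; field; rewrite gt_eqF.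
have {}an : a < 0 by rewrite lt_neqAle a0 an.
rewrite [X in (_ * leb1 X)%E](_ : _ = `[(y / a), (x / a)[%classic); last first.
  by apply/seteqP; split=> t; rewrite /= !in_itv/= ler_ndivrMr// ltr_ndivlMr// mulrC andbC.
rewrite !lebesgue_measure_itv/= !lte_fin ltr_nM2r ?invr_lt0//; case: ifP => // _; last by rewrite mule0.
by rewrite -!EFinD -EFinM; congr EFin; rewrite ltr0_norm//; field.
Qed.

Definition dot n (u v : 'rV[R]_n) : R := (u *m v^T) 0 0.

Lemma dotE n (u v : 'rV[R]_n) : dot u v = \sum_j u 0 j * v 0 j.
Proof. by rewrite /dot mxE; apply: eq_bigr => j _; rewrite mxE. Qed.

Lemma dotC n (u v : 'rV[R]_n) : dot u v = dot v u.
Proof. by rewrite !dotE; apply: eq_bigr => j _; rewrite mulrC. Qed.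

Lemma dot_ge0 n (u : 'rV[R]_n) : 0 <= dot u u.
Proof. by rewrite dotE sumr_ge0// => j _; rewrite -expr2 sqr_ge0. Qed.

Lemma dot_eq0 n (u : 'rV[R]_n) : (dot u u == 0) = (u == 0).
Proof.
apply/eqP/eqP => [|->]; last by rewrite dotE big1// => j _; rewrite mxE mul0r.
rewrite dotE => /psumr_eq0P H; apply/rowP => j; rewrite mxE; apply/eqP.
by rewrite -sqrf_eq0 expr2 H// => i _; rewrite -expr2 sqr_ge0.
Qed.

Lemma dot_delta n (i : 'I_n) : dot (delta_mx 0 i) (delta_mx 0 i) = 1.
Proof.
rewrite dotE (bigD1 i)//= big1 ?addr0 => [|j ji]; last by rewrite mxE (negbTE ji) andbF mul0r.
by rewrite !mxE !eqxx mulr1.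
Qed.

Lemma measurable_shiftV n (w : 'rV[R]_n) (A : set 'rV[R]_n) :
  measurable (A : set (mV R n)) -> measurable ([set v | A (v + w)] : set (mV R n)).
Proof.
move=> mA; have : measurable_fun [set: mV R n] (fun v : mV R n => (v : 'rV[R]_n) + w : mV R n).
  apply: measurable_fun_mV => j; under eq_fun do rewrite mxE.
  by apply: measurable_funD => //; exact: coord_mV.
by move=> /(_ measurableT _ mA); rewrite setTI.
Qed.

Lemma continuous_mulmx m n (A : 'M[R]_(m, n)) : continuous (fun x : 'rV[R]_m => x *m A).
Proof.
apply: continuous_rV => j; under eq_fun do rewrite mxE.
suff H s : continuous (fun x : 'rV[R]_m => \sum_(i <- s) x 0 i * A i j) by exact: H.
elim: s => [|i s IHs].
  have -> : (fun x : 'rV[R]_m => \sum_(i <- [::]) x 0 i * A i j) = fun=> 0.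
    by apply/funext => x; rewrite big_nil.
  exact: cst_continuous.
have -> : (fun x : 'rV[R]_m => \sum_(i <- i :: s) x 0 i * A i j) =
    fun x => x 0 i * A i j + \sum_(i <- s) x 0 i * A i j.
  by apply/funext => x; rewrite big_cons.
move=> x; apply: (@cvgD _ R^o _ (nbhs x)); last exact: IHs.
by apply: (@cvgM _ _ (nbhs x)); [exact: coord_continuous|exact: cvg_cst].
Qed.

Lemma measurable_mulmxV m n (M : 'M[R]_(m, n)) (A : set 'rV[R]_n) :
  measurable (A : set (mV R n)) -> measurable ([set v | A (v *m M)] : set (mV R m)).
Proof.
move=> mA; have := continuous_mVV (@continuous_mulmx m n M).
by move=> /(_ measurableT _ mA); rewrite setTI.
Qed.

Lemma consrD n s t (v w : 'rV[R]_n) : consr s v + consr t w = consr (s + t) (v + w).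
Proof. by have := consr_lin 1 s t v w; rewrite mul1r !scale1r => ->. Qed.

Lemma consr00 n : consr 0 (0 : 'rV[R]_n) = 0.
Proof. by apply/rowP => i; case: (unliftP 0 i) => [j ->|->]; rewrite ?consrS ?consr0 !mxE. Qed.

Lemma consrZ n a t (v : 'rV[R]_n) : a *: consr t v = consr (a * t) (a *: v).
Proof. by have := consr_lin a t 0 v 0; rewrite !addr0 consr00 addr0. Qed.

Lemma consr_conv n s t (v w : 'rV[R]_n) a :
  (1 - a) *: consr s v + a *: consr t w = consr ((1 - a) * s + a * t) ((1 - a) *: v + a *: w).
Proof. by rewrite !consrZ consrD. Qed.

(** Translating the first coordinate acts on the line fibres, and translating
the others acts on the sections. *)
Lemma leb_shift n (w : 'rV[R]_n) (A : set 'rV[R]_n) :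
  measurable (A : set (mV R n)) -> leb n [set v | A (v + w)] = leb n A.
Proof.
elim: n w A => [|n IHn] w A mA.
  by congr (leb 0 _); apply/seteqP; split=> v; rewrite /= (thinmx0 (v + w)) (thinmx0 v).
rewrite -(tailrK w); set s := w 0 0; set w' := tailr w.
have -> : [set v | A (v + consr s w')] =
   [set v | [set u | A (u + consr 0 w')] (v + consr s 0)].
  by apply/seteqP; split=> v /=; rewrite -addrA consrD add0r addr0.
have mA' : measurable ([set u | A (u + consr 0 w')] : set (mV R n.+1)).
  exact: measurable_shiftV.
transitivity (leb n.+1 [set u | A (u + consr 0 w')]).
  rewrite lebS2; last exact: measurable_shiftV.
  rewrite [RHS](lebS2 mA'); apply: eq_integral => v _.
  rewrite -[RHS](leb1_shift s); last exact: measurable_fiber.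
  by congr (leb1 _); apply/seteqP; split=> t /=; rewrite !consrD !addr0.
rewrite [LHS](lebS mA') [RHS](lebS mA); apply: eq_integral => t _.
rewrite -[RHS](IHn w'); last exact: measurable_sect.
by congr (leb n _); apply/seteqP; split=> v /=; rewrite !consrD !addr0.
Qed.

(** The change of variables formula for M. It passes to products, so block
elementary matrices suffice. *)
Let scales n (M : 'M[R]_n) := forall A : set 'rV[R]_n, measurable (A : set (mV R n)) ->
  leb n [set v | A (v *m M)] = ((`|\det M|^-1)%:E * leb n A)%E.

Let scalesM n (M N : 'M[R]_n) : scales M -> scales N -> scales (M *m N).
Proof.
move=> sM sN A mA.
have := sM [set v | A (v *m N)] (measurable_mulmxV N mA).
rewrite sN// => E; rewrite det_mulmx normrM invfM EFinM -muleA -E.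
by congr (leb n _); apply/seteqP; split=> v /=; rewrite mulmxA.
Qed.

Lemma consr_mul n t (v : 'rV[R]_n) a (r : 'rV[R]_n) (c : 'cV[R]_n) (D : 'M[R]_n) :
  (consr t v *m (block_mx (a%:M : 'M[R]_1) r c D : 'M[R]_(1 + n)) : 'rV_n.+1) =
  consr (t * a + (v *m c) 0 0) (t *: r + v *m D).
Proof.
have E := mul_row_block (const_mx t : 'M[R]_1) v (a%:M : 'M[R]_1) r c D.
apply: (etrans E); rewrite /consr; congr row_mx.
  by apply/rowP => i; rewrite (ord1 i) mul_mx_scalar !mxE mulrC.
have -> : (const_mx t : 'M[R]_1) = t%:M by apply/rowP => i; rewrite (ord1 i) !mxE mulr1n.
by rewrite mul_scalar_mx.
Qed.

Let scales_lower n (c : 'cV[R]_n) : scales (block_mx (1%:M : 'M[R]_1) 0 c 1%:M : 'M[R]_(1 + n)).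
Proof.
move=> A mA; rewrite det_lblock !det1 mul1r normr1 invr1 mul1e.
rewrite [LHS]lebS2; last exact: measurable_mulmxV.
rewrite [RHS](lebS2 mA); apply: eq_integral => v _.
rewrite -[RHS](leb1_shift ((v *m c) 0 0)); last exact: measurable_fiber.
congr (leb1 _); apply/seteqP; split=> t /=; rewrite consr_mul;
  by rewrite mulr1 scaler0 mulmx1 add0r.
Qed.

Let scales_upper n (r : 'rV[R]_n) : scales (block_mx (1%:M : 'M[R]_1) r 0 1%:M : 'M[R]_(1 + n)).
Proof.
move=> A mA; rewrite det_ublock !det1 mul1r normr1 invr1 mul1e.
rewrite [LHS]lebS; last exact: measurable_mulmxV.
rewrite [RHS](lebS mA); apply: eq_integral => t _.
rewrite -[RHS](leb_shift (t *: r)); last exact: measurable_sect.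
congr (leb n _); apply/seteqP; split=> v /=; rewrite consr_mul;
  by rewrite mulr1 mulmx0 mxE addr0 mulmx1 addrC.
Qed.

Let scales_block n (D : 'M[R]_n) : scales D -> scales (block_mx (1%:M : 'M[R]_1) 0 0 D : 'M[R]_(1 + n)).
Proof.
move=> sD A mA; rewrite det_ublock det1 mul1r.
rewrite [LHS]lebS; last exact: measurable_mulmxV.
rewrite [in RHS](lebS mA) -ge0_integralZl_EFin ?invr_ge0//; last first.
  apply: (eq_measurable_fun (fun t => leb n (xsection (@consp n @^-1` A) t))).
    by move=> t _; congr (leb n _); apply/seteqP; split=> v; rewrite /xsection/= inE.
  apply: measurable_fun_xsection.
  by rewrite -[X in measurable X]setTI; exact: measurable_consp.
apply: eq_integral => t _.
rewrite -sD; last exact: measurable_sect.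
congr (leb n _); apply/seteqP; split=> v /=; rewrite consr_mul;
  by rewrite mulr1 mulmx0 mxE addr0 scaler0 add0r.
Qed.

Let scales_first n (a : R) : a != 0 -> scales (block_mx (a%:M : 'M[R]_1) 0 0 1%:M : 'M[R]_(1 + n)).
Proof.
move=> a0 A mA; rewrite det_ublock det1 mulr1 det_scalar1.
rewrite [LHS]lebS2; last exact: measurable_mulmxV.
rewrite [in RHS](lebS2 mA) -ge0_integralZl_EFin ?invr_ge0//; last first.
  apply: (eq_measurable_fun (fun v => leb1 (ysection (@consp n @^-1` A) v))).
    by move=> t _; congr (leb1 _); apply/seteqP; split=> v; rewrite /ysection/= inE.
  apply: measurable_fun_ysection.
  by rewrite -[X in measurable X]setTI; exact: measurable_consp.
apply: eq_integral => v _.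
rewrite -leb1_scale//; last exact: measurable_fiber.
congr (leb1 _); apply/seteqP; split=> t /=; rewrite consr_mul;
  by rewrite mulmx0 mxE addr0 scaler0 add0r mulmx1 mulrC.
Qed.

(** When the corner entry is nonzero, block elimination factors M into shears,
a dilation of the first coordinate and a map of the other coordinates. A zero
corner is made nonzero by a shear built from the rest of the first row. *)
Lemma leb_linear n (M : 'M[R]_n) (A : set 'rV[R]_n) : M \in unitmx ->
  measurable (A : set (mV R n)) ->
  leb n [set v | A (v *m M)] = ((`|\det M|^-1)%:E * leb n A)%E.
Proof.
move=> uM; move: A; rewrite -/(scales M).
elim: n M uM => [|n IHn] M uM.
  move=> A _; rewrite det_mx00 normr1 invr1 mul1e; congr (leb 0 _).
  by apply/seteqP; split=> v; rewrite /= (thinmx0 (v *m M)) (thinmx0 v).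
have corner (N : 'M[R]_(1 + n)) : N \in unitmx -> (ulsubmx N) 0 0 != 0 -> scales N.
  move=> uN; set a := _ 0 0 => a0.
  have aE : ulsubmx N = a%:M by rewrite [LHS]mx11_scalar.
  set D := drsubmx N - a^-1 *: (dlsubmx N *m ursubmx N).
  have NE : N = (block_mx (1%:M : 'M[R]_1) 0 (a^-1 *: dlsubmx N) 1%:M) *m
     ((block_mx (a%:M : 'M[R]_1) 0 0 1%:M) *m ((block_mx (1%:M : 'M[R]_1) 0 0 D) *m
       (block_mx (1%:M : 'M[R]_1) (a^-1 *: ursubmx N) 0 1%:M))).
    rewrite -{1}[N]submxK !mulmx_block !(mulmx0, mul0mx, mulmx1, mul1mx, addr0, add0r) aE.
    rewrite !mul_scalar_mx !mul_mx_scalar -scalemxAr !scalerA mulfV// !scale1r.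
    by rewrite -scalemxAl scalerA mulfV// scale1r -scalemxAr /D addrC subrK.
  have uD : D \in unitmx.
    move: uN; rewrite !unitmxE {1}NE !det_mulmx !det_ublock det_lblock !det1 !mulr1 !mul1r.
    by rewrite det_scalar1 unitrM => /andP[].
  rewrite NE; apply: scalesM; first exact: scales_lower.
  apply: scalesM; first exact: scales_first.
  by apply: scalesM; [apply: scales_block; exact: IHn|exact: scales_upper].
have [a0|] := eqVneq ((ulsubmx (M : 'M[R]_(1 + n))) 0 0) 0; last exact: corner.
pose r := ursubmx (M : 'M[R]_(1 + n)).
have r0 : (r *m r^T) 0 0 != 0.
  rewrite -/(dot r r) dot_eq0; apply/negP => /eqP r0.
  move: uM; rewrite unitmxE (expand_det_row _ ord0) big1 ?unitr0// => j _.
  have -> : M ord0 j = 0; last by rewrite mul0r.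
  rewrite -[M](@submxK _ 1 n 1 n); case: (unliftP 0 j) => [k ->|->].
    have -> : lift 0 k = rshift 1 k by apply/val_inj.
    have -> : (ord0 : 'I_(1 + n)) = lshift n 0 by apply/val_inj.
    by apply: etrans; [exact: block_mxEur|rewrite -/r r0 mxE].
  have -> : (ord0 : 'I_(1 + n)) = lshift n 0 by apply/val_inj.
  have -> : (0 : 'I_(1 + n)) = lshift n 0 by apply/val_inj.
  by apply: etrans; [exact: block_mxEul|].
pose E : 'M[R]_(1 + n) := block_mx 1%:M 0 r^T 1%:M.
pose E' : 'M[R]_(1 + n) := block_mx 1%:M 0 (- r^T) 1%:M.
have EE' : E *m E' = 1%:M.
  rewrite mulmx_block !(mulmx0, mul0mx, mulmx1, mul1mx, addr0, add0r) subrr.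
  by rewrite -scalar_mx_block.
have -> : M = (M : 'M[R]_(1 + n)) *m E *m E' by rewrite -mulmxA EE' mulmx1.
apply: scalesM; last exact: scales_lower.
apply: corner.
  rewrite unitmx_mul uM/= unitmxE det_lblock !det1 mulr1 unitr1 //.
rewrite -{1}[M](@submxK _ 1 n 1 n) mulmx_block block_mxKul mulmx1 mxE a0 add0r.
exact: r0.
Qed.

End Lebesgue_rV.

Arguments cubeV {R} n r.

(** * The multiplicative Brunn-Minkowski inequality *)

Section BrunnMinkowski.
Context {R : realType}.
Notation leb1 := (@lebesgue_measure R).

Lemma wamgm (x y t : R) : 0 <= x -> 0 <= y -> 0 < t < 1 ->
  x `^ (1 - t) * y `^ t <= (1 - t) * x + t * y.
Proof.
move=> x0 y0 /andP[t0 t1]; have t1' : 0 < 1 - t by rewrite subr_gt0.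
have := @conjugate_powR R (x `^ (1 - t)) (y `^ t) (1 - t)^-1 t^-1 (powR_ge0 _ _) (powR_ge0 _ _).
rewrite !invr_gt0 !invrK => /(_ t1' t0); rewrite subrK => /(_ erefl).
by rewrite -!powRrM !mulfV ?gt_eqF// !powRr1// [x * _]mulrC [y * _]mulrC.
Qed.

(** For 0 < l < 1 the endpoints are avoided, so X may be open, closed or a
single point. *)
Lemma itv_inner (X : set R) l : is_interval X -> X !=set0 -> has_lbound X -> has_ubound X ->
  0 < l < 1 -> X (inf X + l * (sup X - inf X)).
Proof.
move=> iX X0 lX uX /andP[l0 l1].
have ab : inf X <= sup X.
  by case: X0 => x Xx; apply: le_trans (ge_inf lX Xx) (ub_le_sup uX Xx).
have [ab'|ba] := ltP (inf X) (sup X); last first.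
  have E : inf X = sup X by apply/eqP; rewrite eq_le ab.
  rewrite -E subrr mulr0 addr0; case: X0 => x Xx.
  suff -> : inf X = x by [].
  by apply/eqP; rewrite eq_le ge_inf//= E ub_le_sup.
have d0 : 0 < sup X - inf X by rewrite subr_gt0.
have [u Xu uz] := @inf_adherent R X (l * (sup X - inf X)) (mulr_gt0 l0 d0) (conj X0 lX).
have l1' : 0 < 1 - l by rewrite subr_gt0.
have [v Xv zv] := @sup_adherent R X ((1 - l) * (sup X - inf X)) (mulr_gt0 l1' d0) (conj X0 uX).
by apply: (iX u v) => //; rewrite (ltW uz)/= (le_trans _ (ltW zv))//; lra.
Qed.

Lemma itv_len (X : set R) : is_interval X -> X !=set0 -> has_lbound X -> has_ubound X ->
  (leb1 X <= (sup X - inf X)%:E)%E.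
Proof.
move=> iX X0 lX uX.
have ab : inf X <= sup X.
  by case: X0 => x Xx; apply: le_trans (ge_inf lX Xx) (ub_le_sup uX Xx).
apply: (@le_trans _ _ (leb1 `[inf X, sup X]%classic)).
  apply: le_measure; rewrite ?inE//; first exact: is_interval_measurable.
  by move=> x Xx; rewrite /= in_itv/= ge_inf//= ub_le_sup.
rewrite lebesgue_measure_itv/= lte_fin; case: ifP => // _.
by rewrite lee_fin subr_ge0.
Qed.

Lemma frac01 (u z v : R) : u < z -> z < v -> 0 < (z - u) / (v - u) < 1.
Proof.
move=> uz zv; have uv : 0 < v - u by rewrite subr_gt0 (lt_trans uz).
apply/andP; split; first by rewrite divr_gt0// subr_gt0.
by rewrite ltr_pdivrMr// mul1r ltrD2r.
Qed.

(** W contains the open interval between the combined infima and the combined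
suprema. *)
Lemma leb1_sum (X Y W : set R) t : 0 < t < 1 ->
  is_interval X -> X !=set0 -> has_lbound X -> has_ubound X ->
  is_interval Y -> Y !=set0 -> has_lbound Y -> has_ubound Y -> measurable W ->
  (forall x y, X x -> Y y -> W ((1 - t) * x + t * y)) ->
  ((1 - t)%:E * leb1 X + t%:E * leb1 Y <= leb1 W)%E.
Proof.
move=> /andP[t0 t1] iX X0 lX uX iY Y0 lY uY mW XYW.
have t1' : 0 < 1 - t by rewrite subr_gt0.
set a := inf X; set b := sup X; set c := inf Y; set d := sup Y.
have abX := itv_len iX X0 lX uX; have cdY := itv_len iY Y0 lY uY.
apply: (@le_trans _ _ ((1 - t)%:E * (b - a)%:E + t%:E * (d - c)%:E)%E).
  by apply: leeD; rewrite lee_pmul2l// lte_fin.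
set u := (1 - t) * a + t * c; set v := (1 - t) * b + t * d.
apply: (@le_trans _ _ (leb1 `]u, v[%classic)).
  rewrite lebesgue_measure_itv/= lte_fin -!EFinM -!EFinD.
  case: ltP => [_|vu]; first by rewrite lee_fin /u /v; lra.
  by rewrite lee_fin; move: vu; rewrite /u /v; lra.
apply: le_measure; rewrite ?inE// => z0; rewrite /= in_itv/=; move: (z0 : R) => z /andP[uz zv].
have uv : 0 < v - u by rewrite subr_gt0 (lt_trans uz).
pose l := (z - u) / (v - u).
have l01 : 0 < l < 1 by exact: frac01.
have zE : z = u + l * (v - u) by rewrite divfK ?gt_eqF// addrC subrK.
have := XYW _ _ (itv_inner iX X0 lX uX l01) (itv_inner iY Y0 lY uY l01).
rewrite [X in W X -> _](_ : _ = z)//.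
by rewrite zE /u /v /a /b /c /d; ring.
Qed.

Definition hypograph (f : R -> R) :=
  [set z : measurableTypeR R * measurableTypeR R | 0 <= z.2 < f z.1].

Lemma measurable_hypograph (f : R -> R) : measurable_fun setT f -> measurable (hypograph f).
Proof.
move=> mf.
have -> : hypograph f = [set z | 0 <= z.2] `&` [set z | z.2 < f z.1].
  by apply/seteqP; split=> z /=; [move=> /andP|move=> H; apply/andP].
apply: measurableI.
  have -> : [set z : measurableTypeR R * measurableTypeR R | 0 <= z.2] =
      setT `&` snd @^-1` `[0, +oo[%classic.
    by apply/seteqP; split=> z /=; rewrite in_itv/= andbT => // -[].
  exact: measurable_snd.
have -> : [set z : measurableTypeR R * measurableTypeR R | z.2 < f z.1] =
    setT `&` (fun z => f z.1 - z.2) @^-1` `]0, +oo[%classic.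
  by apply/seteqP; split=> z /=; rewrite in_itv/= andbT subr_gt0 => // -[].
have mh : measurable_fun setT
    (fun z : measurableTypeR R * measurableTypeR R => f z.1 - z.2 : measurableTypeR R).
  apply: measurable_funB; last exact: measurable_snd.
  exact: measurableT_comp mf measurable_fst.
exact: mh.
Qed.

Lemma ysection_hypograph f (a : R) : 0 <= a -> ysection (hypograph f) a = [set x | a < f x].
Proof. by move=> a0; apply/seteqP; split=> x; rewrite /ysection/= inE /hypograph/= a0. Qed.

Lemma measurable_tail (f : R -> R) : measurable_fun setT f ->
  measurable_fun (`[0%R, +oo[%classic : set R) (fun a : R => leb1 [set x | a < f x]).
Proof.
move=> mf; apply: (eq_measurable_fun (fun a => leb1 (ysection (hypograph f) a))).
  by move=> a; rewrite inE/= in_itv/= andbT => a0; rewrite ysection_hypograph.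
apply: (measurable_funS measurableT) => //; apply: measurable_fun_ysection.
exact: measurable_hypograph.
Qed.

(** Both sides are the area under the graph, sliced in the two directions. *)
Lemma layer_cake (f : R -> R) : measurable_fun setT f -> (forall x, 0 <= f x) ->
  (\int[leb1]_x (f x)%:E = \int[leb1]_(a in `[0%R, +oo[) leb1 [set x | (a < f x)%R])%E.
Proof.
move=> mf f0.
pose E := hypograph f; have mE : measurable E by exact: measurable_hypograph.
have E12 : (leb1 \x leb1)%E E = (leb1 \x^ leb1)%E E.
  by apply: product_measure_unique => // A B mA mB; exact: product_measure2E.
transitivity ((leb1 \x leb1)%E E).
  apply: eq_integral => x _ /=.
  rewrite (_ : xsection E x = `[0, f x[%classic); last first.
    by apply/seteqP; split=> y; rewrite /xsection/= inE in_itv.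
  rewrite lebesgue_measure_itv/= lte_fin; case: ltP => [_|fx0]; first by rewrite oppr0 adde0.
  by congr EFin; apply/eqP; rewrite eq_le fx0 f0.
rewrite E12 [RHS]integral_mkcond; apply: eq_integral => a _ /=.
rewrite patchE; case: ifPn => [|].
  by rewrite inE/= in_itv/= andbT => a0; rewrite ysection_hypograph.
rewrite notin_setE/= in_itv/= andbT => /negP a0.
rewrite (_ : ysection E a = set0) ?measure0//.
by apply/seteqP; split=> x //; rewrite /ysection/= inE /E/hypograph/= (negbTE a0).
Qed.

(** Normalise f and g to have supremum 1. For a < 1 the superlevel sets at
height a are then nonempty intervals whose combination lies in that of h, so
[leb1_sum] and [layer_cake] give an additive inequality between the integrals,
which the weighted arithmetic-geometric inequality makes multiplicative. *)
Lemma prekopa_leindler (f g h : R -> R) (t r M : R) (If Ig : R) : 0 < t < 1 ->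
  measurable_fun setT f -> measurable_fun setT g -> measurable_fun setT h ->
  (forall x, 0 <= f x <= M) -> (forall x, 0 <= g x <= M) -> (forall x, 0 <= h x) ->
  (forall x, f x != 0 -> `|x| <= r) -> (forall x, g x != 0 -> `|x| <= r) ->
  (forall a, is_interval [set x | a < f x]) -> (forall a, is_interval [set x | a < g x]) ->
  (forall x y, f x `^ (1 - t) * g y `^ t <= h ((1 - t) * x + t * y)) ->
  (\int[leb1]_x (f x)%:E = If%:E)%E -> (\int[leb1]_x (g x)%:E = Ig%:E)%E ->
  ((If `^ (1 - t) * Ig `^ t)%:E <= \int[leb1]_x (h x)%:E)%E.
Proof.
move=> t01 mf mg mh f0 g0 h0 fr gr fi gi fgh fI gI.
have /andP[t0 t1] := t01; have t1' : 0 < 1 - t by rewrite subr_gt0.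
(* U is the supremum of u. *)
have main : forall (u : R -> R) I, measurable_fun setT u -> (forall x, 0 <= u x <= M) ->
    (\int[leb1]_x (u x)%:E = I%:E)%E -> I != 0 -> 0 < I /\
    exists U, [/\ 0 < U, forall x, u x <= U & forall a, a < U -> exists x, a < u x].
  move=> u I mu u0 uI I0.
  have Ipos : 0 < I.
    rewrite lt_neqAle eq_sym I0/= -lee_fin -uI integral_ge0// => x _.
    by rewrite lee_fin; case/andP: (u0 x).
  have [x ux] : exists x, 0 < u x.
    apply: contrapT => /forallNP ux; move: I0 => /eqP; apply; apply/EFin_inj; rewrite -uI.
    apply: integral0_eq => x _; congr EFin; apply/eqP; rewrite eq_le.
    by case/andP: (u0 x) => -> _; rewrite andbT leNgt; apply/negP/ux.
  have hs : has_sup (range u).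
    split; first by exists (u x), x.
    by exists M => _ [y _ <-]; case/andP: (u0 y).
  split=> //; exists (sup (range u)); split.
  - by apply: lt_le_trans ux _; apply: ub_le_sup; [case: hs|exists x].
  - by move=> y; apply: ub_le_sup; [case: hs|exists y].
  - move=> a aU; have [_ [y _ <-] ay] := @sup_adherent R _ _ (eq_ind_r is_true aU (subr_gt0 a _)) hs.
    by exists y; move: ay; rewrite opprB addrC subrK.
have hpos : (0 <= \int[leb1]_x (h x)%:E)%E by apply: integral_ge0 => x _; rewrite lee_fin.
have [->|If0] := eqVneq If 0; first by rewrite powR0 ?gt_eqF// mul0r.
have [->|Ig0] := eqVneq Ig 0; first by rewrite powR0 ?gt_eqF// mulr0.
have [Ifp [F [Fp fF Fa]]] := main _ _ mf f0 fI If0.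
have [Igp [G [Gp gG Ga]]] := main _ _ mg g0 gI Ig0.
pose H := F `^ (1 - t) * G `^ t.
have Hp : 0 < H by rewrite mulr_gt0// powR_gt0.
have bnd (u : R -> R) a : (forall x, u x != 0 -> `|x| <= r) -> 0 <= a ->
    has_lbound [set x | a < u x] /\ has_ubound [set x | a < u x].
  move=> ur a0; split; [exists (- r)|exists r] => x /= ax;
    by have := ur x; rewrite (gt_eqF (le_lt_trans a0 ax)) => /(_ isT); rewrite ler_norml => /andP[].
have lc (u : R -> R) (c : R) : 0 < c -> measurable_fun setT u -> (forall x, 0 <= u x) ->
   (c^-1%:E * \int[leb1]_x (u x)%:E = \int[leb1]_(a in `[0%R, +oo[) leb1 [set x | (a * c < u x)%R])%E /\
   measurable_fun (`[0%R, +oo[%classic : set R) (fun a : R => leb1 [set x | a * c < u x]).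
  move=> c0 mu u0.
  have muc : measurable_fun setT (fun x : R => c^-1 * u x) by exact: measurable_funM.
  have E a : leb1 [set x | a * c < u x] = leb1 [set x | a < c^-1 * u x].
    by congr (leb1 _); apply/seteqP; split=> x /=; rewrite ltr_pdivlMl// [c * _]mulrC.
  split; last first.
    have := measurable_tail muc; apply: eq_measurable_fun => a _; exact/esym/E.
  rewrite -ge0_integralZl_EFin//; last 3 first.
  - by move=> x _; rewrite lee_fin.
  - exact/measurable_EFinP.
  - by rewrite invr_ge0 ltW.
  rewrite -[LHS]/(\int[leb1]_x (c^-1 * u x)%:E)%E layer_cake//.
    by apply: eq_integral => a _; exact/esym/E.
  by move=> x; rewrite mulr_ge0// invr_ge0 ltW.
have f0' x : 0 <= f x by case/andP: (f0 x).
have g0' x : 0 <= g x by case/andP: (g0 x).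
have [lf mlf] := lc f F Fp mf f0'; have [lg mlg] := lc g G Gp mg g0'.
have [lh mlh] := lc h H Hp mh h0.
(* Compare the superlevel sets of f / F, g / G and h / H at each height a. *)
have key : ((1 - t)%:E * (F^-1%:E * If%:E) + t%:E * (G^-1%:E * Ig%:E) <=
   H^-1%:E * \int[leb1]_x (h x)%:E)%E.
  rewrite -fI -gI lf lg lh -!ge0_integralZl_EFin//; [|exact: ltW..].
  rewrite -ge0_integralD//; last 4 first.
  - by move=> a _; rewrite mule_ge0// lee_fin ltW.
  - exact: measurable_funeM.
  - by move=> a _; rewrite mule_ge0// lee_fin ltW.
  - exact: measurable_funeM.
  apply: ge0_le_integral => //.
  - by move=> a _; rewrite adde_ge0// mule_ge0// lee_fin ltW.
  - by apply: emeasurable_funD; exact: measurable_funeM.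
  move=> a; rewrite /= in_itv/= andbT => a0.
  have [a1|a1] := leP 1 a.
    rewrite [X in leb1 X](_ : _ = set0); last first.
      apply/seteqP; split=> x //=; apply/negP; rewrite -leNgt (le_trans (fF x))//.
      by rewrite ler_peMl// ltW.
    rewrite [X in (_ + _ * leb1 X)%E](_ : _ = set0); last first.
      apply/seteqP; split=> x //=; apply/negP; rewrite -leNgt (le_trans (gG x))//.
      by rewrite ler_peMl// ltW.
    by rewrite measure0 !mule0 adde0.
  have aF0 : 0 <= a * F by rewrite mulr_ge0// ltW.
  have aG0 : 0 <= a * G by rewrite mulr_ge0// ltW.
  have [fl fu] := bnd f _ fr aF0; have [gl gu] := bnd g _ gr aG0.
  apply: leb1_sum => //.
  - have /Fa[x ?] : a * F < F by rewrite gtr_pMl.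
    by exists x.
  - have /Ga[x ?] : a * G < G by rewrite gtr_pMl.
    by exists x.
  - have -> : [set x | a * H < h x] = setT `&` h @^-1` `]a * H, +oo[%classic.
      by apply/seteqP; split=> x /=; rewrite in_itv/= andbT => // -[].
    exact: mh.
  move=> x y /= afx agy; apply: lt_le_trans (fgh x y).
  have -> : a * H = (a * F) `^ (1 - t) * (a * G) `^ t.
    rewrite !powRM ?(ltW Fp) ?(ltW Gp)// mulrACA -powRD ?subrK ?powRr1//.
    by rewrite oner_eq0.
  apply: ltr_pM; rewrite ?powR_ge0//; apply: gt0_ltr_powR => //; rewrite nnegrE//.
have IE : If `^ (1 - t) * Ig `^ t = H * ((F^-1 * If) `^ (1 - t) * (G^-1 * Ig) `^ t).
  have iF : 0 <= F^-1 by rewrite invr_ge0 ltW.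
  have iG : 0 <= G^-1 by rewrite invr_ge0 ltW.
  rewrite mulrACA -!powRM ?mulr_ge0// ?(ltW Fp) ?(ltW Gp) ?(ltW Ifp) ?(ltW Igp)//.
  by rewrite !mulrA !mulfV ?gt_eqF// !mul1r.
rewrite IE EFinM -lee_pdivlMl//; apply: le_trans key.
rewrite -!EFinM -EFinD lee_fin; apply: wamgm => //.
  by rewrite mulr_ge0// ?invr_ge0 ltW.
by rewrite mulr_ge0// ?invr_ge0 ltW.
Qed.

Definition convexV n (A : set 'rV[R]_n) :=
  forall x y t, A x -> A y -> 0 < t < 1 -> A ((1 - t) *: x + t *: y).

Definition vol n (A : set 'rV[R]_n) : R := fine (leb n A).

Lemma compact_mV n (A : set 'rV[R]_n) : compact A -> measurable (A : set (mV R n)).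
Proof.
by move=> cA; apply: mV_closed; apply: compact_closed => //; exact: norm_hausdorff.
Qed.

Lemma compact_cube n (A : set 'rV[R]_n) : compact A -> exists2 r, 0 <= r & A `<=` cubeV n r.
Proof.
move=> /compact_bounded[M [Mr MA]]; exists (`|M| + 1); first by rewrite addr_ge0.
move=> x Ax; have M1 : M < `|M| + 1 by rewrite (le_lt_trans (ler_norm M))// ltrDl.
by apply/asboolP; rewrite -norm_cubeV ?addr_ge0//; exact: (MA _ M1).
Qed.

Lemma compact_fin n (A : set 'rV[R]_n) : compact A -> (leb n A < +oo)%E.
Proof.
move=> cA; have [r _ Ar] := compact_cube cA.
by apply: leb_bounded_fin Ar; exact: compact_mV.
Qed.

Lemma volE n (A : set 'rV[R]_n) : compact A -> leb n A = (vol A)%:E.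
Proof. by move=> cA; rewrite /vol fineK// ge0_fin_numE ?measure_ge0// compact_fin. Qed.

Lemma vol_ge0 n (A : set 'rV[R]_n) : 0 <= vol A.
Proof. by rewrite fine_ge0. Qed.

Lemma vol_le n (A B : set 'rV[R]_n) : compact A -> compact B -> A `<=` B -> vol A <= vol B.
Proof.
move=> cA cB AB; rewrite -lee_fin -!volE//.
by apply: le_measure; rewrite ?inE//; exact: compact_mV.
Qed.

Lemma continuous_consr n t : continuous (fun v : 'rV[R]_n => consr t v).
Proof.
apply: continuous_rV => i; case: (unliftP 0 i) => [j ->|->].
  have -> : (fun x : 'rV[R]_n => consr t x 0 (lift 0 j)) = fun x => x 0 j.
    by apply/funext => x; rewrite consrS.
  exact: coord_continuous.
have -> : (fun x : 'rV[R]_n => consr t x 0 0) = fun=> t.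
  by apply/funext => x; rewrite consr0.
exact: cst_continuous.
Qed.

Lemma compact_sect n (A : set 'rV[R]_n.+1) t : compact A -> compact [set v | A (consr t v)].
Proof.
move=> cA; have [r r0 Ar] := compact_cube cA.
apply: (subclosed_compact _ (@compact_cubeV R n r)); last first.
  by move=> v /= /Ar vr j; have := vr (lift 0 j); rewrite consrS.
apply: (@preimage_closed _ _ (fun v : 'rV[R]_n => consr t v) A).
  by move=> x _; exact: continuous_consr.
by apply: compact_closed cA; exact: norm_hausdorff.
Qed.

Lemma convex_sect n (A : set 'rV[R]_n.+1) t : convexV A -> convexV [set v | A (consr t v)].
Proof.
move=> cA x y s /= Ax Ay s01; have := cA _ _ _ Ax Ay s01.
by rewrite consr_conv -mulrDl subrK mul1r.
Qed.

Lemma measurable_vsect n (A : set 'rV[R]_n.+1) : compact A ->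
  measurable_fun setT (fun t : R => vol [set v | A (consr t v)]).
Proof.
move=> cA; apply/measurable_EFinP.
apply: (eq_measurable_fun (fun t => leb n (xsection (@consp R n @^-1` A) t))).
  move=> t _ /=; rewrite -volE; last exact: compact_sect.
  by congr (leb n _); apply/seteqP; split=> v; rewrite /xsection/= inE.
apply: measurable_fun_xsection.
rewrite -[X in measurable X]setTI; apply: measurable_consp => //; exact: compact_mV.
Qed.

Lemma vol_sect n (A : set 'rV[R]_n.+1) : compact A ->
  (\int[leb1]_t (vol [set v | A (consr t v)])%:E = (vol A)%:E)%E.
Proof.
move=> cA; rewrite -volE// lebS; last exact: compact_mV.
by apply: eq_integral => t _; rewrite volE//; exact: compact_sect.
Qed.

(** Induction on the dimension: the volumes of parallel sections satisfy the
hypothesis of [prekopa_leindler] by the induction hypothesis, and integrate to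
the volumes. Their superlevel sets are intervals by the induction hypothesis
again, applied to two sections of one body. *)
Theorem brunn_minkowski n (A B C : set 'rV[R]_n) t : 0 < t < 1 ->
  compact A -> compact B -> compact C -> convexV A -> convexV B ->
  (forall x y, A x -> B y -> C ((1 - t) *: x + t *: y)) ->
  vol A `^ (1 - t) * vol B `^ t <= vol C.
Proof.
elim: n A B C t => [|n IHn] A B C t /andP[t0 t1] cA cB cC vA vB ABC.
  have t1' : 0 < 1 - t by rewrite subr_gt0.
  rewrite /vol !leb0/= !indicE.
  have [A0|A0] := boolP (0 \in A); last by rewrite powR0 ?gt_eqF// mul0r.
  have [B0|B0] := boolP (0 \in B); last by rewrite powR0 ?gt_eqF// mulr0.
  rewrite !powR1 mulr1; suff -> : 0 \in C by [].
  by apply/mem_set; have := ABC 0 0 (set_mem A0) (set_mem B0); rewrite !scaler0 addr0.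
have t1' : 0 < 1 - t by rewrite subr_gt0.
have [r r0 Ar] := compact_cube cA; have [s s0 Bs] := compact_cube cB.
pose f t := vol [set v | A (consr t v)]; pose g t := vol [set v | B (consr t v)].
pose h t := vol [set v | C (consr t v)].
have bnd (D : set 'rV[R]_n.+1) u x : compact D -> D `<=` cubeV n.+1 u ->
    vol [set v | D (consr x v)] <= vol (cubeV n u).
  move=> cD Du; apply: vol_le; [exact: compact_sect|exact: compact_cubeV|].
  by move=> v /= /Du H j; have := H (lift 0 j); rewrite consrS.
have supp (D : set 'rV[R]_n.+1) u x : D `<=` cubeV n.+1 u ->
    vol [set v | D (consr x v)] != 0 -> `|x| <= u.
  move=> Du; apply: contraNT => xu.
  have -> : [set v | D (consr x v)] = set0.
    apply/seteqP; split=> // v /= /Du/(_ 0); rewrite consr0 => xu'.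
    by rewrite xu' in xu.
  by rewrite /vol measure0.
have quasi (D : set 'rV[R]_n.+1) a : compact D -> convexV D ->
    is_interval [set x | a < vol [set v | D (consr x v)]].
  move=> cD vD x y /= ax ay z /andP[xz zy].
  have [a0|a0] := ltP a 0; first by rewrite (lt_le_trans a0)// vol_ge0.
  move: xz; rewrite le_eqVlt => /predU1P[<-//|xz].
  move: zy; rewrite le_eqVlt => /predU1P[->//|zy].
  pose l := (z - x) / (y - x).
  have l01 : 0 < l < 1 by exact: frac01.
  have zE : z = (1 - l) * x + l * y.
    rewrite -[LHS](subrK x) -(divfK (_ : y - x != 0) (z - x)) -/l; first by ring.
    by rewrite subr_eq0 gt_eqF// (lt_trans xz).
  have := IHn [set v | D (consr x v)] [set v | D (consr y v)] [set v | D (consr z v)] l l01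
    (compact_sect cD) (compact_sect cD) (compact_sect cD) (convex_sect vD) (convex_sect vD).
  have DD : forall v w, D (consr x v) -> D (consr y w) ->
     D (consr z ((1 - l) *: v + l *: w)).
    by move=> v w Dv Dw; have := vD _ _ _ Dv Dw l01; rewrite consr_conv -zE.
  move=> /(_ DD); apply: lt_le_trans.
  have -> : a = a `^ (1 - l) * a `^ l.
    by rewrite -powRD ?subrK ?powRr1// oner_eq0.
  have /andP[l0 l1] := l01.
  apply: ltr_pM; rewrite ?powR_ge0//; apply: gt0_ltr_powR => //; rewrite ?subr_gt0// nnegrE//;
    exact: vol_ge0.
have key := @prekopa_leindler f g h t (Num.max r s) (Num.max (vol (cubeV n r)) (vol (cubeV n s)))
  (vol A) (vol B).
rewrite -lee_fin -(vol_sect cC); apply: key.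
- by rewrite t0.
- exact: measurable_vsect.
- exact: measurable_vsect.
- exact: measurable_vsect.
- by move=> x; rewrite vol_ge0/= le_max (bnd _ _ _ cA Ar).
- by move=> x; rewrite vol_ge0/= le_max (bnd _ _ _ cB Bs) orbT.
- by move=> x; exact: vol_ge0.
- by move=> x fx; rewrite le_max (supp _ _ _ Ar fx).
- by move=> x gx; rewrite le_max (supp _ _ _ Bs gx) orbT.
- by move=> a; exact: quasi.
- by move=> a; exact: quasi.
- move=> x y; apply: IHn; rewrite ?t0//; [exact: compact_sect|exact: compact_sect|exact: compact_sect|
    exact: convex_sect|exact: convex_sect|].
  by move=> v w /= Av Bw; rewrite -consr_conv; exact: ABC.
- exact: vol_sect.
- exact: vol_sect.
Qed.

End BrunnMinkowski.

(** * Moments of a density on the line that is log-concave along rays from 0 *)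

Section LogConcaveMoments.
Context {R : realType}.
Notation leb1 := (@lebesgue_measure R).
Local Notation e := (expR 1 : R).

Lemma integral_laplace (a : R) : 0 < a ->
  (\int[leb1]_x (expR (- `|x| / a))%:E = (2 * a)%:E)%E.
Proof.
move=> a0; have ia0 : 0 < a^-1 by rewrite invr_gt0.
rewrite ge0_symfun_integralT//; last 2 first.
- move=> x; apply: continuous_comp; last exact: continuous_expR.
  apply: cvgM; last exact: cvg_cst.
  by apply: cvgN; exact: norm_continuous.
- by move=> x /=; rewrite normrN.
have H : (a^-1%:E * \int[leb1]_(x in [set x | (0 <= x)%R]) (expR (- `|x| / a))%:E = 1)%E.
  rewrite -(integral_exponential_pdf ia0) -ge0_integralZl_EFin//; last 3 first.
  - rewrite (_ : [set x : R | _] = `[0, +oo[%classic)//.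
    by apply/seteqP; split=> x; rewrite /= in_itv/= andbT.
  - apply/measurable_EFinP; apply: measurableT_comp => //.
    apply: (measurable_funS measurableT) => //.
    by apply: measurable_funM => //; apply: measurableT_comp => //; exact: measurable_normr.
  - exact: ltW.
  rewrite [LHS]integral_mkcond; apply: eq_integral => x _; rewrite patchE.
  case: ifPn => [|].
    rewrite inE/= => x0; rewrite exponential_pdfE// -EFinM; congr EFin.
    by rewrite ger0_norm//; congr (_ * expR _); ring.
  rewrite notin_setE/= => /negP; rewrite -ltNge => x0.
  by rewrite lt0_exponential_pdf.
have -> : (\int[leb1]_(x in [set x | (0 <= x)%R]) (expR (- `|x| / a))%:E = a%:E)%E.
  have E : (1 = a%:E * a^-1%:E)%E by rewrite -EFinM mulfV ?gt_eqF.
  by rewrite -[LHS]mul1e E -muleA H mule1.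
by rewrite EFinM.
Qed.

Variables (f : R -> R) (V : R).
Hypotheses (mf : measurable_fun setT f) (f0 : forall t, 0 <= f t).
Hypotheses (fmax : forall t, f t <= f 0) (V0 : 0 < V).
Hypothesis fV : (\int[leb1]_t (f t)%:E = V%:E)%E.
Hypothesis flog : forall l t, 0 < l < 1 -> f 0 `^ (1 - l) * f t `^ l <= f (l * t).

Lemma section_max_gt0 : 0 < f 0.
Proof.
rewrite lt_neqAle f0 andbT eq_sym; apply/eqP => f00.
move: V0; suff -> : V = 0 by rewrite ltxx.
apply/EFin_inj; rewrite -fV; apply: integral0_eq => t _; congr EFin.
by apply/eqP; rewrite eq_le f0 andbT -f00.
Qed.

(** As f <= f 0, at most half of the mass V lies in [-r, r] for
r = V / (4 f 0), and the other half contributes at least r^2 V / 2. *)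
Lemma second_moment_ge :
  ((V ^+ 3 / (32 * f 0 ^+ 2))%:E <= \int[leb1]_t (t ^+ 2 * f t)%:E)%E.
Proof.
have fp := section_max_gt0.
pose r := V / (4 * f 0); have r0 : 0 < r by rewrite divr_gt0// mulr_gt0.
have mt : measurable_fun setT (fun t : R => t ^+ 2 * f t).
  by apply: measurable_funM => //; exact: measurable_funX.
have H : ((r ^+ 2 * V)%:E <=
    \int[leb1]_t (t ^+ 2 * f t)%:E + (r ^+ 2 * f 0)%:E * (2 * r)%:E)%E.
  rewrite EFinM -fV -ge0_integralZl_EFin//; last 3 first.
  - by move=> t _; rewrite lee_fin.
  - exact/measurable_EFinP.
  - exact: sqr_ge0.
  have -> : (2 * r)%:E = (\int[leb1]_t (\1_(`[(- r), r]%classic) t)%:E)%E.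
    have L : leb1 `[(- r), r]%classic = (2 * r)%:E.
      rewrite lebesgue_measure_itv/= lte_fin (@lt_trans _ _ 0)// ?oppr_lt0//.
      by rewrite -EFinD; congr EFin; ring.
    by rewrite integral_indic// setIT; exact/esym/L.
  rewrite -ge0_integralZl_EFin//; last 2 first.
  - exact/measurable_EFinP.
  - by rewrite mulr_ge0// ?sqr_ge0// ltW.
  rewrite -ge0_integralD//; last 4 first.
  - by move=> t _; rewrite lee_fin mulr_ge0// sqr_ge0.
  - exact/measurable_EFinP.
  - by move=> t _; rewrite -EFinM lee_fin; apply: mulr_ge0; [rewrite mulr_ge0 ?sqr_ge0|rewrite indicE ler0n].
  - by apply: measurable_funeM; exact/measurable_EFinP.
  apply: ge0_le_integral => //.
  - by move=> t _; rewrite -EFinM lee_fin mulr_ge0// sqr_ge0.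
  - by apply: measurable_funeM; exact/measurable_EFinP.
  - apply: emeasurable_funD; first exact/measurable_EFinP.
    by apply: measurable_funeM; exact/measurable_EFinP.
  move=> t _; rewrite -!EFinM -EFinD lee_fin indicE.
  have [tr|tr] := boolP (t \in `[(- r), r]%classic).
    rewrite mulr1 ler_wpDl//; first by rewrite mulr_ge0// sqr_ge0.
    by rewrite ler_wpM2l// sqr_ge0.
  rewrite mulr0 addr0 ler_wpM2r//.
  move: tr; rewrite notin_setE/= in_itv/= => /negP; rewrite -ler_norml -ltNge => tr.
  by rewrite -[leRHS]real_normK ?num_real// lerXn2r// ?nnegrE ?ltW// (lt_trans r0).
rewrite -leeBlDr// in H; apply: le_trans H; rewrite -EFinM -EFinB lee_fin.
by rewrite le_eqVlt; apply/orP; left; apply/eqP; rewrite /r; field; rewrite gt_eqF.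
Qed.

(** At a point s with |s| = e V / f 0 the value is at most f 0 / e, since f is at
least f s on the whole segment from 0 to s. Log-concavity on the ray through s
turns this drop into exponential decay; before s the factor e makes the bound
weaker than f <= f 0. *)
Lemma logconcave_tail t : f t <= e * f 0 * expR (- `|t| / (e * V / f 0)).
Proof.
have fp := section_max_gt0.
set t0 := e * V / f 0; have t00 : 0 < t0 by rewrite divr_gt0// mulr_gt0// expR_gt0.
have [tt0|tt0] := ltP `|t| t0.
  apply: le_trans (fmax t) _; rewrite mulrAC ler_peMl// -expRD -[leLHS]expR0 ler_expR.
  by rewrite mulNr subr_ge0 ler_pdivrMr// mul1r ltW.
have tp : 0 < `|t| by apply: lt_le_trans tt0.
pose s := t0 / `|t| * t.
have sN : `|s| = t0 by rewrite normrM normrM normfV normr_id (gtr0_norm t00) divfK// gt_eqF.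
have fs : f s <= f 0 / e.
  have : (\int[leb1]_x ((f s)%:E * (\1_(if 0 <= s then `]0, t0[%classic else `](- t0), 0[%classic) x)%:E) <= V%:E)%E.
    rewrite -fV; apply: ge0_le_integral => //.
    - by move=> x _; rewrite -EFinM lee_fin mulr_ge0.
    - by apply: measurable_funeM; apply/measurable_EFinP; apply: measurable_indic; case: ifP.
    - exact/measurable_EFinP.
    move=> x _; rewrite -EFinM lee_fin indicE.
    case: (boolP (x \in _)) => xs; last by rewrite mulr0.
    rewrite mulr1; have s0 : s != 0 by rewrite -normr_eq0 sN gt_eqF.
    have [l l01 ->] : exists2 l, 0 < l < 1 & x = l * s.
      exists (x / s); last by rewrite divfK.
      move: xs; rewrite inE; case: ifP => [s0'|/negbT]; rewrite -?ltNge /=.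
        rewrite in_itv/= -sN ger0_norm// => /andP[x0 xs].
        have sp : 0 < s by rewrite lt_neqAle eq_sym s0.
        by rewrite divr_gt0//= ltr_pdivrMr// mul1r.
      move=> s0'; rewrite in_itv/= -sN ltr0_norm// opprK => /andP[xs x0].
      by rewrite ltr_ndivlMr// ltr_ndivrMr// mul0r mul1r x0 xs.
    apply: le_trans (flog _ l01).
    have /andP[l0 l1] := l01.
    rewrite -{1}[f s]powRr1// -{1}(subrK l 1) powRD ?subrK ?oner_eq0//.
    rewrite ler_wpM2r ?powR_ge0//.
    by apply: ge0_ler_powR; rewrite ?nnegrE ?subr_ge0//; exact: ltW.
  rewrite ge0_integralZl_EFin//; last first.
    by apply/measurable_EFinP; apply: measurable_indic; case: ifP.
  rewrite integral_indic//; last by case: ifP.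
  have L : leb1 (if 0 <= s then `]0, t0[%classic else `](- t0), 0[%classic) = t0%:E.
    case: ifP => _; rewrite lebesgue_measure_itv/= lte_fin ?t00 ?oppr_lt0 ?t00 -?EFinD ?oppr0 ?addr0 //.
    by rewrite add0r opprK.
  rewrite [X in (_ * X <= _)%E](_ : _ = t0%:E); last by rewrite setIT; exact: L.
  rewrite -EFinM lee_fin /t0 => H.
  rewrite ler_pdivlMr ?expR_gt0//.
  rewrite -(ler_pM2r V0); apply: le_trans (_ : f s * (e * V / f 0) * f 0 <= _).
    by rewrite le_eqVlt; apply/orP; left; apply/eqP; field; rewrite gt_eqF.
  by rewrite mulrC ler_pM2l.
have [tE|tt0'] := eqVneq `|t| t0.
  have -> : t = s by rewrite /s tE mulfV ?gt_eqF// mul1r.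
  apply: (le_trans fs); rewrite sN mulNr mulfV ?gt_eqF// expRN mulrAC mulfV ?gt_eqF ?expR_gt0//.
  by rewrite mul1r ler_pdivrMr ?expR_gt0// ler_peMr ?ltW// -expR0 ltr_expR.
have l01 : 0 < t0 / `|t| < 1.
  by rewrite divr_gt0//= ltr_pdivrMr// mul1r lt_neqAle eq_sym tt0'.
have := flog t l01; rewrite -/s; set l := t0 / `|t| in l01 *.
have /andP[l0 l1] := l01.
move=> /le_trans /(_ fs).
have -> : f 0 / e = f 0 `^ (1 - l) * (f 0 `^ l / e).
  by rewrite mulrA -powRD ?subrK ?powRr1 ?ltW// oner_eq0.
rewrite ler_pM2l ?powR_gt0// => H.
have {}H : f t <= (f 0 `^ l / e) `^ l^-1.
  have -> : f t = (f t `^ l) `^ l^-1 by rewrite -powRrM mulfV ?gt_eqF// powRr1.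
  rewrite ge0_ler_powR// ?invr_ge0 ?ltW// nnegrE ?powR_ge0//.
  by rewrite divr_ge0 ?powR_ge0 ?expR_ge0.
apply: le_trans H _.
have E1 : e^-1 = expR (-1) by rewrite expRN.
rewrite powRM ?powR_ge0// ?invr_ge0 ?expR_ge0// -powRrM mulfV ?gt_eqF// powRr1 ?(ltW fp)//.
rewrite E1 -expRM [leRHS]mulrAC -expRD [leRHS]mulrC ler_pM2l// ler_expR /l invf_div.
by rewrite !mulNr mul1r ler_wpDl.
Qed.

(** Since (y / q)^q <= exp y for y >= 0, half of the exponential decay absorbs
the power. *)
Lemma moment_le q : 1 <= q ->
  (\int[leb1]_t (`|t| `^ q * f t)%:E <=
    (4 * e ^+ 2 * V * (2 * q * (e * V / f 0)) `^ q)%:E)%E.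
Proof.
move=> q1; have q0 : 0 < q by apply: lt_le_trans q1.
have fp := section_max_gt0.
set t0 := e * V / f 0; have t00 : 0 < t0 by rewrite divr_gt0// mulr_gt0// expR_gt0.
have c0 : 0 <= e * f 0 * (2 * q * t0) `^ q.
  by rewrite !mulr_ge0 ?powR_ge0 ?expR_ge0// ltW.
apply: (@le_trans _ _ (\int[leb1]_t ((e * f 0 * (2 * q * t0) `^ q)%:E * (expR (- `|t| / (2 * t0)))%:E))%E).
  have ml : measurable_fun setT (fun t : R => expR (- `|t| / (2 * t0))).
    apply: measurableT_comp => //; apply: measurable_funM => //.
    by apply: measurableT_comp => //; exact: measurable_normr.
  apply: ge0_le_integral => //.
  - by move=> t _; rewrite lee_fin mulr_ge0// powR_ge0.
  - apply/measurable_EFinP; apply: measurable_funM => //.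
    by apply: (@measurableT_comp _ _ _ _ _ _ (@powR R ^~ q)) => //; exact: measurableT_comp.
  - by apply: measurable_funeM; exact/measurable_EFinP.
  move=> t _; rewrite -EFinM lee_fin.
  apply: le_trans (ler_wpM2l (powR_ge0 _ _) (logconcave_tail t)) _.
  rewrite -/t0 mulrCA -[leRHS]mulrA ler_pM2l ?mulr_gt0 ?expR_gt0//.
  have t2 : 0 < 2 * q * t0 by apply: mulr_gt0 => //; apply: mulr_gt0.
  have -> : `|t| `^ q = (2 * q * t0) `^ q * (`|t| / (2 * q * t0)) `^ q.
    rewrite -powRM; [|exact: ltW|by rewrite divr_ge0// ltW].
    by rewrite mulrC divfK// gt_eqF.
  rewrite -[leLHS]mulrA ler_pM2l ?powR_gt0//.
  have -> : expR (- `|t| / (2 * t0)) = expR (`|t| / (2 * q * t0)) `^ q * expR (- `|t| / t0).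
    rewrite -expRM -expRD; congr expR; field; rewrite !gt_eqF//.
  rewrite ler_wpM2r ?expR_ge0//; apply: ge0_ler_powR; rewrite ?nnegrE ?expR_ge0//.
  - exact: ltW.
  - by rewrite divr_ge0// ltW.
  - by apply: le_trans (expR_ge1Dx _); rewrite ler_wpDl.
rewrite ge0_integralZl_EFin//; last first.
  apply/measurable_EFinP; apply: measurableT_comp => //; apply: measurable_funM => //.
  by apply: measurableT_comp => //; exact: measurable_normr.
have t20 : 0 < 2 * t0 by rewrite mulr_gt0.
rewrite [X in (_ * X <= _)%E](integral_laplace t20) -EFinM lee_fin.
rewrite le_eqVlt; apply/orP; left; apply/eqP.
have -> : f 0 = e * V / t0 by rewrite /t0; field; rewrite !gt_eqF ?expR_gt0.
by field; rewrite gt_eqF.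
Qed.

End LogConcaveMoments.

(** * Moments of linear forms on a symmetric convex body *)

Section BodyMoments.
Context {R : realType}.
Notation leb1 := (@lebesgue_measure R).
Local Notation e := (expR 1 : R).

Definition body n (K : set 'rV[R]_n) :=
  [/\ compact K, convexV K & forall x, K x -> K (- x)].

Lemma vol_opp n (A : set 'rV[R]_n) : compact A -> vol [set v | A (- v)] = vol A.
Proof.
move=> cA; rewrite /vol.
have -> : [set v | A (- v)] = [set v | A (v *m (-1)%:M)].
  by apply/seteqP; split=> v /=; rewrite mul_mx_scalar scaleN1r.
rewrite leb_linear; last exact: compact_mV.
  by rewrite det_scalar normrX normrN1 expr1n invr1 mul1e.
by rewrite unitmxE det_scalar unitfE expf_eq0 oppr_eq0 oner_eq0 andbF.
Qed.

Lemma consr_opp n t (v : 'rV[R]_n) : - consr t v = consr (- t) (- v).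
Proof.
have E (M : 'rV[R]_n.+1) j : (- M) 0 j = - M 0 j by rewrite mxE.
apply/rowP => i; rewrite E; case: (unliftP 0 i) => [j ->|->]; rewrite ?consrS ?consr0//.
by rewrite mxE.
Qed.

Lemma sect_log n (K : set 'rV[R]_n.+1) s t l : compact K -> convexV K -> 0 < l < 1 ->
  vol [set v | K (consr s v)] `^ (1 - l) * vol [set v | K (consr t v)] `^ l <=
  vol [set v | K (consr ((1 - l) * s + l * t) v)].
Proof.
move=> cK vK l01; apply: brunn_minkowski => //; do ?exact: compact_sect; do ?exact: convex_sect.
by move=> x y /= Kx Ky; rewrite -consr_conv; exact: vK.
Qed.

(** By symmetry the sections at t and - t have the same volume, and the section
at 0 is midway between them. *)
Lemma sect_max n (K : set 'rV[R]_n.+1) t : body K ->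
  vol [set v | K (consr t v)] <= vol [set v | K (consr 0 v)].
Proof.
move=> [cK vK sK].
have h : 0 < (2^-1 : R) < 1 by rewrite invr_gt0 ltr0n/= invf_lt1// ltr1n.
have := sect_log (- t) t cK vK h.
rewrite (_ : (1 - 2^-1) * - t + 2^-1 * t = 0); last by field.
rewrite (_ : vol [set v | K (consr (- t) v)] = vol [set v | K (consr t v)]).
  by rewrite -powRD ?subrK ?powRr1 ?vol_ge0// oner_eq0.
rewrite -[RHS]vol_opp; last exact: compact_sect.
congr vol; apply/seteqP; split=> v /= /sK; rewrite consr_opp ?opprK//.
Qed.

Lemma integral_first n (K : set 'rV[R]_n.+1) (phi : R -> R) : compact K ->
  measurable_fun setT phi -> (forall t, 0 <= phi t) ->
  (\int[leb n.+1]_(x in K) (phi ((x : 'rV[R]_n.+1) 0 0))%:E =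
   \int[leb1]_t (phi t * vol [set v | K (consr t v)])%:E)%E.
Proof.
move=> cK mphi phi0; rewrite integral_mkcond integral_lebS; first last.
- by move=> x; rewrite patchE; case: ifP => // _; rewrite lee_fin.
- apply/(measurable_restrictT _ (compact_mV cK)).
  apply: (measurable_funS measurableT) => //; apply/measurable_EFinP.
  by apply: measurableT_comp => //; exact: coord_mV.
apply: eq_integral => t _.
transitivity (\int[leb n]_(v in [set v | K (consr t v)]) (phi t)%:E)%E.
  rewrite [RHS]integral_mkcond; apply: eq_integral => v _; rewrite !patchE consr0.
  by congr (if _ then _ else _); apply/idP/idP; rewrite !inE.
rewrite integral_cst; last by apply: compact_mV; exact: compact_sect.
by rewrite EFinM -volE//; exact: compact_sect.
Qed.

Section standard.
Variables (n : nat) (K : set 'rV[R]_n.+1).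
Hypotheses (bK : body K) (V0 : 0 < vol K).
Let f t := vol [set v | K (consr t v)].

Let cK : compact K. Proof. by case: bK. Qed.
Let mf : measurable_fun setT f. Proof. exact: measurable_vsect. Qed.
Let f0 t : 0 <= f t. Proof. exact: vol_ge0. Qed.
Let fmax t : f t <= f 0. Proof. exact: sect_max. Qed.
Let fV : (\int[leb1]_t (f t)%:E = (vol K)%:E)%E. Proof. exact: vol_sect. Qed.
Let flog l t : 0 < l < 1 -> f 0 `^ (1 - l) * f t `^ l <= f (l * t).
Proof.
case: bK => _ vK _ l01; have := sect_log 0 t cK vK l01.
by rewrite mulr0 add0r.
Qed.

Lemma first_section_gt0 : 0 < f 0.
Proof. exact: (section_max_gt0 f0 fmax V0 fV). Qed.

Lemma first_second_moment :
  ((vol K ^+ 3 / (32 * f 0 ^+ 2))%:E <=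
   \int[leb n.+1]_(x in K) (((x : 'rV[R]_n.+1) 0 0) ^+ 2)%:E)%E.
Proof.
rewrite (integral_first (phi := fun t => t ^+ 2))//.
- exact: (second_moment_ge mf f0 fmax V0 fV).
- by move=> t; rewrite sqr_ge0.
Qed.

Lemma first_moment q : 1 <= q ->
  (\int[leb n.+1]_(x in K) (`|(x : 'rV[R]_n.+1) 0 0| `^ q)%:E <=
   (4 * e ^+ 2 * vol K * (2 * q * (e * vol K / f 0)) `^ q)%:E)%E.
Proof.
move=> q1; rewrite (integral_first (phi := fun t => `|t| `^ q))//.
- exact: (moment_le mf f0 fmax V0 fV flog).
- by apply: (@measurableT_comp _ _ _ _ _ _ (@powR R ^~ q)) => //; exact: measurableT_comp.
Qed.

End standard.

Lemma col_frame n (u : 'rV[R]_n.+1) (U : 'M[R]_(n, n.+1)) : dot u u = 1 ->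
  U *m U^T = 1%:M -> U *m u^T = 0 ->
  (col_mx u U : 'M[R]_(1 + n)) *m (col_mx u U : 'M[R]_(1 + n))^T = 1%:M.
Proof.
move=> uu UU Uu; have uU : u *m U^T = 0 by rewrite -[u]trmxK -trmx_mul Uu trmx0.
rewrite tr_col_mx mul_col_row UU Uu uU.
have -> : u *m u^T = 1%:M by rewrite [LHS]mx11_scalar -/(dot u u) uu.
by rewrite -scalar_mx_block.
Qed.

Lemma orth_unit n (O : 'M[R]_n) : O *m O^T = 1%:M -> O \in unitmx /\ `|\det O| = 1.
Proof.
move=> OO; have D : \det O ^+ 2 = 1 by rewrite expr2 -{2}det_tr -det_mulmx OO det1.
have DN : `|\det O| = 1.
  by apply/eqP; rewrite -(eqrXn2 (n := 2)) ?expr1n// real_normK ?num_real// D.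
by split=> //; rewrite unitmxE unitfE -normr_gt0 DN.
Qed.

Lemma integral_orth n (O : 'M[R]_n) (K : set 'rV[R]_n) (F : 'rV[R]_n -> \bar R) :
  O *m O^T = 1%:M -> compact K -> measurable_fun [set: mV R n] F -> (forall x, 0 <= F x)%E ->
  (\int[leb n]_(x in [set x | K (x *m O)]) F (x *m O) = \int[leb n]_(x in K) F x)%E.
Proof.
move=> OO cK mF F0; have [uO dO] := orth_unit OO.
have mO : measurable_fun [set: mV R n] (fun x : mV R n => (x : 'rV[R]_n) *m O : mV R n).
  by apply: continuous_mVV; exact: continuous_mulmx.
have mK := compact_mV cK.
transitivity (\int[push (leb n) mO]_(x in K) F x)%E.
  rewrite ge0_integral_pushforward//; exact: measurable_funS mF.
apply: eq_measure_integral => A mA _; rewrite /push/= /pushforward.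
by have := leb_linear uO mA; rewrite dO invr1 mul1e.
Qed.

Lemma orth_body n (O : 'M[R]_n) (K : set 'rV[R]_n) : O *m O^T = 1%:M -> body K ->
  body [set x | K (x *m O)] /\ vol [set x | K (x *m O)] = vol K.
Proof.
move=> OO [cK vK sK]; have [uO dO] := orth_unit OO.
have OT : O^T *m O = 1%:M by apply: mulmx1C.
split; last first.
  by rewrite /vol leb_linear//; [rewrite dO invr1 mul1e|exact: compact_mV].
split.
- have -> : [set x | K (x *m O)] = (fun y : 'rV[R]_n => y *m O^T) @` K.
    apply/seteqP; split=> [x Kx|_ [y Ky <-]] /=.
      by exists (x *m O) => //; rewrite -mulmxA OO mulmx1.
    by rewrite -mulmxA OT mulmx1.
  apply: continuous_compact => //; apply: continuous_subspaceT.
  exact: continuous_mulmx.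
- by move=> x y t /= Kx Ky t01; rewrite mulmxDl -!scalemxAl; exact: vK.
- by move=> x /= Kx; rewrite mulNmx; exact: sK.
Qed.

(** The factor 12 e comes from the decay rate of the marginal; 4 e^2 is a factor
in front of the q-th moment, moved inside the power because q >= 1. *)
Definition moment_cst : R := 48 * e ^+ 3.

Lemma moment_cst_gt0 : 0 < moment_cst.
Proof. by rewrite mulr_gt0// exprn_gt0// expR_gt0. Qed.

(** After a rotation taking u to the first coordinate, these are the moments of
the marginal of K, whose value at 0 is the volume w of the central section. The
first bound says V / w <= 6 s, which replaces V / w by s in the second. *)
Lemma direction_moments n (K : set 'rV[R]_n.+1) (u : 'rV[R]_n.+1) (U : 'M[R]_(n, n.+1)) s q :
  body K -> 0 < vol K -> dot u u = 1 -> U *m U^T = 1%:M -> U *m u^T = 0 -> 0 <= s -> 1 <= q ->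
  (\int[leb n.+1]_(x in K) (dot x u ^+ 2)%:E = (vol K * s ^+ 2)%:E)%E ->
  vol K <= 6 * vol [set v | K (v *m U)] * s /\
  (\int[leb n.+1]_(x in K) (`|dot x u| `^ q)%:E <= (vol K * (moment_cst * q * s) `^ q)%:E)%E.
Proof.
move=> bK V0 uu UU Uu s0 q1 Hs; have q0 : 0 < q by apply: lt_le_trans q1.
have [cK _ _] := bK.
pose O : 'M[R]_(1 + n) := col_mx u U.
have OO : O *m O^T = 1%:M by exact: col_frame.
have [bK' vK'] := orth_body (n := n.+1) OO bK.
set K' := [set x : 'rV[R]_n.+1 | K (x *m O)] in bK' vK'.
have dE (x : 'rV[R]_n.+1) : dot (x *m O) u = x 0 0.
  rewrite /dot -(tailrK x) /consr -(mulmxA _ O) /O mul_col_mx Uu.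
  have -> : u *m u^T = 1%:M by rewrite [LHS]mx11_scalar -/(dot u u) uu.
  apply: etrans; first by apply: congr1; exact: erefl.
  rewrite (_ : row_mx _ _ *m _ = const_mx (x 0 0)); first by rewrite mxE consr0.
  by apply: etrans; [exact: mul_row_col|rewrite mulmx1 mulmx0 addr0].
have mdot : measurable_fun [set: mV R n.+1] (fun x : 'rV[R]_n.+1 => dot x u).
  apply: continuous_mV => x.
  have := @continuous_mulmx R _ _ u^T x => H.
  exact: (continuous_comp H (@coord_continuous R 1 1 0 0 _)).
have cU v : consr 0 v *m O = v *m U.
  have E := mul_row_col (const_mx 0 : 'M[R]_1) v u U.
  apply: (etrans E); by rewrite (_ : const_mx 0 = 0) ?mul0mx ?add0r.
have f0E : vol [set v | K' (consr 0 v)] = vol [set v | K (v *m U)].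
  by congr vol; apply/seteqP; split=> v; rewrite /K'/= cU.
have V0' : 0 < vol K' by rewrite vK'.
have := first_section_gt0 bK' V0'; rewrite f0E; set w := vol _ => w0.
have I2 : (\int[leb n.+1]_(x in K') (((x : 'rV[R]_n.+1) 0 0) ^+ 2)%:E = (vol K * s ^+ 2)%:E)%E.
  rewrite -Hs -(integral_orth OO cK (F := fun x => (dot x u ^+ 2)%:E)).
  - by apply: eq_integral => x _; rewrite dE.
  - by apply/measurable_EFinP; exact: measurable_funX.
  - by move=> x; rewrite lee_fin sqr_ge0.
have H2 := first_second_moment bK' V0'.
rewrite I2 f0E -/w lee_fin vK' in H2.
have H : vol K <= 6 * w * s.
  have H3 : vol K ^+ 2 <= (6 * w * s) ^+ 2.
    move: H2; rewrite ler_pdivrMr ?mulr_gt0 ?exprn_gt0// exprSr => H2.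
    have {}H2 : vol K ^+ 2 <= s ^+ 2 * (32 * w ^+ 2).
      by rewrite -(ler_pM2r V0); apply: le_trans H2 _; rewrite [vol K * _]mulrC mulrAC.
    apply: le_trans H2 _; rewrite !exprMn [leRHS]mulrC ler_wpM2l ?sqr_ge0//.
    by rewrite ler_wpM2r ?sqr_ge0// -natrX ler_nat.
  rewrite -ler_sqr// nnegrE ?vol_ge0//.
  by rewrite mulr_ge0// mulr_ge0// ltW.
split=> //.
have I1 : (\int[leb n.+1]_(x in K) (`|dot x u| `^ q)%:E =
   \int[leb n.+1]_(x in K') (`|(x : 'rV[R]_n.+1) 0 0| `^ q)%:E)%E.
  rewrite -(integral_orth OO cK (F := fun x => (`|dot x u| `^ q)%:E)).
  - by apply: eq_integral => x _; rewrite dE.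
  - apply/measurable_EFinP.
    by apply: (@measurableT_comp _ _ _ _ _ _ (@powR R ^~ q)) => //; exact: measurableT_comp.
  - by move=> x; rewrite lee_fin powR_ge0.
rewrite I1; apply: le_trans (first_moment bK' V0' q1) _.
rewrite lee_fin vK' f0E -/w mulrAC [leRHS]mulrC ler_pM2r//.
have e0 : 0 < e := expR_gt0 _.
have Hw : vol K / w <= 6 * s by rewrite ler_pdivrMr// mulrAC.
have c4 : 1 <= 4 * e ^+ 2.
  have : 1 <= e ^+ 2 by rewrite exprn_ege1// -expR0 ler_expR.
  by lra.
have c40 : 0 <= 4 * e ^+ 2 by apply: le_trans c4.
have b0 : 0 <= 2 * q * (e * vol K / w).
  apply: mulr_ge0; first by rewrite mulr_ge0 ?ler0n ?ltW.
  exact: divr_ge0 (mulr_ge0 (ltW e0) (ltW V0)) (ltW w0).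
have bb : 2 * q * (e * vol K / w) <= 12 * e * q * s.
  rewrite -(mulrA e) (_ : 12 * e * q * s = 2 * q * (e * (6 * s))); last by ring.
  by rewrite !ler_wpM2l ?mulr_ge0// ltW.
have d0 : 0 <= 12 * e * q * s by apply: le_trans bb.
apply: (@le_trans _ _ ((4 * e ^+ 2) `^ q * (12 * e * q * s) `^ q)).
  apply: (ler_pM c40 (powR_ge0 _ _)).
    by rewrite -{1}[4 * _]powRr1// ler_powR.
  by apply: ge0_ler_powR; rewrite ?nnegrE// ltW.
rewrite -powRM// le_eqVlt; apply/orP; left; apply/eqP; congr (_ `^ _).
by rewrite /moment_cst; ring.
Qed.

End BodyMoments.

(** * Volumes of zonotopes *)

Section Zonotopes.
Context {R : realType}.
Notation leb1 := (@lebesgue_measure R).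

Definition perp n (u : 'rV[R]_n) : {vspace 'rV[R]_n} :=
  lker (linfun (mulmxr u^T : 'rV[R]_n -> 'rV[R]_1)).

Lemma mem_perp n (u x : 'rV[R]_n) : (x \in perp u) = (dot x u == 0).
Proof.
rewrite memv_ker lfunE/=; apply/eqP/eqP => [E|E]; first by rewrite /dot E mxE.
by rewrite [LHS]mx11_scalar -/(dot x u) E; apply/matrixP => i j; rewrite !mxE mul0rn.
Qed.

Lemma dim_perp n (u : 'rV[R]_n) : dot u u != 0 -> (\dim (perp u)).+1 = n.
Proof.
move=> uu; set f := linfun (mulmxr u^T : 'rV[R]_n -> 'rV[R]_1).
have := limg_ker_dim f fullv; rewrite capfv dimvf/= /dim/= mul1n -/(perp u).
suff -> : \dim (f @: fullv) = 1%N by rewrite addn1.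
apply/eqP; rewrite eqn_leq; apply/andP; split.
  by apply: leq_trans (dimvS (subvf _)) _; rewrite dimvf/= /dim/= mul1n.
rewrite lt0n dimv_eq0; apply/eqP => f0.
have : f u \in (f @: fullv)%VS by apply: memv_img; exact: memvf.
rewrite f0 memv0 lfunE/= => /eqP E; move: uu; rewrite /dot E mxE eqxx //.
Qed.

Lemma perp_frame n (u : 'rV[R]_n.+1) : dot u u = 1 ->
  exists U : 'M[R]_(n, n.+1), U *m U^T = 1%:M /\ U *m u^T = 0.
Proof.
move=> uu; have [U [UU UH]] := orthonormal_frames_neq0 (perp u).
have d : \dim (perp u) = n by apply: succn_inj; rewrite dim_perp// uu oner_neq0.
move: (\dim _) d U UU UH => k kn; subst k => U UU UH.
exists U; split=> //; apply/matrixP => i j; rewrite (ord1 j) [RHS]mxE.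
have := UH i; rewrite mem_perp => /eqP <-.
by rewrite /dot -row_mul [RHS]mxE.
Qed.

Lemma normalize n (u : 'rV[R]_n) : u != 0 ->
  exists2 c : R, 0 < c & dot (c^-1 *: u) (c^-1 *: u) = 1 /\ c ^+ 2 = dot u u.
Proof.
move=> u0; have uu : 0 < dot u u by rewrite lt_neqAle eq_sym dot_eq0 u0 dot_ge0.
exists (Num.sqrt (dot u u)); first by rewrite sqrtr_gt0.
have E : Num.sqrt (dot u u) ^+ 2 = dot u u by rewrite sqr_sqrtr// ltW.
split=> //; rewrite /dot linearZ/= -scalemxAl -scalemxAr scalerA mxE -/(dot u u).
by rewrite -invfM -expr2 E mulVf// gt_eqF.
Qed.

Lemma rotate_to_first n (z : 'rV[R]_n.+1) : z != 0 ->
  exists2 A : 'M[R]_n.+1, A \in unitmx & z *m A = consr 1 0.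
Proof.
move=> z0; have [c c0 [uu _]] := normalize z0; set u := c^-1 *: z in uu.
have [U [UU Uu]] := perp_frame uu.
have uU : u *m U^T = 0 by rewrite -[u]trmxK -trmx_mul Uu trmx0.
have OO := col_frame uu UU Uu; set O := col_mx u U in OO.
have [uO _] := orth_unit OO.
exists (c^-1 *: (O : 'M[R]_n.+1)^T).
  by rewrite unitmxZ ?unitmx_tr// unitfE invr_eq0 gt_eqF.
rewrite -scalemxAr scalemxAl -/u.
have E := mul_mx_row u (u^T) (U^T).
apply: (etrans (congr1 (mulmx u) (tr_col_mx u U))).
apply: (etrans E); rewrite uU /consr; congr row_mx.
by rewrite [LHS]mx11_scalar -/(dot u u) uu; apply/rowP => i; rewrite (ord1 i) !mxE.
Qed.

(** The sum of the segments [- z_j, z_j] over the rows z_j of z. *)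
Definition zono N n (z : 'M[R]_(N, n)) : set 'rV[R]_n :=
  (fun a : 'rV[R]_N => a *m z) @` cubeV N 1.

Lemma compact_zono N n (z : 'M[R]_(N, n)) : compact (zono z).
Proof.
apply: continuous_compact; last exact: compact_cubeV.
apply: continuous_subspaceT; exact: continuous_mulmx.
Qed.

Lemma convex_zono N n (z : 'M[R]_(N, n)) : convexV (zono z).
Proof.
move=> _ _ t [a ca <-] [b cb <-] /andP[t0 t1].
exists ((1 - t) *: a + t *: b); last by rewrite mulmxDl !scalemxAl.
move=> j; rewrite !mxE; apply: le_trans (ler_normD _ _) _.
have t1' : 0 < 1 - t by rewrite subr_gt0.
rewrite !normrM (gtr0_norm t0) (gtr0_norm t1').
have := ca j; have := cb j => b1 a1.
have H1 := ler_wpM2l (ltW t1') a1; have H2 := ler_wpM2l (ltW t0) b1.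
by apply: le_trans (lerD H1 H2) _; rewrite !mulr1 subrK.
Qed.

(** A line in the first direction that meets Z does so in an interval, which
adding the segment [- e_1, e_1] lengthens by 2. The lines that meet Z are
parametrised by its projection. *)
Lemma vol_add_segment n (Z Z1 : set 'rV[R]_n.+1) : compact Z -> convexV Z -> compact Z1 ->
  (forall s x, `|s| <= 1 -> Z x -> Z1 (consr s 0 + x)) ->
  vol Z + 2 * vol (@tailr R n @` Z) <= vol Z1.
Proof.
move=> cZ vZ cZ1 ZZ1.
have cT : compact (@tailr R n @` Z).
  apply: continuous_compact => //; apply: continuous_subspaceT.
  apply: continuous_rV => j.
  have -> : (fun x : 'rV[R]_n.+1 => tailr x 0 j) = fun x => x 0 (lift 0 j).
    by apply/funext => x; rewrite mxE.
  exact: coord_continuous.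
have mfib (Y : set 'rV[R]_n.+1) : compact Y ->
    measurable_fun [set: mV R n] (fun v : mV R n => leb1 [set t | Y (consr t v)]).
  move=> cY.
  apply: (eq_measurable_fun (fun v => leb1 (ysection (@consp R n @^-1` Y) v))).
    by move=> t _; congr (leb1 _); apply/seteqP; split=> v; rewrite /ysection/= inE.
  apply: measurable_fun_ysection.
  rewrite -[X in measurable X]setTI; apply: measurable_consp => //; exact: compact_mV.
have mT := compact_mV cT.
rewrite -lee_fin EFinD EFinM -!volE//.
rewrite (lebS2 (compact_mV cZ)) (lebS2 (compact_mV cZ1)).
have -> : leb n (@tailr R n @` Z) = (\int[leb n]_v (\1_(@tailr R n @` Z) v)%:E)%E.
  by rewrite integral_indic// setIT.
rewrite -ge0_integralZl_EFin//; last exact/measurable_EFinP/measurable_indic.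
rewrite -ge0_integralD//; last 2 first.
- exact: mfib.
- by apply: measurable_funeM; exact/measurable_EFinP/measurable_indic.
apply: ge0_le_integral => //.
- by move=> v _; rewrite adde_ge0// -EFinM lee_fin mulr_ge0// indicE ler0n.
- apply: emeasurable_funD; first exact: mfib.
  by apply: measurable_funeM; exact/measurable_EFinP/measurable_indic.
- exact: mfib.
move=> v _; rewrite indicE; have [|vZ0] := boolP (_ \in _); last first.
  rewrite mulr0n mule0 adde0.
  have mf Y : compact Y -> [set t | Y (consr t v)] \in measurable.
    by move=> cY; rewrite inE; apply: measurable_fiber; exact: compact_mV.
  apply: le_measure; [exact: mf|exact: mf|].
  move=> t /= Zt; have := ZZ1 0 _ _ Zt; rewrite normr0 consrD add0r add0r; exact.
rewrite inE => -[x Zx xv].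
have [r r0 Zr] := compact_cube cZ.
set X := [set t | Z (consr t v)].
have X0 : X !=set0 by exists (x 0 0); rewrite /X/= -xv tailrK.
have Xr t : X t -> `|t| <= r by move=> /Zr/(_ 0); rewrite consr0.
have lX : has_lbound X by exists (- r) => t /Xr; rewrite ler_norml => /andP[].
have uX : has_ubound X by exists r => t /Xr; rewrite ler_norml => /andP[].
have iX : is_interval X.
  move=> s t /= Zs Zt z /andP[].
  rewrite le_eqVlt => /predU1P[<-//|sz]; rewrite le_eqVlt => /predU1P[->//|zt].
  have := vZ _ _ _ Zs Zt (frac01 sz zt); rewrite consr_conv -scalerDl subrK scale1r.
  rewrite /X/= [X in Z (consr X v) -> _](_ : _ = z)//; set l := (z - s) / (t - s).
  have E : l * (t - s) = z - s by rewrite divfK// subr_eq0 gt_eqF// (lt_trans sz).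
  have -> : (1 - l) * s + l * t = s + l * (t - s) by ring.
  by rewrite E addrC subrK.
have ab : inf X <= sup X.
  by case: X0 => y Xy; apply: le_trans (ge_inf lX Xy) (ub_le_sup uX Xy).
rewrite mulr1n mule1; apply: (@le_trans _ _ ((sup X - inf X) + 2)%:E).
  have := itv_len iX X0 lX uX => H.
  exact: (leeD H (lexx 2%:E)).
apply: (@le_trans _ _ (leb1 `]inf X - 1, sup X + 1[%classic)).
  rewrite lebesgue_measure_itv/= lte_fin ifT; last by lra.
  by rewrite -EFinB lee_fin; lra.
apply: le_measure; rewrite ?inE//.
  by apply: measurable_fiber; exact: compact_mV.
move=> t0; rewrite /= in_itv/=; move: (t0 : R) => t /andP[ta tb].
have l01 := frac01 ta tb; set l := (_ / _) in l01.
have := itv_inner iX X0 lX uX l01; set y := _ + _ => Xy.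
have lE : l * (sup X + 1 - (inf X - 1)) = t - (inf X - 1).
  by rewrite divfK// subr_eq0 gt_eqF// (lt_trans ta).
have -> : consr t v = consr (t - y) 0 + consr y v by rewrite consrD subrK add0r.
apply: ZZ1 => //; rewrite ler_norml /y; case/andP: l01 => l0 l1.
apply/andP; split; lra.
Qed.

Lemma zono_mul N n (z : 'M[R]_(N, n)) (A : 'M[R]_n) : A \in unitmx ->
  vol (zono (z *m A)) = `|\det A| * vol (zono z).
Proof.
move=> uA; have A0 : \det A != 0 by move: uA; rewrite unitmxE unitfE.
have -> : zono z = [set v | zono (z *m A) (v *m A)].
  apply/seteqP; split=> [_ [a ca <-]|v [a ca]] /=; first by exists a; rewrite // mulmxA.
  by rewrite mulmxA => /(can_inj (mulmxK uA)) <-; exists a.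
rewrite /vol leb_linear//; last by apply: compact_mV; exact: compact_zono.
rewrite [X in fine (_ * X)]volE; last exact: compact_zono.
by rewrite -EFinM/= mulrA mulfV ?mul1r// normr_eq0.
Qed.

(** The rank-one term changes the first row only, and the determinant is linear
in that row. *)
Lemma det_row0 n (v : 'rV[R]_n.+1) (G : 'M[R]_n.+1) :
  \det ((consr 1 0)^T *m v + G) = \det G + \det (\matrix_i (if i == 0 then v else row i G)).
Proof.
set A := _ + G; set D := \matrix_i _.
rewrite (@determinant_multilinear _ _ A G D 0 1 1) ?mul1r//.
- rewrite !scale1r rowK eqxx addrC /A raddfD/=; congr (_ + _).
  apply/rowP => j; rewrite !mxE big_ord1 !mxE.
  by have := consr0 1 (0 : 'rV[R]_n); rewrite /consr mxE => ->; rewrite mul1r.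
- apply/matrixP => i j; rewrite /A !mxE big_ord1 !mxE.
  have := consrS 1 (0 : 'rV[R]_n) i; rewrite /consr mxE => ->.
  by rewrite mxE mul0r add0r.
- apply/matrixP => i j; rewrite /A !mxE big_ord1 !mxE.
  have := consrS 1 (0 : 'rV[R]_n) i; rewrite /consr mxE => ->.
  by rewrite mxE mul0r add0r.
Qed.

Lemma dot_mul_orth n (O : 'M[R]_n) (x : 'rV[R]_n) : O *m O^T = 1%:M ->
  dot (x *m O) (x *m O) = dot x x.
Proof. by move=> OO; rewrite /dot trmx_mul mulmxA -(mulmxA x) OO mulmx1. Qed.

Lemma dot_row_mx m n (a : 'rV[R]_m) (b : 'rV[R]_n) :
  dot (row_mx a b) (row_mx a b) = dot a a + dot b b.
Proof. by rewrite /dot tr_row_mx mul_row_col mxE. Qed.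

Lemma dot_frame_le n (u : 'rV[R]_n.+1) (U : 'M[R]_(n, n.+1)) x : dot u u = 1 ->
  U *m U^T = 1%:M -> U *m u^T = 0 -> dot (x *m U^T) (x *m U^T) <= dot x x.
Proof.
move=> uu UU Uu; have OO := col_frame uu UU Uu; set O := (col_mx u U) in OO.
have OTO : O^T *m (O^T)^T = 1%:M by rewrite trmxK; apply: mulmx1C.
rewrite -(dot_mul_orth (O := O^T) (x : 'rV_(1 + n)) OTO).
have -> : x *m O^T = row_mx (x *m u^T) (x *m U^T) by rewrite /O tr_col_mx; exact: mul_mx_row.
apply: (@le_trans _ _ (dot (x *m u^T) (x *m u^T) + dot (x *m U^T) (x *m U^T))).
  by rewrite ler_wpDl ?dot_ge0.
by rewrite -dot_row_mx; exact: lexx.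
Qed.

Definition tailm N n (z : 'M[R]_(N.+1, n)) : 'M[R]_(N, n) := \matrix_j row (lift 0 j) z.

Lemma trmul_tailm N n (z v : 'M[R]_(N.+1, n)) :
  z^T *m v = (row 0 z)^T *m row 0 v + (tailm z)^T *m tailm v.
Proof.
apply/matrixP => i j; rewrite !mxE big_ord_recl big_ord1 !mxE; congr (_ + _).
by apply: eq_bigr => k _; rewrite !mxE.
Qed.

Lemma mul_tailm N n (a : 'rV[R]_N.+1) (z : 'M[R]_(N.+1, n)) :
  a *m z = a 0 0 *: row 0 z + tailr a *m tailm z.
Proof.
apply/rowP => j; rewrite !mxE big_ord_recl; congr (_ + _).
by apply: eq_bigr => k _; rewrite !mxE.
Qed.

Lemma zono_tailm N n (z : 'M[R]_(N.+1, n)) t x : `|t| <= 1 -> zono (tailm z) x ->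
  zono z (t *: row 0 z + x).
Proof.
move=> t1 [a ca <-]; exists (consr t a); last by rewrite mul_tailm consr0 tailr_consr.
by move=> i; case: (unliftP 0 i) => [j ->|->]; rewrite ?consrS ?consr0.
Qed.

Lemma zono_tailr N n (z : 'M[R]_(N, n.+1)) (P : 'M[R]_(n.+1, n)) :
  (forall x : 'rV[R]_n.+1, x *m P = tailr x) -> @tailr R n @` zono z = zono (z *m P).
Proof.
move=> PE; apply/seteqP; split=> [_ [_ [a ca <-] <-]|_ [a ca <-]].
  by exists a => //; rewrite mulmxA PE.
by exists (a *m z); [exists a|rewrite mulmxA PE].
Qed.

Lemma tailr_mx n : exists P : 'M[R]_(n.+1, n), forall x, x *m P = tailr x.
Proof.
exists (\matrix_(i, j) (i == lift 0 j)%:R) => x; apply/rowP => j; rewrite !mxE.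
rewrite (bigD1 (lift 0 j))//= mxE eqxx mulr1 big1 ?addr0// => i ij.
by rewrite mxE (negbTE ij) mulr0.
Qed.

Lemma det_consr1 n (a : R) (c : 'cV[R]_n) (B : 'M[R]_n) :
  \det (block_mx a%:M 0 c B : 'M[R]_(1 + n)) = a * \det B.
Proof. by rewrite det_lblock det_scalar1. Qed.

(** In an orthonormal basis starting with the direction of w, the first row is
(|w|, 0, ..., 0). The determinant is then |w| <= 1 times a minor of the form
(z P)^T v', where P drops the first coordinate and v' consists of the
coordinates of the v_j in the hyperplane orthogonal to w, which are no longer
than v_j. *)
Lemma det_replace_row N n (z v : 'M[R]_(N, n.+1)) (w : 'rV[R]_n.+1) (P : 'M[R]_(n.+1, n)) c :
  (forall x : 'rV[R]_n.+1, x *m P = tailr x) -> 0 <= c ->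
  (forall v' : 'M[R]_(N, n), (forall j, dot (row j v') (row j v') <= dot (row j v) (row j v)) ->
     `|\det ((z *m P)^T *m v')| <= c) ->
  dot w w <= 1 ->
  `|\det (\matrix_i (if i == 0 then w else row i (z^T *m v)))| <= c.
Proof.
move=> PE c0 H w1; set D := \matrix_i _.
have [w0|w0] := eqVneq w 0.
  rewrite (expand_det_row _ 0) big1 ?normr0// => j _.
  by rewrite mxE eqxx w0 mxE mul0r.
have [r r0 [uu rr]] := normalize w0; set u := r^-1 *: w in uu.
have [U [UU Uu]] := perp_frame uu; have OO := col_frame uu UU Uu.
have uU : u *m U^T = 0 by rewrite -[u]trmxK -trmx_mul Uu trmx0.
set O := col_mx u U in OO.
have [_ dO] := orth_unit OO.
have PTE M (X : 'M[R]_(n.+1, M)) j k : (P^T *m X) j k = X (lift 0 j) k.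
  have := congr1 (fun y : 'rV[R]_n => y 0 j) (PE (row k X^T)).
  by rewrite -row_mul mxE [RHS]mxE [RHS]mxE [RHS]mxE => <-; rewrite -{1}[X]trmxK -trmx_mul mxE.
have -> : `|\det D| = `|\det (D *m (O : 'M[R]_n.+1)^T)|.
  by rewrite det_mulmx det_tr normrM dO mulr1.
have wE : w = r *: u by rewrite scalerA mulfV ?gt_eqF// scale1r.
have wuT : w *m u^T = r%:M.
  by rewrite wE -scalemxAl [u *m _]mx11_scalar -/(dot u u) uu scale_scalar_mx mulr1.
have wUT : w *m U^T = 0 by rewrite wE -scalemxAl uU scaler0.
have -> : D *m (O : 'M[R]_n.+1)^T =
   (block_mx r%:M 0 ((z *m P)^T *m v *m u^T) ((z *m P)^T *m (v *m U^T)) : 'M[R]_(1 + n)).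
  have DE : D = (col_mx w ((z *m P)^T *m v) : 'M[R]_(1 + n, n.+1)).
    apply/matrixP => i k; case: (unliftP 0 i) => [j ->|->].
      have L : D (lift 0 j) k = (z^T *m v) (lift 0 j) k.
        by rewrite mxE eq_sym (negbTE (neq_lift _ _)) mxE.
      rewrite L; have -> : lift 0 j = rshift 1 j by apply/val_inj.
      apply: etrans; last by apply/esym; exact: col_mxEd.
      rewrite trmx_mul -mulmxA; have := PTE _ (z^T *m v) j k => ->.
      by congr ((_ *m _) _ _); apply/val_inj.
    rewrite mxE eqxx; have -> : (0 : 'I_(1 + n)) = lshift n 0 by apply/val_inj.
    by apply: etrans; last by apply/esym; exact: col_mxEu.
  apply: (etrans (congr2 (@mulmx _ _ _ _) DE (tr_col_mx u U))).
  apply: (etrans (mul_col_row w ((z *m P)^T *m v) u^T U^T)).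
  by rewrite wuT wUT mulmxA.
rewrite det_consr1 normrM (gtr0_norm r0).
have r1 : r <= 1 by rewrite -(@ler_sqr R)// ?nnegrE ?(ltW r0)// rr expr1n.
apply: (@le_trans _ _ (1 * c)); last by rewrite mul1r.
apply: ler_pM => //; first exact: ltW.
apply: H => j; rewrite (row_mul j v (U^T)).
exact: (dot_frame_le (row j v) uu UU Uu).
Qed.

(** Generators are added one at a time. A linear map brings the first one to
e_1 and multiplies both sides by the same determinant. The matrix z^T v is then
that of the other generators plus a rank-one term in the first row, and the two
terms of [det_row0] are dominated by the two terms of [vol_add_segment]: the
zonotope of the other generators and its projection along e_1. *)
Lemma vol_zono N n (z v : 'M[R]_(N, n)) : (forall j, dot (row j v) (row j v) <= 1) ->
  2 ^+ n * `|\det (z^T *m v)| <= vol (zono z).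
Proof.
elim: N n z v => [|N IHN] n z v v1.
  case: n z v v1 => [|n] z v _.
    rewrite expr0 mul1r det_mx00 normr1 /vol leb0 indicE mem_set//=.
    by exists 0; [move=> j; rewrite mxE normr0|rewrite mul0mx].
  by rewrite (flatmx0 v) mulmx0 det0 normr0 mulr0; exact: vol_ge0.
case: n z v v1 => [|m] z v v1.
  rewrite expr0 mul1r det_mx00 normr1 /vol leb0 indicE mem_set//=.
  by exists 0; [move=> j; rewrite mxE normr0 ler01|rewrite mul0mx].
have tv1 j : dot (row j (tailm v)) (row j (tailm v)) <= 1 by rewrite rowK.
have [z0|z0] := eqVneq (row 0 z) 0.
  rewrite trmul_tailm z0 trmx0 mul0mx add0r; apply: le_trans (IHN _ _ _ tv1) _.
  apply: vol_le; [exact: compact_zono|exact: compact_zono|] => x Zx.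
  by rewrite -[x]add0r -(scale0r (row 0 z)); apply: zono_tailm; rewrite // normr0.
have [A uA zA] := rotate_to_first z0.
have dA : 0 < `|\det A| by rewrite normr_gt0; move: uA; rewrite unitmxE unitfE.
rewrite -(ler_pM2l dA) -zono_mul// mulrCA -normrM -[\det A]det_tr -det_mulmx mulmxA -trmx_mul.
have {zA} : row 0 (z *m A) = consr 1 0 by rewrite row_mul.
move: (z *m A) => {z z0 A uA dA} z z0.
have [P PE] := tailr_mx m.
set G := (tailm z)^T *m tailm v.
have -> : z^T *m v = (consr 1 0)^T *m row 0 v + G by rewrite (trmul_tailm z v) z0.
rewrite det_row0.
have H1 := IHN _ (tailm z) (tailm v) tv1; rewrite -/G in H1.
have c0 : 0 <= vol (zono (tailm z *m P)) / 2 ^+ m by rewrite divr_ge0 ?vol_ge0// exprn_ge0.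
have H2 := @det_replace_row _ _ (tailm z) (tailm v) (row 0 v) P _ PE c0 _ (v1 0).
have {}H2 : `|\det (\matrix_i (if i == 0 then row 0 v else row i G))| <=
    vol (zono (tailm z *m P)) / 2 ^+ m.
  apply: H2 => v' vv'; rewrite ler_pdivlMr ?exprn_gt0// mulrC; apply: IHN => j.
  exact: le_trans (vv' j) (tv1 j).
have H3 : vol (zono (tailm z)) + 2 * vol (zono (tailm z *m P)) <= vol (zono z).
  rewrite -zono_tailr//; apply: vol_add_segment.
  - exact: compact_zono.
  - exact: convex_zono.
  - exact: compact_zono.
  move=> s x s1 Zx; have := zono_tailm s1 Zx; rewrite z0.
  by rewrite consrZ mulr1 scaler0.
apply: le_trans H3.
apply: le_trans (ler_wpM2l _ (ler_normD _ _)) _; first by rewrite exprn_ge0.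
rewrite mulrDr; apply: lerD => //.
apply: le_trans (ler_wpM2l _ H2) _; first by rewrite exprn_ge0.
by rewrite exprS -mulrA ler_pM2l// mulrC divfK// gt_eqF// exprn_gt0.
Qed.

End Zonotopes.

(** * Cholesky factorisation with a bound on the determinant *)

Section Cholesky.
Context {R : realType}.

(** Elimination of the first variable: the Schur complement D' is the minimum of
the quadratic form over the first coordinate, so it is still bounded below by m,
and every pivot is at least m. *)
Lemma cholesky n (M : 'M[R]_n) (m : R) : 0 < m -> M^T = M ->
  (forall x : 'rV[R]_n, m * dot x x <= dot (x *m M) x) ->
  exists S : 'M[R]_n, [/\ S *m S^T = M, 0 < \det S & m ^+ n <= \det S ^+ 2].
Proof.
elim: n M => [|n IHn] M m0 MT Mm.
  exists 0; rewrite det_mx00 expr1n expr0 lexx ltr01; split=> //.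
  by apply/matrixP => -[].
pose M' : 'M[R]_(1 + n) := M.
pose a : R := ulsubmx M' 0 0; pose b : 'rV[R]_n := ursubmx M'; pose D : 'M[R]_n := drsubmx M'.
have bT : dlsubmx M' = b^T by rewrite /b trmx_ursub; congr (@dlsubmx _ 1 n 1 n _); exact/esym/MT.
have aE : ulsubmx M' = a%:M by rewrite [LHS]mx11_scalar.
have DT : D^T = D by rewrite /D trmx_drsub; congr (@drsubmx _ 1 n 1 n _); exact: MT.
have ME : M' = block_mx a%:M b b^T D by rewrite -[LHS]submxK aE bT.
have quad (t : R) (y : 'rV[R]_n) :
    m * (t ^+ 2 + dot y y) <= t ^+ 2 * a + 2 * t * dot y b + dot (y *m D) y.
  have Mm' (x : 'rV[R]_(1 + n)) : m * @dot R (1 + n) x x <= @dot R (1 + n) (x *m M') x.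
    exact: Mm.
  have := Mm' (row_mx t%:M y); rewrite dot_row_mx ME.
  have -> : dot (row_mx t%:M y *m block_mx a%:M b b^T D) (row_mx t%:M y) =
     dot (t%:M *m a%:M + y *m b^T) t%:M + dot (t%:M *m b + y *m D) y.
    have E := mul_row_block (t%:M : 'M[R]_1) y a%:M b b^T D.
    rewrite [X in dot X _](_ : _ = row_mx (t%:M *m a%:M + y *m b^T) (t%:M *m b + y *m D)) //.
    by rewrite /dot tr_row_mx mul_row_col mxE.
  have sc (s : R) (w : 'M[R]_1) : dot w s%:M = s * w 0 0.
    by rewrite /dot tr_scalar_mx mul_mx_scalar mxE.
  have s2 : (t%:M *m a%:M + y *m b^T : 'M[R]_1) 0 0 = t * a + dot y b.
    by rewrite mxE -scalar_mxM mxE eqxx mulr1n.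
  have s3 : dot (t%:M *m b + y *m D) y = t * dot y b + dot (y *m D) y.
    by rewrite {1}/dot mulmxDl mxE mul_scalar_mx -scalemxAl [X in X + _]mxE -/(dot b y) dotC.
  have s4 : (t%:M : 'M[R]_1) 0 0 = t by rewrite mxE eqxx mulr1n.
  rewrite !sc s2 s3 s4 -expr2 => /le_trans; apply.
  by rewrite le_eqVlt; apply/orP; left; apply/eqP; ring.
have am : m <= a.
  have := quad 1 0; rewrite /dot !mul0mx !mxE mulr0 expr1n !addr0 mul1r mulr1; exact.
have a0 : 0 < a by apply: lt_le_trans am.
pose D' := D - a^-1 *: (b^T *m b).
have D'T : D'^T = D' by rewrite /D' linearB/= linearZ/= trmx_mul trmxK DT.
have D'm y : m * dot y y <= dot (y *m D') y.
  have := quad (- (dot y b / a)) y.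
  have -> : dot (y *m D') y = dot (y *m D) y - dot y b ^+ 2 / a.
    rewrite {1}/dot mulmxBr mulmxBl mxE [X in _ + X]mxE -/(dot (y *m D) y); congr (_ - _).
    rewrite -scalemxAr -scalemxAl mxE mulmxA -(mulmxA (y *m b^T)) mxE big_ord1 -/(dot y b) -/(dot b y).
    by rewrite [dot b y]dotC expr2 mulrC.
  move=> H; apply: le_trans (_ : m * (dot y y) <= m * ((- (dot y b / a)) ^+ 2 + dot y y)) _.
    by rewrite ler_pM2l// lerDr sqr_ge0.
  apply: le_trans H _; rewrite le_eqVlt; apply/orP; left; apply/eqP.
  by field; rewrite gt_eqF.
have [S [SS S0 Sm]] := IHn D' m0 D'T D'm.
pose s := Num.sqrt a; have s0 : 0 < s by rewrite sqrtr_gt0.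
have ss : s ^+ 2 = a by rewrite sqr_sqrtr// ltW.
pose T : 'M[R]_(1 + n) := block_mx s%:M 0 (s^-1 *: b^T) S.
have dT : \det T = s * \det S by rewrite det_lblock det_scalar1.
exists T; rewrite dT; split.
- rewrite -[RHS]/M' ME.
  suff TT : (T *m T^T : 'M[R]_(1 + n)) = block_mx a%:M b b^T D by exact: TT.
  rewrite /T tr_block_mx mulmx_block !trmx0 !mulmx0 !mul0mx !addr0 !tr_scalar_mx -scalar_mxM -expr2 ss.
  rewrite linearZ/= trmxK mul_scalar_mx mul_mx_scalar !scalerA mulfV ?gt_eqF// !scale1r.
  rewrite -scalemxAl -scalemxAr scalerA -invfM -expr2 ss SS.
  by rewrite /D' addrC subrK.
- exact: mulr_gt0.
- by rewrite exprMn ss exprS; apply: ler_pM => //; rewrite ?exprn_ge0// ltW.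
Qed.

End Cholesky.

(** * The slicing inequality from finitely many generators *)

Section Core.
Context {R : realType}.

Section expectation.
Variables (n : nat) (K : set 'rV[R]_n).
Hypotheses (cK : compact K) (V0 : 0 < vol K).

(** Borel and bounded on K: a class stable under the operations below, on which
the mean over K is linear and monotone. *)
Definition tame (F : 'rV[R]_n -> R) :=
  measurable_fun [set: mV R n] F /\ exists B, forall x, K x -> `|F x| <= B.

Definition avg (F : 'rV[R]_n -> R) : R := (\int[leb n]_(x in K) F x) / vol K.

Lemma tame_integrable F : tame F -> (leb n).-integrable K (EFin \o F).
Proof.
move=> [mF [B BF]]; apply: measurable_bounded_integrable.
- exact: compact_mV.
- exact: compact_fin.
- exact: measurable_funS mF.
- exists B; split; first exact: num_real.
  by move=> x Bx y Ky; apply: le_trans (BF _ Ky) (ltW Bx).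
Qed.

Lemma tameD F G : tame F -> tame G -> tame (fun x => F x + G x).
Proof.
move=> [mF [B BF]] [mG [C CG]]; split; first exact: measurable_funD.
exists (B + C) => x Kx; apply: le_trans (ler_normD _ _) _.
by apply: lerD; [exact: BF|exact: CG].
Qed.

Lemma tameM F G : tame F -> tame G -> tame (fun x => F x * G x).
Proof.
move=> [mF [B BF]] [mG [C CG]]; split; first exact: measurable_funM.
exists (B * C) => x Kx; rewrite normrM.
by apply: ler_pM => //; [exact: BF|exact: CG].
Qed.

Lemma tame_cst c : tame (fun=> c).
Proof. by split=> //; exists `|c|. Qed.

Lemma tame_powR F r : 0 <= r -> tame F -> tame (fun x => `|F x| `^ r).
Proof.
move=> r0 [mF [B BF]]; split.
  by apply: (@measurableT_comp _ _ _ _ _ _ (@powR R ^~ r)) => //; exact: measurableT_comp.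
exists (B `^ r) => x Kx; rewrite ger0_norm ?powR_ge0//.
apply: ge0_ler_powR; rewrite ?nnegrE//; last exact: BF.
exact: le_trans (BF _ Kx).
Qed.

Lemma tame_sum I (s : seq I) (F : I -> 'rV[R]_n -> R) : (forall i, tame (F i)) ->
  tame (fun x => \sum_(i <- s) F i x).
Proof.
move=> gF; elim: s => [|i s IHs].
  by rewrite (_ : (fun x => _) = fun=> 0); [exact: tame_cst|apply/funext => x; rewrite big_nil].
rewrite (_ : (fun x => _) = fun x => F i x + \sum_(i <- s) F i x); first exact: tameD.
by apply/funext => x; rewrite big_cons.
Qed.

Lemma tame_coord j : tame (fun x : 'rV[R]_n => x 0 j).
Proof.
split; first exact: coord_mV.
by have [r r0 Kr] := compact_cube cK; exists r => x /Kr/(_ j).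
Qed.

Lemma tame_dot w : tame (fun x => dot x w).
Proof.
have -> : (fun x : 'rV[R]_n => dot x w) = (fun x => \sum_j x 0 j * w 0 j).
  by apply/funext => x; rewrite dotE.
by apply: tame_sum => j; apply: tameM; [exact: tame_coord|exact: tame_cst].
Qed.

Lemma avgD F G : tame F -> tame G -> avg (fun x => F x + G x) = avg F + avg G.
Proof.
move=> gF gG; rewrite /avg RintegralD ?mulrDl//; [exact: compact_mV|exact: tame_integrable..].
Qed.

Lemma avgZ c F : tame F -> avg (fun x => c * F x) = c * avg F.
Proof.
move=> gF; rewrite /avg RintegralZl ?mulrA//; [exact: compact_mV|exact: tame_integrable].
Qed.

Lemma avg_sum I (s : seq I) (F : I -> 'rV[R]_n -> R) : (forall i, tame (F i)) ->
  avg (fun x => \sum_(i <- s) F i x) = \sum_(i <- s) avg (F i).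
Proof.
move=> gF; elim: s => [|i s IHs].
  rewrite big_nil (_ : (fun x => _) = fun=> 0 * 0); last by apply/funext => x; rewrite big_nil mul0r.
  by rewrite (avgZ 0 (tame_cst 0)) mul0r.
rewrite big_cons -IHs -avgD//; last exact: tame_sum.
by congr avg; apply/funext => x; rewrite big_cons.
Qed.

Lemma avg_cst c : avg (fun=> c) = c.
Proof.
rewrite /avg Rintegral_cst; last exact: compact_mV.
by rewrite -/(vol K) mulfK// gt_eqF.
Qed.

Lemma avg_le F G : tame F -> tame G -> (forall x, K x -> F x <= G x) -> avg F <= avg G.
Proof.
move=> gF gG FG; rewrite /avg ler_pM2r ?invr_gt0//.
by apply: le_Rintegral => //; [exact: compact_mV|exact: tame_integrable..].
Qed.

Lemma avg_integral F : tame F -> (\int[leb n]_(x in K) (F x)%:E = (vol K * avg F)%:E)%E.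
Proof.
move=> gF; rewrite /avg mulrC divfK ?gt_eqF//.
by rewrite /Rintegral fineK//; apply: integrable_fin_num; [exact: compact_mV|exact: tame_integrable].
Qed.

Lemma eq_avg F G : (forall x, K x -> F x = G x) -> avg F = avg G.
Proof. by move=> FG; rewrite /avg; congr (_ / _); apply: eq_Rintegral => x; rewrite inE; exact: FG. Qed.

End expectation.

Lemma young_powR (x y p q : R) : 0 <= x -> 0 <= y -> 0 < p -> 0 < q -> p^-1 + q^-1 = 1 ->
  x * y <= p^-1 * x `^ p + q^-1 * y `^ q.
Proof.
by move=> x0 y0 p0 q0 pq; rewrite [p^-1 * _]mulrC [q^-1 * _]mulrC; exact: conjugate_powR.
Qed.

Section main.
(* The rows of z generate K up to the constant c: by Kz the unit ball of l_p is
   mapped into K by b |-> b z, and by az and ap every x in K is the image of a x,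
   whose l_p norm is at most c. *)
Variables (n N : nat) (K : set 'rV[R]_n.+1) (z : 'M[R]_(N, n.+1)).
Variables (a : 'rV[R]_n.+1 -> 'rV[R]_N) (p q c beta : R).
Hypotheses (bK : body K) (V0 : 0 < vol K).
Hypotheses (p1 : 1 < p) (q1 : 1 <= q) (pq : p^-1 + q^-1 = 1) (c0 : 0 < c).
Hypothesis sections : forall u : 'rV[R]_n.+1, dot u u = 1 -> exists U : 'M[R]_(n, n.+1),
  [/\ U *m U^T = 1%:M, U *m u^T = 0 & vol [set v | K (v *m U)] <= beta].
Hypothesis ma : forall j, measurable_fun [set: mV R n.+1] (fun x : 'rV[R]_n.+1 => a x 0 j).
Hypothesis az : forall x, K x -> a x *m z = x.
Hypothesis ap : forall x, K x -> \sum_j `|a x 0 j| `^ p <= c `^ p.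
Hypothesis Kz : forall b : 'rV[R]_N, \sum_j `|b 0 j| `^ p <= 1 -> K (b *m z).

Let cK : compact K. Proof. by case: bK. Qed.
Let p0 : 0 < p. Proof. by apply: lt_trans p1. Qed.
Let q0 : 0 < q. Proof. by apply: lt_le_trans q1. Qed.
Local Notation E := (avg K).
Local Notation tame := (tame K).

Let tame_a j : tame (fun x => a x 0 j).
Proof.
split; first exact: ma.
exists c => x Kx; have H : `|a x 0 j| `^ p <= c `^ p.
  apply: le_trans (ap Kx); rewrite (bigD1 j)//= lerDl; apply: sumr_ge0 => i _.
  exact: powR_ge0.
rewrite leNgt; apply/negP => cx.
by have := gt0_ltr_powR p0 (ltW c0) (normr_ge0 (a x 0 j)) cx; rewrite ltNge H.
Qed.

(** A section of volume at most beta forces the mass of K to spread along u. *)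
Lemma direction_variance (u : 'rV[R]_n.+1) : dot u u = 1 ->
  0 < beta /\ (vol K / (6 * beta)) ^+ 2 <= E (fun x => dot x u ^+ 2).
Proof.
move=> uu; have [U [UU Uu Ub]] := sections uu.
have gd2 : tame (fun x => dot x u ^+ 2).
  rewrite (_ : (fun x => _) = fun x => dot x u * dot x u); last by apply/funext => x; rewrite expr2.
  by apply: tameM; exact: tame_dot.
have s20 : 0 <= E (fun x => dot x u ^+ 2).
  rewrite -(avg_cst cK V0 0); apply: avg_le => //; first exact: tame_cst.
  by move=> x _; exact: sqr_ge0.
set s := Num.sqrt (E (fun x => dot x u ^+ 2)).
have ss : s ^+ 2 = E (fun x => dot x u ^+ 2) by rewrite sqr_sqrtr.
have s0 : 0 <= s by rewrite sqrtr_ge0.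
have H := avg_integral cK V0 gd2; rewrite -ss in H.
have [H1 _] := direction_moments bK V0 uu UU Uu s0 (lexx 1) H.
have H2 : vol K <= 6 * beta * s.
  by apply: le_trans H1 _; rewrite ler_wpM2r// ler_wpM2l.
have b0 : 0 < beta.
  rewrite ltNge; apply/negP => b0; have := lt_le_trans V0 H2.
  by rewrite ltNge mulr_le0_ge0// mulr_ge0_le0.
split=> //; rewrite -ss ler_sqr ?nnegrE ?divr_ge0 ?vol_ge0 ?mulr_ge0 ?(ltW b0)//.
by rewrite ler_pdivrMr ?mulr_gt0// mulrC.
Qed.

(** The bound of [direction_moments] is homogeneous, so the direction may be
normalised by the variance instead of by the length. *)
Lemma normalized_moment_le (w : 'rV[R]_n.+1) : w != 0 -> E (fun x => dot x w ^+ 2) = 1 ->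
  E (fun x => `|dot x w| `^ q) <= (moment_cst * q) `^ q.
Proof.
move=> w0 Ew; have [r r0 [uu _]] := normalize w0; set u := r^-1 *: w in uu.
have [U [UU Uu _]] := sections uu.
have du x : dot x u = r^-1 * dot x w by rewrite /dot /u linearZ/= -scalemxAr mxE.
have gd2 v : tame (fun x => dot x v ^+ 2).
  rewrite (_ : (fun x => _) = fun x => dot x v * dot x v); last by apply/funext => x; rewrite expr2.
  by apply: tameM; exact: tame_dot.
have gdq v : tame (fun x => `|dot x v| `^ q) by apply: tame_powR; [exact: ltW|exact: tame_dot].
have ri0 : 0 <= r^-1 by rewrite invr_ge0 ltW.
have Eu : E (fun x => dot x u ^+ 2) = r^-1 ^+ 2.
  rewrite -[RHS]mulr1 -Ew -avgZ//; apply: eq_avg => x _.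
  by rewrite du exprMn.
have H := avg_integral cK V0 (gd2 u); rewrite Eu in H.
have [_] := direction_moments bK V0 uu UU Uu ri0 q1 H.
rewrite (avg_integral cK V0 (gdq u)) lee_fin ler_pM2l// => H1.
have H2 : E (fun x => `|dot x u| `^ q) = r^-1 `^ q * E (fun x => `|dot x w| `^ q).
  rewrite -avgZ//; apply: eq_avg => x _.
  by rewrite du normrM powRM// (ger0_norm ri0).
move: H1; rewrite H2 powRM// ?mulr_ge0 ?(ltW moment_cst_gt0) ?(ltW q0)// mulrC.
by rewrite ler_pM2r// powR_gt0// invr_gt0.
Qed.

(** M is the covariance matrix of K and mm the mixed moments of the coefficients
a_j(x) and of x; z^T mm = M becomes z^T Y = S after multiplication by S^-T. The
rows of Y are the vectors y_j, and r j their lengths. *)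
Theorem slicing_finite : (vol K) ^+ n.+1 <= (3 * beta * (moment_cst * q * c)) ^+ n.+1 * vol K.
Proof.
pose lam := moment_cst * q.
have lam0 : 0 < lam by rewrite mulr_gt0// moment_cst_gt0.
pose M : 'M[R]_n.+1 := \matrix_(k, l) E (fun x => x 0 k * x 0 l).
have gc j : tame (fun x => x 0 j) by exact: tame_coord.
have MT : M^T = M.
  by apply/matrixP => k l; rewrite !mxE; apply: eq_avg => x _; rewrite mulrC.
have ME (w : 'rV[R]_n.+1) : dot (w *m M) w = E (fun x => dot x w ^+ 2).
  rewrite dotE; transitivity (E (fun x => \sum_l \sum_k w 0 k * w 0 l * (x 0 k * x 0 l))).
    rewrite avg_sum//; last first.
      by move=> l; apply: tame_sum => k; apply: tameM; [exact: tame_cst|exact: tameM].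
    apply: eq_bigr => l _; rewrite mxE mulr_suml avg_sum//; last first.
      by move=> k; apply: tameM; [exact: tame_cst|exact: tameM].
    apply: eq_bigr => k _; rewrite avgZ//; last exact: tameM.
    by rewrite mxE mulrAC.
  apply: eq_avg => x _; rewrite dotE expr2 mulr_sumr; apply: eq_bigr => l _.
  by rewrite mulr_suml; apply: eq_bigr => k _; ring.
pose m := (vol K / (6 * beta)) ^+ 2.
have [b0 _] := direction_variance (dot_delta (0 : 'I_n.+1)).
have m0 : 0 < m by rewrite exprn_gt0// divr_gt0// mulr_gt0.
have Mm (w : 'rV[R]_n.+1) : m * dot w w <= dot (w *m M) w.
  have [->|w0] := eqVneq w 0; first by rewrite /dot !mul0mx mxE mulr0.
  have [r r0 [uu rr]] := normalize w0; set u := r^-1 *: w in uu.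
  have wu : w = r *: u by rewrite scalerA mulfV ?gt_eqF// scale1r.
  rewrite -rr wu -scalemxAl /dot linearZ/= -scalemxAl -scalemxAr scalerA mxE -expr2 mulrC.
  rewrite ler_pM2l ?exprn_gt0// -/(dot (u *m M) u) ME.
  by have [] := direction_variance uu.
have [S [SS S0 Sm]] := cholesky m0 MT Mm.
have uS : S \in unitmx by rewrite unitmxE unitfE gt_eqF.
pose mm : 'M[R]_(N, n.+1) := \matrix_(j, k) E (fun x => a x 0 j * x 0 k).
have zM : z^T *m mm = M.
  apply/matrixP => k l; rewrite !mxE.
  transitivity (E (fun x => \sum_j z j k * (a x 0 j * x 0 l))).
    rewrite avg_sum//; last by move=> j; apply: tameM; [exact: tame_cst|exact: tameM].
    by apply: eq_bigr => j _; rewrite avgZ ?mxE//; exact: tameM.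
  apply: eq_avg => x Kx; have -> : x 0 k = \sum_j a x 0 j * z j k by rewrite -{1}(az Kx) mxE.
  rewrite mulr_suml.
  by apply: eq_bigr => j _; rewrite mulrA [z j k * _]mulrC.
pose Y : 'M[R]_(N, n.+1) := mm *m (invmx S)^T.
have zY : z^T *m Y = S.
  by rewrite /Y mulmxA zM -SS trmx_inv -mulmxA mulmxV ?mulmx1// unitmx_tr.
pose r j := Num.sqrt (dot (row j Y) (row j Y)).
have rr j : r j ^+ 2 = dot (row j Y) (row j Y) by rewrite sqr_sqrtr// dot_ge0.
have r_ge0 j : 0 <= r j by rewrite sqrtr_ge0.
(* r j is the mean of a_j times the linear form of w, which has variance one.
   Young's inequality for a_j * (lam / r j) and that form divided by lam gives
   the p-th power of Hoelder's inequality directly. *)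
have rp j : r j `^ p <= lam `^ p * E (fun x => `|a x 0 j| `^ p).
  have gap : tame (fun x => `|a x 0 j| `^ p) by apply: tame_powR => //; exact: ltW.
  have [rj0|rj0] := eqVneq (r j) 0.
    rewrite rj0 powR0 ?gt_eqF// mulr_ge0 ?powR_ge0// -(avg_cst cK V0 0).
    by apply: avg_le => //; exact: tame_cst.
  have rj : 0 < r j by rewrite lt_neqAle eq_sym rj0 r_ge0.
  pose e' := (r j)^-1 *: row j Y.
  have ee' : dot e' e' = 1.
    rewrite /dot linearZ/= -scalemxAl -scalemxAr scalerA mxE -/(dot _ _) -rr -expr2.
    by rewrite -exprMn mulVf// expr1n.
  pose w := e' *m invmx S.
  have wM : dot (w *m M) w = 1.
    rewrite /dot /w trmx_mul -SS !mulmxA mulmxKV// -mulmxA -mulmxA -trmx_mul.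
    by rewrite -trmx_mul mulmxKV// -/(dot e' e').
  have Ew : E (fun x => dot x w ^+ 2) = 1 by rewrite -ME.
  have w0 : w != 0.
    by apply/eqP => w0; move: wM; rewrite w0 /dot !mul0mx mxE => /eqP; rewrite eq_sym oner_eq0.
  have Hq := normalized_moment_le w0 Ew.
  have rE : r j = E (fun x => a x 0 j * dot x w).
    have -> : r j = dot (row j Y) e'.
      by rewrite /dot /e' linearZ/= -scalemxAr mxE -/(dot _ _) -rr expr2 mulrA mulVf// mul1r.
    have -> : dot (row j Y) e' = dot (row j mm) w.
      by rewrite /dot /Y row_mul -mulmxA -trmx_mul.
    rewrite dotE; transitivity (E (fun x => \sum_k w 0 k * (a x 0 j * x 0 k))).
      rewrite avg_sum//; last by move=> k; apply: tameM; [exact: tame_cst|exact: tameM].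
      by apply: eq_bigr => k _; rewrite !mxE avgZ 1?mulrC//; exact: tameM.
    by apply: eq_avg => x _; rewrite dotE mulr_sumr; apply: eq_bigr => k _; ring.
  have gdw : tame (fun x => dot x w) by exact: tame_dot.
  have gwq : tame (fun x => `|dot x w| `^ q) by apply: tame_powR => //; exact: ltW.
  have H : 1 <= p^-1 * (lam / r j) `^ p * E (fun x => `|a x 0 j| `^ p) +
      q^-1 * lam^-1 `^ q * E (fun x => `|dot x w| `^ q).
    have g1 := tameM (tame_cst K (p^-1 * (lam / r j) `^ p)) gap.
    have g2 := tameM (tame_cst K (q^-1 * lam^-1 `^ q)) gwq.
    rewrite -!avgZ// -(avgD cK g1 g2).
    have -> : 1 = E (fun x => (r j)^-1 * (a x 0 j * dot x w)).
      by rewrite avgZ -?rE ?mulVf//; exact: tameM.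
    apply: avg_le => //.
    - by apply: tameM; [exact: tame_cst|exact: tameM].
    - by apply: tameD; apply: tameM => //; exact: tame_cst.
    move=> x _; have l1 : 0 <= lam / r j := divr_ge0 (ltW lam0) (ltW rj).
    have l2 : 0 <= lam^-1 by rewrite invr_ge0 ltW.
    have := young_powR (mulr_ge0 l1 (normr_ge0 (a x 0 j)))
      (mulr_ge0 l2 (normr_ge0 (dot x w))) p0 q0 pq.
    rewrite (powRM p l1 (normr_ge0 _)) (powRM q l2 (normr_ge0 _)) !(mulrA _ (_ `^ _)).
    apply: le_trans.
    apply: le_trans (ler_norm _) _; rewrite normrM (gtr0_norm (_ : 0 < (r j)^-1)) ?invr_gt0//.
    rewrite normrM le_eqVlt; apply/orP; left; apply/eqP; field.
    by rewrite !gt_eqF.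
  have H2 : q^-1 * lam^-1 `^ q * E (fun x => `|dot x w| `^ q) <= q^-1.
    rewrite -mulrA -[leRHS]mulr1 ler_pM2l ?invr_gt0//.
    apply: le_trans (ler_wpM2l (powR_ge0 _ _) Hq) _.
    by rewrite -powRM ?invr_ge0 ?(ltW lam0)// mulVf ?gt_eqF// powR1.
  have H3 : 1 <= (lam / r j) `^ p * E (fun x => `|a x 0 j| `^ p).
    have : p^-1 <= p^-1 * ((lam / r j) `^ p * E (fun x => `|a x 0 j| `^ p)).
      by rewrite mulrA -(lerD2r q^-1) pq; apply: le_trans H _; rewrite lerD2l.
    by rewrite -{1}[p^-1]mulr1 ler_pM2l ?invr_gt0.
  rewrite -[leLHS]mulr1; apply: le_trans (ler_wpM2l (powR_ge0 _ _) H3) _.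
  rewrite mulrA -powRM ?divr_ge0 ?(ltW lam0)//.
  by have -> : r j * (lam / r j) = lam by rewrite mulrC divfK.
pose mu := lam * c; have mu0 : 0 < mu by rewrite mulr_gt0.
have sum_rp : \sum_j r j `^ p <= mu `^ p.
  apply: (@le_trans _ _ (\sum_j lam `^ p * E (fun x => `|a x 0 j| `^ p))).
    by apply: ler_sum => j _; exact: rp.
  rewrite -mulr_sumr /mu powRM ?(ltW lam0) ?(ltW c0)//; apply: ler_wpM2l; first exact: powR_ge0.
  have gap j : tame (fun x => `|a x 0 j| `^ p) by apply: tame_powR => //; exact: ltW.
  rewrite -avg_sum// -[leRHS](avg_cst cK V0); apply: avg_le => //; [exact: tame_sum|exact: tame_cst].
(* The coefficients r j / mu have l_p norm at most 1, so the zonotope of Z is in K;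
   and Z^T v = mu^-1 S with rows of v of length at most 1. *)
pose Z : 'M[R]_(N, n.+1) := \matrix_j ((r j / mu) *: row j z).
pose v : 'M[R]_(N, n.+1) := \matrix_j ((r j)^-1 *: row j Y).
have v1 j : dot (row j v) (row j v) <= 1.
  rewrite rowK /dot linearZ/= -scalemxAl -scalemxAr scalerA mxE -/(dot _ _) -rr -expr2 -exprMn.
  by have [->|rj] := eqVneq (r j) 0; [rewrite mulr0 expr0n/= ler01|rewrite mulVf// expr1n].
have ZK : zono Z `<=` K.
  move=> _ [al al1 <-].
  have -> : al *m Z = (\row_j (al 0 j * (r j / mu))) *m z.
    by rewrite !mulmx_sum_row; apply: eq_bigr => j _; rewrite rowK scalerA mxE.
  apply: Kz; apply: (@le_trans _ _ (\sum_j (r j `^ p / mu `^ p))).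
    apply: ler_sum => j _; rewrite mxE normrM powRM// (ger0_norm (divr_ge0 (r_ge0 j) (ltW mu0))).
    rewrite (_ : r j `^ p / mu `^ p = (r j / mu) `^ p); last first.
      have mui : 0 <= mu^-1 by rewrite invr_ge0 ltW.
      rewrite (powRM p (r_ge0 j) mui); congr (_ * _).
      by rewrite -powRN -powR_inv1 ?(ltW mu0)// -powRrM mulN1r.
    rewrite -[leRHS]mul1r ler_wpM2r ?powR_ge0//.
    rewrite (_ : 1 = 1 `^ p :> R); last by rewrite powR1.
    by apply: ge0_ler_powR; rewrite ?nnegrE ?(ltW p0)//; exact: al1.
  by rewrite -mulr_suml ler_pdivrMr ?mul1r// powR_gt0.
have Zv : Z^T *m v = mu^-1 *: S.
  rewrite -zY scalemxAr; apply/matrixP => k l; rewrite !mxE; apply: eq_bigr => j _.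
  rewrite !mxE; have [rj|rj] := eqVneq (r j) 0.
    have -> : \sum_j0 mm j j0 * (invmx S)^T j0 l = 0; last by rewrite !mulr0.
    have : dot (row j Y) (row j Y) == 0 by rewrite -rr rj expr0n.
    rewrite dot_eq0 => /eqP/rowP/(_ l); by rewrite !mxE.
  by field; rewrite rj gt_eqF.
have := vol_zono Z v1; rewrite Zv detZ normrM => HZ.
have cZ : compact (zono Z) by exact: compact_zono.
have {}HZ := le_trans HZ (vol_le cZ cK ZK).
have Sm' : (vol K / (6 * beta)) ^+ n.+1 <= \det S.
  rewrite -ler_sqr ?nnegrE ?(ltW S0) ?exprn_ge0 ?divr_ge0 ?mulr_ge0 ?(ltW b0) ?(ltW V0)//.
  by rewrite -exprM mulnC exprM.
move: HZ; rewrite normrX (gtr0_norm S0) (gtr0_norm (_ : 0 < mu^-1)) ?invr_gt0// => HZ.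
have {}HZ : 2 ^+ n.+1 * (mu^-1 ^+ n.+1 * (vol K / (6 * beta)) ^+ n.+1) <= vol K.
  apply: le_trans HZ; rewrite ler_wpM2l ?exprn_ge0// ler_wpM2l ?exprn_ge0 ?invr_ge0 ?(ltW mu0)//.
move: HZ; rewrite -!exprMn -/lam -/mu.
rewrite (_ : 2 * (mu^-1 * (vol K / (6 * beta))) = vol K / (3 * beta * mu)); last first.
  by field; rewrite !gt_eqF.
by rewrite expr_div_n ler_pdivrMr ?exprn_gt0 ?mulr_gt0// mulrC.
Qed.

End main.

End Core.

(** * Density of finitely valued functions in L_p *)

Section LpSimple.
Context d (T : measurableType d) (R : realType).
Variables (mu : {measure set T -> \bar R}) (p : \bar R) (p1 : (1 <= p)%E).
Local Notation Lf := (LfunType mu p1).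
Local Notation nrm f := ('N[mu]_p[EFin \o f])%E.

Lemma measurable_powR_norm (h : T -> R) r : measurable_fun [set: T] h ->
  measurable_fun [set: T] (fun x => (`|h x| `^ r)%:E).
Proof.
move=> mh; apply/measurable_EFinP.
by apply: (@measurableT_comp _ _ _ _ _ _ (@powR R ^~ r)) => //; exact: measurableT_comp.
Qed.

Lemma Lnorm_mono (f g : T -> R) : measurable_fun [set: T] f -> measurable_fun [set: T] g ->
  (forall x, `|f x| <= `|g x|) -> (nrm f <= nrm g)%E.
Proof.
move=> mf mg fg; rewrite unlock /Lnorm.
case: p p1 => [r r1|_|]; last by rewrite leeNy_eq.
- have r0 : 0 < r by rewrite -lte_fin; apply: lt_le_trans r1; rewrite lte01.
  have N0 (h : T -> R) : (0 <= \int[mu]_x (`|h x| `^ r)%:E)%E.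
    by apply: integral_ge0 => x _; rewrite lee_fin powR_ge0.
  apply: gt0_ler_poweR.
  + by rewrite invr_ge0 ltW.
  + by rewrite in_itv/= leey andbT; exact: N0.
  + by rewrite in_itv/= leey andbT; exact: N0.
  apply: ge0_le_integral => //; do ?[exact: measurable_powR_norm|by move=> x _; rewrite lee_fin powR_ge0].
  move=> x _; rewrite lee_fin; apply: ge0_ler_powR; rewrite ?nnegrE//.
  exact: ltW.
- case: ifPn => // _; apply: le_ess_sup; apply: aeW => x /=.
  by rewrite lee_fin.
Qed.

Lemma Lfun_dominated (f : T -> R) (g : Lf) : measurable_fun [set: T] f ->
  (forall x, `|f x| <= `|g x|) -> f \in Lfun mu p.
Proof.
move=> mf fg; apply/andP; split; rewrite inE//=.
have := @Lfunction_finite _ _ _ _ _ p1 g; rewrite /finite_norm; apply: le_lt_trans.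
by apply: Lnorm_mono.
Qed.

Section fibers.
Variables (J : finType) (i : T -> J).

(** i encodes a finite measurable partition of T. *)
Definition measurable_fibers := forall j, measurable (i @^-1` [set j]).

Lemma finite_valuedE (v : J -> R) x : v (i x) = \sum_j v j * \1_(i @^-1` [set j]) x.
Proof.
rewrite (bigD1 (i x))//= big1 ?addr0 => [|j jx].
  by rewrite indicE mem_set// mulr1.
by rewrite indicE memNset ?mulr0//= => ij; rewrite ij eqxx in jx.
Qed.

Hypothesis mi : measurable_fibers.

Lemma measurable_finite_valued (v : J -> R) : measurable_fun [set: T] (v \o i).
Proof.
rewrite (_ : _ \o _ = fun x => \sum_(j <- index_enum J) v j * \1_(i @^-1` [set j]) x).
  by apply: measurable_sum => j; apply: measurable_funM => //; exact: measurable_indic.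
by apply/funext => x; exact: finite_valuedE.
Qed.

End fibers.

(** |t| is rounded down to a multiple of 1/k, and t is replaced by 0 if |t| > k.
Rounding towards 0 keeps the result dominated by t, which dominated convergence
needs for p < oo; the uniform error 1/k serves for p = oo. *)
Definition trunc_part (k : nat) (t : R) : R :=
  if `|t| <= k%:R then (-1) ^+ (t < 0)%R * ((Num.truncn (k%:R * `|t|))%:R / k%:R) else 0.

(** A finite code of [trunc_part k t], decoded by [trunc_value]. *)
Definition trunc_index (k : nat) (t : R) : bool * 'I_(k * k).+1 :=
  (t < 0, inord (if `|t| <= k%:R then Num.truncn (k%:R * `|t|) else 0)).

Definition trunc_value k (j : bool * 'I_(k * k).+1) : R := (-1) ^+ j.1 * (j.2%:R / k%:R).

Lemma trunc_index_value k t : trunc_value (trunc_index k t) = trunc_part k t.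
Proof.
rewrite /trunc_value /trunc_part /=.
have [tk|_] := ifPn; last by rewrite inordK// mul0r mulr0.
rewrite inordK// ltnS -(ler_nat R) natrM.
have : (Num.truncn (k%:R * `|t|))%:R <= k%:R * `|t| by rewrite truncn_le mulr_ge0.
by move/le_trans; apply; rewrite ler_wpM2l.
Qed.

Lemma trunc_part_itv k t : 0 <= `|t| <= k%:R ->
  exists2 s, 0 <= s <= `|t| & trunc_part k t = (-1) ^+ (t < 0)%R * s /\ `|t| - s <= k%:R^-1.
Proof.
move=> /andP[_ tk]; exists ((Num.truncn (k%:R * `|t|))%:R / k%:R).
  rewrite divr_ge0//=; have [->|k0] := eqVneq k 0; first by rewrite invr0 mulr0.
  by rewrite ler_pdivrMr ?ltr0n ?lt0n// mulrC truncn_le mulr_ge0.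
split; first by rewrite /trunc_part tk.
have [k0|k0] := eqVneq k 0%N; first by move: tk; rewrite k0 invr0 mulr0 subr0.
have kR : (0 : R) < k%:R by rewrite ltr0n lt0n.
rewrite lerBlDr -{1}[k%:R^-1]mul1r -[X in _ <= X]mulrDl ler_pdivlMr// mulrC addrC natr1.
by rewrite ltW// truncnS_gt.
Qed.

Let sign_norm (t s : R) : t - (-1) ^+ (t < 0)%R * s = (-1) ^+ (t < 0)%R * (`|t| - s).
Proof. by rewrite mulrBr -(realEsign (num_real t)). Qed.

Lemma trunc_part_le k t : `|trunc_part k t| <= `|t| /\ `|t - trunc_part k t| <= `|t|.
Proof.
have [tk|tk] := boolP (`|t| <= k%:R); last first.
  by rewrite /trunc_part (negbTE tk) normr0 subr0.
have [|s /andP[s0 st] [-> _]] := @trunc_part_itv k t; first by rewrite normr_ge0.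
rewrite sign_norm !normrMsign (ger0_norm s0) ger0_norm ?subr_ge0//.
by split=> //; rewrite lerBlDr lerDl.
Qed.

Lemma trunc_part_near k t : `|t| <= k%:R -> `|t - trunc_part k t| <= k%:R^-1.
Proof.
move=> tk; have [|s /andP[s0 st] [-> H]] := @trunc_part_itv k t; first by rewrite normr_ge0.
by rewrite sign_norm normrMsign ger0_norm ?subr_ge0.
Qed.

Lemma trunc_part_cvg t : trunc_part k t @[k --> \oo] --> t.
Proof.
apply/cvgrPdist_le => e e0; near=> k.
apply: le_trans (trunc_part_near _) _.
  by near: k; exact: nbhs_infty_ger.
have ek : e^-1 <= k%:R by near: k; exact: nbhs_infty_ger.
by rewrite -[e]invrK lef_pV2 ?posrE ?invr_gt0// (lt_le_trans _ ek) ?invr_gt0.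
Unshelve. all: by end_near. Qed.

Lemma measurable_trunc_index k (f : T -> R) : measurable_fun [set: T] f ->
  measurable_fibers (trunc_index k \o f).
Proof.
move=> mf [b m].
have ltf (g h : T -> R) : measurable_fun [set: T] g -> measurable_fun [set: T] h ->
    measurable [set x | g x < h x].
  by move=> mg mh; have := measurable_fun_ltr mg mh measurableT (_ : measurable [set true]); rewrite setTI; apply.
have lef (g h : T -> R) : measurable_fun [set: T] g -> measurable_fun [set: T] h ->
    measurable [set x | g x <= h x].
  by move=> mg mh; have := measurable_fun_ler mg mh measurableT (_ : measurable [set true]); rewrite setTI; apply.
have mn : measurable_fun [set: T] (fun x => `|f x|) by exact: measurableT_comp.
have mkn : measurable_fun [set: T] (fun x => k%:R * `|f x|) by exact: measurable_funM.
rewrite (_ : _ @^-1` _ = [set x | (f x < 0) = b] `&`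
   ([set x | `|f x| <= k%:R] `&` ([set x | m%:R <= k%:R * `|f x|] `&` [set x | k%:R * `|f x| < m.+1%:R])
    `|` [set x | k%:R < `|f x|] `&` [set x | m = 0%N :> nat])).
  apply: measurableI.
    rewrite (_ : [set x | _] = if b then [set x | f x < 0] else [set x | 0 <= f x]).
      by case: b; [exact: ltf|exact: lef].
    by apply/seteqP; split=> x /=; case: b => /=; case: ltP.
  apply: measurableU.
    by apply: measurableI; [exact: lef|apply: measurableI; [exact: lef|exact: ltf]].
  apply: measurableI; first exact: ltf.
  have [m0|m0] := eqVneq (m : nat) 0%N.
    by rewrite (_ : [set _ | _] = setT)//; apply/seteqP; split.
  by rewrite (_ : [set _ | _] = set0)//; apply/seteqP; split=> // x; apply/eqP.
have tr x : `|f x| <= k%:R -> (Num.truncn (k%:R * `|f x|) < (k * k).+1)%N.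
  move=> fk; rewrite ltnS -(ler_nat R) natrM.
  have : (Num.truncn (k%:R * `|f x|))%:R <= k%:R * `|f x| by rewrite truncn_le mulr_ge0.
  by move/le_trans; apply; rewrite ler_wpM2l.
apply/seteqP; split=> x /=.
  move=> [-> <-]; split=> //; have [fk|fk] := leP `|f x| k%:R; last by right; rewrite inordK.
  left; rewrite inordK; last exact: tr.
  by have /andP[] := truncn_itv (mulr_ge0 (ler0n R k) (normr_ge0 (f x))).
move=> [<-] [[fk [m1 m2]]|[fk m0]]; congr pair; apply/val_inj; rewrite /= ?fk.
  by rewrite inordK; [apply: truncn_def; rewrite m1|exact: tr].
by rewrite leNgt fk /= inordK.
Qed.

(** Dominated convergence if p < oo. If p = oo, the error is at most 1/k almost
everywhere once k exceeds the essential supremum. *)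
Lemma trunc_approx (f : T -> R) (e : R) : measurable_fun [set: T] f -> finite_norm mu p f ->
  0 < e -> exists k, (nrm (fun x => (f x - trunc_part k (f x))%R) < e%:E)%E.
Proof.
move=> mf; rewrite /finite_norm => fp e0.
have ms k : measurable_fun [set: T] (fun x => trunc_part k (f x)).
  rewrite (_ : (fun x => _) = @trunc_value k \o (trunc_index k \o f)).
    by apply: measurable_finite_valued; exact: measurable_trunc_index.
  by apply/funext => x; rewrite /= trunc_index_value.
have md k : measurable_fun [set: T] (fun x => f x - trunc_part k (f x)).
  exact: measurable_funB.
case: p p1 fp => [r r1|_|]; last by rewrite leeNy_eq.
- have r0 : 0 < r by rewrite -lte_fin; apply: lt_le_trans r1; rewrite lte01.
  move=> fp.
  have fr : mu.-integrable setT (fun x => (`|f x| `^ r)%:E).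
    apply/integrableP; split; first exact: measurable_powR_norm.
    under eq_integral do rewrite gee0_abs ?lee_fin ?powR_ge0//.
    have := poweR_Lnorm mu (EFin \o f) (lt0r_neq0 r0).
    under eq_integral => x _ do rewrite abse_EFin poweR_EFin.
    by move=> <-; exact: poweR_lty.
  have H : (\int[mu]_x (`|f x - trunc_part k (f x)| `^ r)%:E)%E @[k --> \oo] --> (\int[mu]_x (cst 0 x))%E.
    apply: (@dominated_cvg _ _ _ mu setT _ _ _ (fun x => (`|f x| `^ r)%:E)) => //.
    + by move=> k; exact: measurable_powR_norm.
    + move=> x _; apply: cvg_EFin; first by apply: nearW.
      apply/cvgrPdist_le => eps eps0; near=> k; rewrite sub0r normrN ger0_norm ?powR_ge0//.
      have ek : `|f x - trunc_part k (f x)| <= eps `^ r^-1.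
        rewrite distrC; near: k; apply: cvgr_distC_le; last exact: powR_gt0.
        exact: trunc_part_cvg.
      apply: (@le_trans _ _ ((eps `^ r^-1) `^ r)).
        by apply: ge0_ler_powR; rewrite ?nnegrE ?powR_ge0// ltW.
      by rewrite -powRrM mulVf ?gt_eqF// powRr1// ltW.
    + move=> k x _; rewrite gee0_abs ?lee_fin ?powR_ge0//.
      apply: ge0_ler_powR; rewrite ?nnegrE// ?(ltW r0)//.
      by have [] := trunc_part_le k (f x).
  rewrite integral0 in H.
  have [k Hk] : exists k, (\int[mu]_x (`|f x - trunc_part k (f x)| `^ r)%:E < (e `^ r)%:E)%E.
    have /H [N _ /(_ N (leqnn N))] : nbhs 0%E [set y | (y < (e `^ r)%:E)%E]; last by exists N.
    by apply: open_nbhs_nbhs; split; [exact: open_ereal_lt_ereal|rewrite /= lte_fin powR_gt0].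
  exists k; rewrite ltNge; apply/negP => He.
  move: Hk; rewrite ltNge => /negP; apply.
  have := poweR_Lnorm mu (EFin \o (fun x => f x - trunc_part k (f x))) (lt0r_neq0 r0).
  under eq_integral => x _ do rewrite abse_EFin poweR_EFin.
  move=> <-; rewrite -poweR_EFin; apply: gt0_ler_poweR => //.
  + exact: ltW.
  + by rewrite in_itv/= leey lee_fin ltW.
  + by rewrite in_itv/= leey Lnorm_ge0.
- rewrite unlock /Lnorm; case: ifPn => mu0; last by move=> _; exists 0%N; rewrite lte_fin.
  move=> fp.
  have f0 : (0 <= ess_sup mu (abse \o (EFin \o f)))%E.
    by apply: ess_sup_gee => //; apply: aeW => x /=.
  have [M ME] : exists M : R, ess_sup mu (abse \o (EFin \o f)) = M%:E.
    by exists (fine (ess_sup mu (abse \o (EFin \o f)))); rewrite fineK// ge0_fin_numE.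
  pose k := (Num.truncn (Num.max M (2 / e))).+1.
  have Mk : Num.max M (2 / e) < k%:R by exact: truncnS_gt.
  have k1 : k%:R^-1 <= e / 2.
    rewrite -[e / 2]invrK lef_pV2 ?posrE ?invr_gt0 ?divr_gt0// invf_div.
    by apply: ltW; apply: le_lt_trans Mk; rewrite le_max lexx orbT.
  exists k; apply: (@le_lt_trans _ _ (e / 2)%:E); last by rewrite lte_fin ltr_pdivrMr// ltr_pMr// ltr1n.
  apply/ess_supP; have := ess_sup_ge mu (abse \o (EFin \o f)); rewrite ME.
  apply: filterS => x /=; rewrite !lee_fin => fM; apply: le_trans k1.
  apply: trunc_part_near; apply: le_trans fM _; apply: ltW; apply: le_lt_trans Mk.
  by rewrite le_max lexx.
Unshelve. all: by end_near. Qed.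

Lemma simple_approx (f : Lf) (e : R) : 0 < e ->
  exists (J : finType) (i : T -> J) (v : J -> R) (g : Lf),
    [/\ measurable_fibers i, (g : T -> R) = v \o i & `|Lp_class (f - g)| < e].
Proof.
move=> e0.
have mf : measurable_fun [set: T] f by [].
have [k kH] := trunc_approx mf (@Lfunction_finite _ _ _ _ _ p1 f) e0.
have sE : (fun x => trunc_part k (f x)) = @trunc_value k \o (trunc_index k \o f).
  by apply/funext => x; rewrite /= trunc_index_value.
have ms : measurable_fun [set: T] (fun x => trunc_part k (f x)).
  by rewrite sE; apply: measurable_finite_valued; exact: measurable_trunc_index.
have sL : (fun x => trunc_part k (f x)) \in Lfun mu p.
  by apply: (@Lfun_dominated _ f) => // x; have [] := trunc_part_le k (f x).
exists _, (trunc_index k \o f), (@trunc_value k), (Lfun_Sub p1 sL); split=> //.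
  exact: measurable_trunc_index.
by rewrite normr_Lp_class -lte_fin finite_norm_fine.
Qed.

(** The product of the partitions of the individual functions is a common one. *)
Lemma joint_simple_approx L (f : 'I_L -> Lf) (e : R) : 0 < e ->
  exists (J : finType) (i : T -> J), measurable_fibers i /\ forall l,
    exists (v : J -> R) (g : Lf), (g : T -> R) = v \o i /\ `|Lp_class (f l - g)| < e.
Proof.
move=> e0.
elim: L f => [|L IHL] f.
  exists unit, (fun=> tt); split; last by case.
  by move=> []; rewrite (_ : _ @^-1` _ = setT)//; apply/seteqP; split.
have [J [i [mi Hi]]] := IHL (fun l => f (lift ord0 l)).
have [J0 [i0 [v0 [g0 [mi0 gE0 ge0]]]]] := simple_approx (f ord0) e0.
exists (J0 * J)%type, (fun x => (i0 x, i x)); split.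
  move=> [j0 j]; rewrite (_ : _ @^-1` _ = i0 @^-1` [set j0] `&` i @^-1` [set j]).
    exact: measurableI.
  by apply/seteqP; split=> x /=; [move=> [-> ->]|move=> [-> ->]].
move=> l; case: (unliftP ord0 l) => [l' ->|->]; last by exists (v0 \o fst), g0.
by have [v [g [gE ge]]] := Hi l'; exists (v \o snd), g.
Qed.

End LpSimple.

(** * Normalised indicators of disjoint sets *)

Section Atoms.
Context d (T : measurableType d) (R : realType).
Variables (mu : {measure set T -> \bar R}) (p : \bar R) (p1 : (1 <= p)%E).
Local Notation Lf := (LfunType mu p1).
Local Notation nrm f := ('N[mu]_p[EFin \o f])%E.
Variables (N : nat) (A : 'I_N -> set T).
Hypothesis mA : forall k, measurable (A k).
Hypothesis dA : forall k l x, A k x -> A l x -> k = l.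
Hypothesis gA : forall k, (\1_(A k) : T -> R) \in Lfun mu p.
Hypothesis A0 : forall k, (0 < mu (A k))%E.

Definition step (c : 'I_N -> R) : T -> R := fun x => \sum_k c k * \1_(A k) x.

Lemma step_at c k x : A k x -> step c x = c k.
Proof.
move=> Ax; rewrite /step (bigD1 k)//= big1 ?addr0 => [|l lk].
  by rewrite indicE mem_set// mulr1.
rewrite indicE memNset ?mulr0// => Alx.
by rewrite (dA Alx Ax) eqxx in lk.
Qed.

Lemma step_off c x : (forall k, ~ A k x) -> step c x = 0.
Proof.
by move=> Ax; rewrite /step big1// => k _; rewrite indicE memNset ?mulr0.
Qed.

(** As the sets are disjoint, at most one term of the sum is nonzero at x. *)
Lemma step_comp c (F : R -> R) : F 0 = 0 -> forall x, F (step c x) = step (F \o c) x.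
Proof.
move=> F0 x; have [[k Ax]|Ax] := pselect (exists k, A k x).
  by rewrite !(step_at _ Ax).
by rewrite !step_off// => k Akx; apply: Ax; exists k.
Qed.

Lemma norm_step r c : p = r%:E -> (nrm (step c) `^ r = \sum_k (`|c k| `^ r)%:E * mu (A k))%E.
Proof.
move=> pr; have r0 : 0 < r.
  by rewrite -lte_fin -pr; apply: lt_le_trans p1; rewrite lte01.
rewrite pr poweR_Lnorm ?gt_eqF//.
under eq_integral => x _.
  rewrite abse_EFin poweR_EFin (@step_comp c (fun t => `|t| `^ r)); last first.
    by rewrite normr0 powR0// gt_eqF.
  rewrite /step -sumEFin.
  under eq_bigr do rewrite EFinM.
  over.
rewrite ge0_integral_sum//; last 2 first.
- move=> k; apply/measurable_EFinP; apply: measurable_funM => //; exact: measurable_indic.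
- by move=> k x _; rewrite mule_ge0// lee_fin ?powR_ge0// indicE.
apply: eq_bigr => k _; rewrite ge0_integralZl//.
- by rewrite integral_indic// setIT.
- apply/measurable_EFinP; exact: measurable_indic.
- by rewrite lee_fin powR_ge0.
Qed.

Lemma step_Lfun c : step c \in Lfun mu p.
Proof.
rewrite (_ : step c = \sum_k c k *: (\1_(A k) : T -> R)).
  by apply: rpred_sum => k _; exact: rpredZ.
by apply/funext => x; rewrite /step fct_sumE; apply: eq_bigr.
Qed.

Definition stepL c : Lf := Lfun_Sub p1 (step_Lfun c).
Definition atomL k : Lf := Lfun_Sub p1 (gA k).

Lemma stepLE c : Lp_class (stepL c) = \sum_k c k *: Lp_class (atomL k).
Proof.
have -> : stepL c = \sum_k c k *: atomL k.
  apply/LfuneqP => x; rewrite /= /step.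
  have -> : (\sum_k c k *: atomL k : Lf) x = \sum_k (c k *: atomL k : Lf) x.
    by elim/big_rec2: _ => // k y1 y2 _ <-.
  by apply: eq_bigr.
rewrite /Lp_class linear_sum; apply: eq_bigr => k _; exact: linearZ.
Qed.

Lemma atomL_neq0 k : 0 < `|Lp_class (atomL k)|.
Proof.
rewrite lt_def normr_ge0 andbT; apply/eqP; rewrite normr_Lp_class => /fine_Lnormr_eq0 H.
have : (mu.-negligible (A k)).
  apply: (@negligibleS _ _ _ mu _ _ _ H) => x Ax /= /(_ I).
  by rewrite indicE mem_set// => /eqP; rewrite oner_eq0.
move=> /negligibleP - /(_ (mA k)) A00; have := A0 k; rewrite A00 ltxx//.
Qed.

Definition unit_atom k : Lp mu p1 := `|Lp_class (atomL k)|^-1 *: Lp_class (atomL k).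

Lemma unit_atomE b : \sum_k b k *: unit_atom k = Lp_class (stepL (fun k => b k / `|Lp_class (atomL k)|)).
Proof. by rewrite stepLE; apply: eq_bigr => k _; rewrite scalerA. Qed.

(** Normalised indicators of disjoint sets span an isometric copy of l_r. *)
Lemma norm_unit_atoms r b : p = r%:E -> `|\sum_k b k *: unit_atom k| `^ r = \sum_k `|b k| `^ r.
Proof.
move=> pr; rewrite unit_atomE; apply: EFin_inj; rewrite -poweR_EFin normr_Lp_class finite_norm_fine.
rewrite (norm_step _ pr) -sumEFin; apply: eq_bigr => k _.
have w0 := atomL_neq0 k; set w := `|_| in w0 *.
have -> : mu (A k) = (w `^ r)%:E.
  have := norm_step (fun l => (l == k)%:R) pr.
  have -> : step (fun l => (l == k)%:R) = atomL k.
    apply/funext => x; rewrite /step (bigD1 k)//= eqxx mul1r big1 ?addr0// => l lk.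
    by rewrite (negbTE lk) mul0r.
  rewrite -finite_norm_fine -normr_Lp_class poweR_EFin -/w => ->.
  rewrite (bigD1 k)//= eqxx normr1 powR1 mul1e big1 ?adde0// => l lk.
  rewrite (negbTE lk) normr0 powR0 ?mul0e//.
  have : (1 <= r%:E)%E by rewrite -pr.
  by rewrite lee_fin => /(lt_le_trans ltr01)/lt0r_neq0.
rewrite -EFinM normrM normfV (gtr0_norm w0) -powRM ?divr_ge0 ?(ltW w0)//.
by rewrite divfK// gt_eqF.
Qed.

(** The span is a copy of l_oo: a bound that holds almost everywhere holds
somewhere on each of the sets, as they have positive measure. *)
Lemma norm_unit_atoms_oo b : p = +oo%E ->
  (forall k s, `|\sum_k b k *: unit_atom k| <= s -> `|b k| <= s) /\
  (forall s, 0 <= s -> (forall k, `|b k| <= s) -> `|\sum_k b k *: unit_atom k| <= s).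
Proof.
move=> py; rewrite unit_atomE.
have T0 (k : 'I_N) : (0 < mu [set: T])%E.
  by have /lt_le_trans := A0 k; apply; apply: le_measure; rewrite ?inE.
have nE f : nrm f = (if (0 < mu [set: T])%E then ess_sup mu (abse \o (EFin \o f)) else 0)%E.
  by rewrite py unlock.
have low (f : T -> R) k t s : (nrm f <= s%:E)%E -> (forall x, A k x -> `|f x| = t) -> t <= s.
  rewrite nE (T0 k) => /ess_supP H Af.
  rewrite leNgt; apply/negP => st.
  have : mu.-negligible (A k).
    apply: (@negligibleS _ _ _ mu _ _ _ H) => x Ax /=.
    by rewrite lee_fin (Af x Ax) leNgt st.
  by move=> /negligibleP - /(_ (mA k)) A00; have := A0 k; rewrite A00 ltxx.
have w1 k : `|Lp_class (atomL k)| = 1.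
  apply/eqP; rewrite eq_le; apply/andP; split.
    rewrite -lee_fin normr_Lp_class finite_norm_fine nE (T0 k).
    apply/ess_supP/aeW => x /=; rewrite indicE lee_fin.
    by case: (_ \in _); rewrite ?normr1 ?normr0.
  apply: (low (\1_(A k)) k); first by rewrite normr_Lp_class finite_norm_fine.
  by move=> x Ax; rewrite indicE mem_set// normr1.
split=> [k s|s s0 bs].
  rewrite -lee_fin normr_Lp_class finite_norm_fine => H; apply: (low _ k _ _ H) => x Ax.
  by rewrite /= (step_at _ Ax) w1 divr1.
rewrite -lee_fin normr_Lp_class finite_norm_fine nE; case: ifPn => // _.
apply/ess_supP/aeW => x /=; rewrite lee_fin.
have [[k Ax]|Ax] := pselect (exists k, A k x).
  by rewrite (step_at _ Ax) w1 divr1.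
by rewrite step_off ?normr0// => k Akx; apply: Ax; exists k.
Qed.

End Atoms.

(** * Finite-dimensional sections of L_p *)

Section FiniteSections.
Context (R : realType).

(** Any finite family in X is close to the span of vectors g on which the norm
is equivalent to that of l_r, up to a factor 2. The exponent r may depend on the
family, as it must for L_oo, but its conjugate q is bounded by Q. *)
Definition lr_sections (X : normedModType R) (Q : R) :=
  forall L (u : 'I_L -> X) (e : R), 0 < e -> exists N (g : 'I_N -> X) (r q : R),
  [/\ [/\ 1 < r, 1 <= q <= Q & r^-1 + q^-1 = 1],
    forall b : 'I_N -> R, \sum_k `|b k| `^ r <= 1 -> `|\sum_k b k *: g k| <= 1,
    forall (b : 'I_N -> R) s, `|\sum_k b k *: g k| <= s -> \sum_k `|b k| `^ r <= (2 * s) `^ r &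
    forall l, exists b : 'I_N -> R, `|u l - \sum_k b k *: g k| < e].

Variables (d : measure_display) (T : measurableType d) (mu : {measure set T -> \bar R}).

(** Only atoms of positive measure with indicator in L_p are kept. Null atoms do
not change the class of a function, and a function of L_p that is constant on an
atom whose indicator is not in L_p vanishes there. *)
Lemma Lp_simple_section (p : \bar R) (p1 : (1 <= p)%E) L (u : 'I_L -> Lp mu p1) (e : R) : 0 < e ->
  exists N (A : 'I_N -> set T) (mA : forall k, measurable (A k))
  (dA : forall k l x, A k x -> A l x -> k = l)
  (gA : forall k, (\1_(A k) : T -> R) \in Lfun mu p) (A0 : forall k, (0 < mu (A k))%E),
  forall l, exists b : 'I_N -> R, `|u l - \sum_k b k *: unit_atom p1 gA k| < e.
Proof.
move=> e0.
have /choice [f fE] l : exists f, Lp_class f = u l by apply: quot_proj_surj.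
have [J [i [mi Hi]]] := joint_simple_approx f e0.
pose at_ j := i @^-1` [set j].
pose good j := ((\1_(at_ j) : T -> R) \in Lfun mu p) && (0 < mu (at_ j))%E.
pose J' := {j : J | good j}.
pose idx (k : 'I_(#|{: J'}|)) : J := val (enum_val k).
have gi k : good (idx k) by exact: (valP (enum_val k)).
pose A k := at_ (idx k).
have mA k : measurable (A k) by exact: mi.
have dA k l x : A k x -> A l x -> k = l.
  by rewrite /A /at_ /= => -> H; apply: enum_val_inj; exact: val_inj.
have gA k : (\1_(A k) : T -> R) \in Lfun mu p by have /andP[] := gi k.
have A0 k : (0 < mu (A k))%E by have /andP[] := gi k.
exists _, A, mA, dA, gA, A0 => l.
have [v [g [gE ge]]] := Hi l.
have w0 k : 0 < `|Lp_class (atomL p1 gA k)| by apply: atomL_neq0.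
exists (fun k => v (idx k) * `|Lp_class (atomL p1 gA k)|).
suff -> : \sum_k v (idx k) * `|Lp_class (atomL p1 gA k)| *: unit_atom p1 gA k = Lp_class g.
  by rewrite -fE /Lp_class -linearB.
rewrite unit_atomE; apply/quot_projE/asboolP.
pose bad j := if good j then set0 else if (mu (at_ j) == 0)%E then at_ j else set0.
have nb : mu.-negligible (\big[setU/set0]_(j : J) bad j).
  elim/big_ind: _ => [|B C nB nC|j _]; [exact: negligible_set0|exact: negligibleU|].
  rewrite /bad; case: ifP => _; first exact: negligible_set0.
  case: ifPn => [/eqP m0|_]; last exact: negligible_set0.
  by apply/negligibleP => //; exact: mi.
apply: (@negligibleS _ _ _ mu _ _ _ nb) => x /= H.
have offE : ~~ good (i x) -> forall k, ~ A k x.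
  by move=> /negP gx k Akx; apply: gx; have := gi k; rewrite -(_ : i x = idx k).
rewrite (bigD1 (i x))//=; left; rewrite /bad.
have gxE : g x = v (i x) by rewrite gE.
have stepE c y : stepL p1 gA c y = step A c y by [].
have diffE c : (stepL p1 gA c - g : LfunType mu p1) x = step A c x - g x by [].
case: ifPn => [gx|gx].
  case: H => _; pose k : 'I_(#|{: J'}|) := enum_rank (exist _ (i x) gx : J').
  have kE : idx k = i x by rewrite /idx enum_rankK.
  have Ax : A k x by rewrite /A /at_ /= kE.
  rewrite -[LHS]/((stepL p1 gA _ - g : LfunType mu p1) x) diffE gxE (step_at dA _ Ax) kE.
  by rewrite mulfK ?subrr// gt_eqF.
case: ifPn => [//|mu0]; case: H => _.
rewrite -[LHS]/((stepL p1 gA _ - g : LfunType mu p1) x) diffE step_off; last exact: offE.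
rewrite sub0r gxE; have [->|vx] := eqVneq (v (i x)) 0; first by rewrite oppr0.
case/negP: gx; rewrite /good lt0e mu0 measure_ge0 !andbT.
apply: (@Lfun_dominated _ _ _ mu p p1 _ ((v (i x))^-1 *: g)).
  by apply: measurable_indic; exact: mi.
move=> y; rewrite -[X in _ <= `|X|]/((v (i x))^-1 * g y) gE indicE.
have [yx|_] := boolP (y \in _); last by rewrite normr0.
by move: yx; rewrite inE /at_ /= => ->; rewrite mulVf.
Qed.

(** For p < oo the exponent is p itself. For p = oo and N atoms, r = N + 2 works:
if |b_j| <= s for all j, then sum_j |b_j|^r <= N s^r <= (2 s)^r, and the
conjugate exponent of r is at most 2. *)
Lemma Lp_has_lr_sections (p p' : \bar R) (p_gt1 : (1 < p)%E) : (p^-1 + p'^-1 = 1)%E ->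
  exists2 Q : R, lr_sections (Lp mu (ltW p_gt1)) Q & 0 < Q /\ (Q%:E <= 2%:E * p')%E.
Proof.
move=> pp'; case pE : p p_gt1 pp' => [r||] p_gt1 pp' //.
- have r1 : 1 < r by rewrite -lte_fin.
  have r0 : 0 < r by apply: lt_trans r1.
  have ri : r^-1 < 1 by rewrite invf_lt1.
  have ri0 : 0 < 1 - r^-1 by rewrite subr_gt0.
  pose q := (1 - r^-1)^-1.
  have q1 : 1 <= q by rewrite invf_ge1// gerBl invr_ge0 ltW.
  have p'E : p' = q%:E.
    rewrite -[p']inveK; move: pp'; rewrite inver (gt_eqF r0); case: (p'^-1)%E => [s||] //= [rs].
    have -> : s = 1 - r^-1 by rewrite -rs addrAC subrr add0r.
    by rewrite inver gt_eqF.
  exists q; last first.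
    by rewrite p'E -EFinM lee_fin; split; [exact: lt_le_trans q1|rewrite ler_peMl ?ler1n//; exact: le_trans q1].
  move=> L u e e0.
  have [N [A [mA [dA [gA [A0 H]]]]]] := Lp_simple_section u e0.
  exists N, (unit_atom (ltW p_gt1) gA), r, q; split=> //.
  + by rewrite r1 q1 lexx; split=> //; rewrite /q invrK addrC subrK.
  + move=> b b1; have := norm_unit_atoms (ltW p_gt1) mA dA gA A0 b erefl.
    set S := `|_| => Sb; rewrite leNgt; apply/negP => S1.
    move: b1; rewrite -Sb leNgt => /negP; apply.
    have := @gt0_ltr_powR R r r0 1 S; rewrite powR1; apply=> //; rewrite ?nnegrE ?ler01 ?normr_ge0//.
  + move=> b s bs; have s0 : 0 <= s by apply: le_trans bs.
    rewrite -(norm_unit_atoms (ltW p_gt1) mA dA gA A0 b erefl).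
    apply: ge0_ler_powR; rewrite ?nnegrE// ?(ltW r0)//.
      by rewrite mulr_ge0.
    by apply: le_trans bs _; rewrite ler_peMl ?ler1n.
- have p'E : p' = 1%E.
    by rewrite -[p']inveK; move: pp'; rewrite invey add0e => ->; rewrite inve1.
  exists 2; last by rewrite p'E mule1.
  move=> L u e e0.
  have [N [A [mA [dA [gA [A0 H]]]]]] := Lp_simple_section u e0.
  pose r : R := N.+2%:R.
  have r2 : 2 <= r by rewrite ler_nat.
  have r0 : 0 < r by apply: lt_le_trans r2.
  have ri : r^-1 <= 2^-1 by rewrite lef_pV2 ?posrE.
  have ri0 : 0 < 1 - r^-1.
    by rewrite subr_gt0; apply: le_lt_trans ri _; rewrite invf_lt1// ltr1n.
  exists N, (unit_atom (ltW p_gt1) gA), r, (1 - r^-1)^-1; split=> //.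
  + split; first by apply: lt_le_trans r2; rewrite ltr1n.
    * rewrite invf_ge1// gerBl invr_ge0 ltW//= -[leRHS]invrK lef_pV2 ?posrE ?invr_gt0//.
      by rewrite lerBrDr [leRHS]splitr !mul1r lerD2l.
    * by rewrite invrK addrC subrK.
  + move=> b b1; have [_] := norm_unit_atoms_oo (ltW p_gt1) mA dA gA A0 b erefl.
    apply => // k; rewrite leNgt; apply/negP => bk.
    move: b1; rewrite leNgt => /negP; apply; rewrite (bigD1 k)//=; apply: ltr_wpDr.
      by apply: sumr_ge0 => l _; exact: powR_ge0.
    have := @gt0_ltr_powR R r r0 1 `|b k|; rewrite powR1; apply=> //; rewrite ?nnegrE ?ler01 ?normr_ge0//.
  + move=> b s bs; have [H1 _] := norm_unit_atoms_oo (ltW p_gt1) mA dA gA A0 b erefl.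
    have s0 : 0 <= s by apply: le_trans bs.
    have {}H1 k : `|b k| `^ r <= s `^ r.
      by apply: ge0_ler_powR; rewrite ?nnegrE// ?(ltW r0)//; exact: H1.
    apply: le_trans (ler_sum _ (fun k _ => H1 k)) _.
    rewrite sumr_const card_ord powRM// -[_ *+ N]mulr_natl ler_wpM2r ?powR_ge0//.
    rewrite powR_mulrn// -natrX ler_nat.
    by apply: (@leq_trans N.+2); rewrite ?leqW//; apply: ltnW; exact: ltn_expl.
Qed.

End FiniteSections.

(** * Near-identity matrices, nets and measurable selections *)

Section Reduction.
Context {R : realType}.

Lemma coord_le_norm n (x : 'rV[R]_n) j : `|x 0 j| <= `|x|.
Proof.
have := norm_cubeV x (normr_ge0 x); rewrite lexx => /esym/asboolP; exact.
Qed.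

Lemma norm_le_coord n (x : 'rV[R]_n) r : 0 <= r -> (forall j, `|x 0 j| <= r) -> `|x| <= r.
Proof. by move=> r0 xr; rewrite norm_cubeV//; apply/asboolP. Qed.

(** t = t B - t (B - 1), and the last term is at most |t| / 2. *)
Lemma near_id_unit n (B : 'M[R]_n) (h : R) : 0 <= h -> n%:R * h <= 2^-1 ->
  (forall k j, `|B k j - (k == j)%:R| <= h) ->
  B \in unitmx /\ forall t : 'rV[R]_n, `|t| <= 2 * `|t *m B|.
Proof.
move=> h0 nh Bh.
have H (t : 'rV[R]_n) : `|t| <= 2 * `|t *m B|.
  suff : `|t| <= `|t *m B| + 2^-1 * `|t| by lra.
  apply: norm_le_coord => [|j]; first by rewrite addr_ge0// mulr_ge0.
  have -> : t 0 j = (t *m B) 0 j - \sum_k t 0 k * (B k j - (k == j)%:R).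
    rewrite mxE -sumrB [RHS](eq_bigr (fun k => t 0 k * (k == j)%:R)); last by move=> k _; ring.
    by rewrite (bigD1 j)//= eqxx mulr1 big1 ?addr0// => k kj; rewrite (negbTE kj) mulr0.
  apply: le_trans (ler_normB _ _) _; apply: lerD; first exact: coord_le_norm.
  apply: le_trans (ler_norm_sum _ _ _) _.
  apply: (@le_trans _ _ (\sum_(k < n) `|t| * h)).
    by apply: ler_sum => k _; rewrite normrM ler_pM//; exact: coord_le_norm.
  by rewrite sumr_const card_ord -[X in X <= _]mulr_natl [`|t| * h]mulrC mulrA ler_wpM2r.
split=> //; rewrite -row_free_unit -kermx_eq0; apply/rowV0P => v /sub_kermxP vB.
by have := H v; rewrite vB normr0 mulr0 normr_le0 => /eqP.
Qed.

Lemma continuous_dist n (c : 'rV[R]_n) : continuous (fun x : 'rV[R]_n => `|x - c|).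
Proof.
move=> x A /nbhs_ballP[e /= e0 eA]; apply/nbhs_ballP; exists e => //= y.
rewrite -ball_normE /= => xy; apply: eA; rewrite -ball_normE /=.
by apply: le_lt_trans (ler_dist_dist _ _) _; rewrite opprB addrA subrK.
Qed.

(** A list of pairs (c, f) encodes a map that is f near the first centre c
within e of x. *)
Fixpoint select n N (s : seq ('rV[R]_n * ('rV[R]_n -> 'rV[R]_N))) (e : R) (x : 'rV[R]_n) : 'rV[R]_N :=
  if s is (c, f) :: s' then if `|x - c| <= e then f x else select s' e x else 0.

Lemma select_near n N (s : seq ('rV[R]_n * ('rV[R]_n -> 'rV[R]_N))) e x (P : 'rV[R]_N -> Prop) :
  (exists2 i, (i < size s)%N & `|x - (nth (0, fun=> 0) s i).1| <= e) ->
  (forall i, (i < size s)%N -> `|x - (nth (0, fun=> 0) s i).1| <= e -> P ((nth (0, fun=> 0) s i).2 x)) ->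
  P (select s e x).
Proof.
elim: s => [|[c f] s IHs] /=; first by case.
move=> [i si ie] H; case: ifPn => [xc|xc]; first exact: (H 0%N).
apply: IHs => [|j js]; last exact: (H j.+1).
by case: i si ie => [_ /= cx|i]; [rewrite cx in xc|exists i].
Qed.

Lemma measurable_select n N (s : seq ('rV[R]_n * ('rV[R]_n -> 'rV[R]_N))) e j :
  (forall i, continuous (fun x => (nth (0, fun=> 0) s i).2 x 0 j)) ->
  measurable_fun [set: mV R n] (fun x : 'rV[R]_n => select s e x 0 j).
Proof.
elim: s => [|[c f] s IHs] H /=; first by apply: measurable_cst.
rewrite (_ : (fun x => _) = (fun x : mV R n => if `|x - c| <= e then f x 0 j else select s e x 0 j)).
  apply: measurable_fun_ifT.
  - apply: measurable_fun_ler => //; apply: continuous_mV.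
    have C : continuous (fun x : 'rV[R]_n => `|x - c|).
      exact: continuous_dist.
    exact: C.
  - by apply: continuous_mV; exact: (H 0%N).
  - by apply: IHs => i; exact: (H i.+1).
by apply/funext => x; case: ifP.
Qed.

Lemma compact_net n (K : set 'rV[R]_n) (e : R) : compact K -> 0 < e ->
  exists s : seq 'rV[R]_n, (forall x, x \in s -> K x) /\ forall x, K x -> exists2 i, (i < size s)%N & `|x - nth 0 s i| <= e.
Proof.
move=> cK e0; move: (cK); rewrite compact_cover => /(_ _ K (fun y => ball y e)).
move=> [|x Kx|D DK KD].
- by move=> y _; exact: ball_open.
- by exists x => //; exact: ballxx.
exists (finmap.enum_fset D); split=> [x xD|x /KD[y /= yD xy]].
  by have := DK x xD; rewrite inE.
exists (index y (finmap.enum_fset D)); first by rewrite index_mem.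
rewrite nth_index// distrC; apply: ltW.
by move: xy; rewrite -ball_normE.
Qed.

End Reduction.

(** * Reduction of a quotient map to finitely many generators *)

Section Slicing.
Context {R : realType}.
(* pi stands for the quotient map and K for the unit ball of the quotient. *)
Variables (X : normedModType R) (Q : R) (n : nat) (pi : {linear X -> 'rV[R]_n.+1}) (K : set 'rV[R]_n.+1).
Variable beta : R.
Hypotheses (LX : lr_sections X Q) (bK : body K) (V0 : 0 < vol K) (Q0 : 0 < Q) (b0 : 0 <= beta).
Hypothesis piK : forall x, `|x| <= 1 -> K (pi x).
Hypothesis Kpi : forall y, K y -> exists2 x, pi x = y & `|x| <= 2.
Hypothesis pi_surj : forall y, exists x, pi x = y.
Hypothesis sections : forall u : 'rV[R]_n.+1, dot u u = 1 -> exists U : 'M[R]_(n, n.+1),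
  [/\ U *m U^T = 1%:M, U *m u^T = 0 & vol [set v | K (v *m U)] <= beta].

Definition comb N (g : 'I_N -> X) (b : 'rV[R]_N) : X := \sum_k b 0 k *: g k.

Lemma comb_linear N (g : 'I_N -> X) : linear (comb g).
Proof.
move=> a u v; rewrite /comb scaler_sumr -big_split; apply: eq_bigr => k _ /=.
by rewrite !mxE scalerDl scalerA.
Qed.

HB.instance Definition _ N (g : 'I_N -> X) :=
  GRing.isLinear.Build R 'rV[R]_N X *:%R (comb g) (comb_linear g).

Lemma pi_comb N (g : 'I_N -> X) b : pi (comb g b) = b *m \matrix_k pi (g k).
Proof.
rewrite mulmx_sum_row linear_sum; apply: eq_bigr => k _.
by rewrite linearZ rowK.
Qed.

Lemma comb_mul m N (g : 'I_N -> X) (t : 'rV[R]_m) (V : 'M[R]_(m, N)) :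
  comb g (t *m V) = \sum_k t 0 k *: comb g (row k V).
Proof. by rewrite mulmx_sum_row linear_sum; apply: eq_bigr => k _; rewrite linearZ. Qed.

(** Lift a finite net of K and the standard basis to X, and approximate all these
lifts in one section. The net point closest to x gives coefficients of x up to a
small error. The approximate lifts W of the basis have an image B close to the
identity, hence correct that error exactly and linearly. The vector of X obtained
in this way has norm at most 4, so the l_r norm of its coefficients is at most 8. *)
Lemma slicing_reduction : (vol K) ^+ n.+1 <= (3 * beta * (moment_cst * Q * 8)) ^+ n.+1 * vol K.
Proof.
have [cK vK sK] := bK.
have [rho rho_ge0 Krho0] := compact_cube cK.
have small x e : 0 < e -> `|x| <= e -> `|pi x| <= rho * e.
  move=> e0 xe; have -> : pi x = e *: pi (e^-1 *: x).
    by rewrite linearZ scalerA mulfV ?scale1r// gt_eqF.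
  rewrite normrZ gtr0_norm// mulrC ler_wpM2r ?(ltW e0)//.
  apply: norm_le_coord => // j; apply: Krho0; apply: piK.
  by rewrite normrZ gtr0_norm ?invr_gt0// ler_pdivrMl// mulr1.
have /choice [w wE] : forall k : 'I_n.+1, exists x, pi x = delta_mx 0 k by move=> k; exact: pi_surj.
pose M := 1 + \sum_k `|w k|.
pose dd : R := n.+1%:R.
have dd1 : 1 <= dd by rewrite ler1n.
have M1 : 1 <= M by rewrite lerDl; apply: sumr_ge0.
(* Small enough for B to be within 1/2 of the identity (dd * rho * e <= 1/2) and
   for the linear correction to have norm at most 1; K lies in a cube of size rho. *)
pose e : R := (2 * (1 + rho) * (M + dd))^-1.
have R1 : 0 < 1 + rho by apply: ltr_wpDr.
have MD : 0 < M + dd by apply: addr_gt0; [exact: lt_le_trans M1|exact: lt_le_trans dd1].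
have e0 : 0 < e by rewrite invr_gt0 !mulr_gt0.
have [s [sK' sN]] := compact_net cK e0.
have /choice [x0 x0E] : forall l : 'I_(size s), exists x, pi x = s`_l /\ `|x| <= 2.
  move=> l; have [|x xE x2] := @Kpi s`_l; last by exists x.
  by apply: sK'; exact: mem_nth.
pose u (l : 'I_(size s + n.+1)) : X :=
  match fintype.split l with inl l => x0 l | inr k => w k end.
have [N [g [r [q [[r1 /andP[q1 qQ] rq] G1 G2 G3]]]]] := LX u e0.
have combE (b : 'rV_N) : \sum_k b 0 k *: g k = comb g b by [].
have {G3} /choice [b bE] : forall l, exists b : 'rV[R]_N, `|u l - comb g b| <= e.
  move=> l; have [b bE] := G3 l; exists (\row_k b k); apply: ltW.
  by rewrite /comb; under eq_bigr do rewrite mxE.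
pose bv (l : 'I_(size s)) := b (lshift _ l).
pose bw (k : 'I_n.+1) := b (rshift (size s) k).
have bvE l : `|x0 l - comb g (bv l)| <= e by have := bE (lshift _ l); rewrite /u (unsplitK (inl l)).
have bwE k : `|w k - comb g (bw k)| <= e by have := bE (rshift _ k); rewrite /u (unsplitK (inr k)).
pose Z : 'M[R]_(N, n.+1) := \matrix_k pi (g k).
pose W : 'M[R]_(n.+1, N) := \matrix_k bw k.
pose B := W *m Z.
have ke : 2 * (1 + rho) * (M + dd) * e = 1.
  by rewrite mulfV// gt_eqF// -invr_gt0.
have [uB BH] : B \in unitmx /\ forall t : 'rV[R]_n.+1, `|t| <= 2 * `|t *m B|.
  apply: (@near_id_unit _ n.+1 B (rho * e)).
  - by rewrite mulr_ge0// ltW.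
  - rewrite -/dd; have : dd * (rho * e) * 2 <= 1; last by lra.
    rewrite -ke; have : 0 <= M * e by rewrite mulr_ge0 ?(ltW e0)//; lra.
    have : 0 <= dd * e by rewrite mulr_ge0 ?(ltW e0)//; lra.
    have : 0 <= rho * (M * e) by rewrite !mulr_ge0 ?(ltW e0)//; lra.
    nra.
  - move=> k j; have -> : B k j - (k == j)%:R = - (pi (w k - comb g (bw k))) 0 j.
      rewrite linearB /= wE pi_comb -/Z; have -> : B k j = (bw k *m Z) 0 j.
        by rewrite /B -[bw k](rowK bw k) -/W -row_mul [in RHS]mxE.
      by rewrite !mxE eqxx /= eq_sym opprB.
    by rewrite normrN; apply: le_trans (coord_le_norm _ _) _; exact: small.
pose y l := bv l *m Z.
have yE (l : 'I_(size s)) : `|s`_l - y l| <= rho * e.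
  by rewrite /y -(x0E l).1 -pi_comb -linearB; exact: small.
pose f (l : 'I_(size s)) (x : 'rV[R]_n.+1) : 'rV[R]_N := bv l + (x - y l) *m invmx B *m W.
pose sel := [seq (s`_(l : 'I_(size s)), f l) | l <- enum 'I_(size s)].
pose a := select sel e.
have selS : size sel = size s by rewrite size_map size_enum_ord.
have selE i (i_s : (i < size s)%N) : nth (0, fun=> 0) sel i = (s`_i, f (Ordinal i_s)).
  rewrite (nth_map (Ordinal i_s)) ?size_enum_ord//.
  have -> : nth (Ordinal i_s) (enum 'I_(size s)) i = Ordinal i_s.
    by apply: val_inj; rewrite /= nth_enum_ord.
  by [].
have aP (P : 'rV[R]_N -> Prop) x : K x -> (forall l : 'I_(size s), `|x - s`_l| <= e -> P (f l x)) -> P (a x).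
  move=> Kx H; apply: select_near.
    by have [i i_s xi] := sN x Kx; exists i; rewrite ?selS// selE.
  by rewrite selS => i i_s; rewrite selE => xi; exact: (H (Ordinal i_s)).
have c8 : (0 : R) < 8 by [].
have ma j : measurable_fun [set: mV R n.+1] (fun x : 'rV[R]_n.+1 => a x 0 j).
  apply: measurable_select => i; have [i_s|i_s] := ltnP i (size s); last first.
    by rewrite nth_default ?selS//; exact: cst_continuous.
  rewrite selE /=; set l := Ordinal i_s; pose C := invmx B *m W.
  rewrite (_ : (fun x => _) = fun x : 'rV[R]_n.+1 => (bv l - y l *m C) 0 j + (x *m C) 0 j).
    have cC : continuous (fun x : 'rV[R]_n.+1 => (x *m C) 0 j).
      move=> x; apply: (@continuous_comp _ _ _ (fun x : 'rV[R]_n.+1 => x *m C) (fun v : 'rV[R]_N => v 0 j)).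
        exact: continuous_mulmx.
      exact: coord_continuous.
    by move=> x; apply: continuousD; [exact: cst_continuous|exact: cC].
  by apply/funext => x; rewrite /f -mulmxA -/C mulmxBl addrA addrAC !mxE.
have az x : K x -> a x *m Z = x.
  move=> Kx; apply: (aP (fun v => v *m Z = x)) => // l _.
  by rewrite /f mulmxDl -/(y l) -!mulmxA -/B mulVmx// mulmx1 addrC subrK.
have nG x (l : 'I_(size s)) : K x -> `|x - s`_l| <= e -> `|comb g (f l x)| <= 4.
  move=> Kx xl; rewrite /f linearD /= comb_mul; set t := _ *m invmx B.
  have nv : `|comb g (bv l)| <= 2 + e.
    rewrite -[comb g _](subrK (x0 l)) addrC; apply: le_trans (ler_normD _ _) _.
    by apply: lerD; [exact: (x0E l).2|rewrite distrC].
  have nw k : `|comb g (row k W)| <= `|w k| + e.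
    rewrite rowK -[comb g _](subrK (w k)) addrC; apply: le_trans (ler_normD _ _) _.
    by apply: lerD => //; rewrite distrC.
  have nt : `|t| <= 2 * (e + rho * e).
    apply: le_trans (BH t) _; rewrite ler_pM2l// /t mulmxKV//.
    rewrite -[x](subrK s`_l) -addrA; apply: le_trans (ler_normD _ _) _.
    exact: lerD.
  have ns : `|\sum_k t 0 k *: comb g (row k W)| <= 2 * (e + rho * e) * (M + dd * e).
    apply: le_trans (ler_norm_sum _ _ _) _.
    apply: (@le_trans _ _ (\sum_k 2 * (e + rho * e) * (`|w k| + e))).
      apply: ler_sum => k _; rewrite normrZ; apply: ler_pM => //.
      by apply: le_trans nt; exact: coord_le_norm.
    rewrite -mulr_sumr ler_wpM2l//; first exact: le_trans nt.
    rewrite big_split /= sumr_const card_ord -[X in _ + X]mulr_natl -/dd lerD2r /M.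
    by rewrite ler_wpDl.
  apply: le_trans (ler_normD _ _) _; apply: le_trans (lerD nv ns) _.
  have e1 : e <= 1.
    have : 0 <= rho * ((M + dd) * e) by rewrite !mulr_ge0// ltW.
    have : 1 * e <= (M + dd) * e by rewrite ler_wpM2r ?(ltW e0)//; lra.
    move: ke; set Me := (M + dd) * e => ke; have : 2 * (Me + rho * Me) = 1 by rewrite -[RHS]ke /Me; ring.
    by lra.
  have : 2 * (e + rho * e) * (M + dd * e) <= 1.
    rewrite -[X in _ <= X]ke (_ : 2 * (e + rho * e) = 2 * (1 + rho) * e); last by ring.
    rewrite mulrAC ler_wpM2r ?(ltW e0)// ler_wpM2l ?mulr_ge0 ?(ltW R1)// lerD2l.
    by rewrite ler_piMr//; lra.
  by move=> ?; lra.
apply: le_trans (_ : (3 * beta * (moment_cst * q * 8)) ^+ n.+1 * vol K <= _); last first.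
  rewrite ler_wpM2r ?(ltW V0)//; apply: lerXn2r; rewrite ?nnegrE.
  - by rewrite !mulr_ge0// ?(ltW moment_cst_gt0)//; apply: le_trans q1.
  - by rewrite !mulr_ge0// ?(ltW moment_cst_gt0)// ltW.
  - rewrite ler_wpM2l ?mulr_ge0//; rewrite ler_wpM2r// ler_wpM2l//.
    exact: ltW moment_cst_gt0.
apply: (@slicing_finite _ n N K Z a r q 8 beta bK V0 r1 q1 rq c8 sections ma az).
- move=> x Kx; apply: (aP (fun v => \sum_j `|v 0 j| `^ r <= 8 `^ r)) => // l xl.
  rewrite (_ : 8 = 2 * 4 :> R); last by ring.
  by apply: (G2 (fun j => f l x 0 j)); exact: nG.
- move=> v v1; rewrite -pi_comb; apply: piK.
  exact: (G1 (fun j => v 0 j)).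
Qed.

End Slicing.

(** * Unit balls and hyperplane sections in coordinates *)

Section UnitBall.
Context {R : realType}.

(** The cube contains the zonotope of r times the identity matrix. *)
Lemma cube_vol_gt0 n (r : R) : 0 < r -> 0 < vol (cubeV n r).
Proof.
move=> r0; pose z : 'M[R]_n := r%:M.
have := @vol_zono R n n z 1%:M; rewrite mulmx1 tr_scalar_mx det_scalar => H.
have : 2 ^+ n * `|r ^+ n| <= vol (zono z).
  by apply: H => j; rewrite row1 dot_delta.
move=> {}H; have r2 : 0 < 2 ^+ n * `|r ^+ n| by rewrite mulr_gt0 ?exprn_gt0// normr_gt0 expf_neq0 ?gt_eqF.
have cc := @compact_cubeV R n r; have cz : compact (zono z) by exact: compact_zono.
apply: (lt_le_trans r2); apply: le_trans H _; apply: vol_le => // _ [a a1 <-] j.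
by rewrite mul_mx_scalar mxE normrM (gtr0_norm r0) ler_piMr ?(ltW r0).
Qed.

Variables (F : normedModType R) (n : nat) (phi : {linear F -> 'rV[R]_n}).
Hypothesis phi_bij : bijective phi.

(** Equivalence of norms: with psi the inverse of phi, |psi x| is at most C |x|,
and at least m |x| for m the minimum of |psi| on the unit sphere. *)
Lemma image_ball : body (phi @` unit_ball F) /\ exists2 r, 0 < r & cubeV n r `<=` phi @` unit_ball F.
Proof.
have [psi phiK psiK] := phi_bij.
have psiL : linear psi by move=> a x y; apply: (can_inj phiK); rewrite psiK linearD linearZ /= !psiK.
pose Psi : {linear 'rV[R]_n -> F} := HB.pack psi (GRing.isLinear.Build R 'rV[R]_n F *:%R psi psiL).
have psiE x : psi x = \sum_j x 0 j *: psi (delta_mx 0 j).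
  rewrite -[psi x]/(Psi x) {1}[x]row_sum_delta linear_sum; apply: eq_bigr => j _.
  by rewrite linearZ.
pose C := 1 + \sum_j `|psi (delta_mx 0 j)|.
have C1 : 1 <= C by rewrite lerDl; apply: sumr_ge0.
have C0 : 0 < C by apply: lt_le_trans C1.
have psi_le x : `|psi x| <= C * `|x|.
  rewrite psiE; apply: le_trans (ler_norm_sum _ _ _) _.
  apply: (@le_trans _ _ (\sum_j `|x| * `|psi (delta_mx 0 j)|)).
    by apply: ler_sum => j _; rewrite normrZ ler_wpM2r//; exact: coord_le_norm.
  by rewrite -mulr_sumr mulrC ler_wpM2r// lerDr.
have KE : phi @` unit_ball F = [set x | `|psi x| <= 1].
  apply/seteqP; split=> [_ [x x1 <-]|x x1] /=; first by rewrite phiK.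
  by exists (psi x).
have npsi_cont : continuous (fun x => `|psi x|).
  move=> x A /nbhs_ballP[e /= e0 eA]; apply/nbhs_ballP; exists (e / C) => /=; first exact: divr_gt0.
  move=> y; rewrite -ball_normE /= => xy; apply: eA; rewrite -ball_normE /=.
  apply: le_lt_trans (ler_dist_dist _ _) _.
  have -> : psi x - psi y = psi (x - y) by rewrite -[RHS]/(Psi (x - y)) linearB.
  by apply: le_lt_trans (psi_le _) _; rewrite -ltr_pdivlMl// mulrC.
have [m m0 mH] : exists2 m, 0 < m & forall x, m * `|x| <= `|psi x|.
  pose S := [set x : 'rV[R]_n | `|x| = 1].
  have cS : compact S.
    apply: (subclosed_compact _ (@compact_cubeV R n 1)).
      rewrite (_ : S = (fun x : 'rV[R]_n => `|x - 0|) @^-1` [set 1]); last first.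
        by apply/seteqP; split=> x /=; rewrite /S /= subr0.
      apply: closed_comp => [x _|]; [exact: continuous_dist|].
      exact: closed_eq.
    by move=> x; rewrite /S /= => x1; apply/asboolP; rewrite -norm_cubeV// x1.
  have [S0|S0] := pselect (S !=set0); last first.
    exists 1 => // x; have [->|x0] := eqVneq x 0; first by rewrite normr0 mulr0.
    exfalso; apply: S0; exists (`|x|^-1 *: x); rewrite /S /= normrZ normfV normr_id mulVf//.
    by rewrite normr_eq0.
  have cN : {within S, continuous (fun x => `|psi x|)} by apply: continuous_subspaceT.
  have [c] := EVT_min_rV S0 cS cN; rewrite inE => Sc cmin.
  have c0 : 0 < `|psi c|.
    rewrite normr_gt0; apply/eqP => pc0; have : c = 0.
      by rewrite -[c]psiK pc0 linear0.
    by move=> c0; move: Sc; rewrite /S /= c0 normr0 => /eqP; rewrite eq_sym oner_eq0.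
  exists `|psi c| => // x; have [->|x0] := eqVneq x 0; first by rewrite normr0 mulr0.
  have nx : 0 < `|x| by rewrite normr_gt0.
  have := cmin (`|x|^-1 *: x); rewrite inE.
  have -> : psi (`|x|^-1 *: x) = `|x|^-1 *: psi x by rewrite -[LHS]/(Psi _) linearZ.
  rewrite normrZ normfV normr_id ler_pdivlMl// mulrC; apply.
  by rewrite /S /= normrZ normfV normr_id mulVf ?gt_eqF.
split; last first.
  exists C^-1; first by rewrite invr_gt0.
  move=> x xC; rewrite KE /=; apply: le_trans (psi_le _) _.
  by rewrite -ler_pdivlMl// mulr1 norm_cubeV ?invr_ge0 ?(ltW C0)//; apply/asboolP.
rewrite KE; split.
- apply: (subclosed_compact _ (@compact_cubeV R n m^-1)).
    rewrite (_ : [set x | _] = (fun x => `|psi x|) @^-1` [set t | t <= 1])//.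
    apply: closed_comp => [x _|]; [exact: npsi_cont|exact: closed_le].
  move=> x /= x1; apply/asboolP; rewrite -norm_cubeV ?invr_ge0 ?(ltW m0)//.
  by rewrite -[m^-1]mulr1 ler_pdivlMl//; apply: le_trans x1.
- move=> x y t /= x1 y1 /andP[t0 t1].
  have -> : psi ((1 - t) *: x + t *: y) = (1 - t) *: psi x + t *: psi y.
    by rewrite -[LHS]/(Psi _) linearD !linearZ.
  apply: le_trans (ler_normD _ _) _; rewrite !normrZ (gtr0_norm t0) gtr0_norm ?subr_gt0//.
  apply: (@le_trans _ _ ((1 - t) * 1 + t * 1)); last by rewrite !mulr1 subrK.
  by apply: lerD; rewrite ler_wpM2l// ltW// subr_gt0.
- move=> x /=; have -> : psi (- x) = - psi x by rewrite -[LHS]/(Psi _) linearN.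
  by rewrite normrN.
Qed.

Lemma image_ball_vol : 0 < vol (phi @` unit_ball F).
Proof.
have [[cK _ _] [r r0 rK]] := image_ball.
have cc := @compact_cubeV R n r.
by apply: lt_le_trans (cube_vol_gt0 n r0) _; apply: vol_le.
Qed.

End UnitBall.

(** The frame is the one chosen by [lebesgue_on] for the hyperplane orthogonal to
u. The dimension of this hyperplane is m only up to a proof, hence the
substitution. *)
Lemma hyperplane_section (R : realType) m (K : set 'rV[R]_m.+1) (beta : R) (u : 'rV[R]_m.+1) :
  compact K ->
  (forall H : {vspace 'rV[R]_m.+1}, (\dim H).+1 = m.+1 ->
    (lebesgue_on H (K `&` [set x | x \in H]) <= beta%:E)%E) ->
  dot u u = 1 -> exists U : 'M[R]_(m, m.+1),
  [/\ U *m U^T = 1%:M, U *m u^T = 0 & vol [set v | K (v *m U)] <= beta].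
Proof.
move=> cK HH uu.
have d : (\dim (perp u)).+1 = m.+1 by rewrite dim_perp// uu oner_neq0.
have := HH _ d; rewrite /lebesgue_on.
have := orthonormal_frames_neq0 (perp u) => /(xgetPex 0).
move: (xget 0 _) => U [UU UH].
have KH : [set y | (K `&` [set x | x \in perp u]) (y *m U)] = [set y | K (y *m U)].
  apply/seteqP; split=> y /=; first by case.
  by move=> Ky; split=> //; rewrite mulmx_sum_row rpred_sum// => i _; rewrite rpredZ.
rewrite KH; have {UH KH} Uu : U *m u^T = 0.
  apply/matrixP => i j; rewrite (ord1 j) [RHS]mxE.
  have := UH i; rewrite mem_perp => /eqP <-.
  by rewrite /dot -row_mul [RHS]mxE.
move: (\dim _) d U UU Uu => k [kn]; subst k => U UU Uu Hb.
exists U; split=> //.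
have mK := measurable_mulmxV U (compact_mV cK).
move: Hb; rewrite -lebE// => Hb.
by rewrite -lee_fin /vol fineK// ge0_fin_numE ?measure_ge0//; apply: le_lt_trans Hb _; rewrite ltry.
Qed.

(** * The slicing inequality for quotients of L_p *)

Lemma lebesgue_rV_ge0 (R : realType) n (A : set 'rV[R]_n) : (0 <= lebesgue_rV A)%E.
Proof.
elim: n A => [|n IHn] A /=; first by rewrite lee_fin indicE.
by apply: integral_ge0 => x _; exact: IHn.
Qed.

Lemma power_root (R : realType) m (V t : R) : 0 < V -> 0 <= t ->
  V ^+ m.+1 <= t ^+ m.+1 * V -> V `^ (m%:R / m.+1%:R) <= t.
Proof.
move=> V0 t0; rewrite exprSr ler_pM2r// => Vt.
rewrite powRrM powR_mulrn ?(ltW V0)//.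
rewrite -[leRHS](powRr1 t0) -[X in _ <= t `^ X](@mulfV _ m.+1%:R) ?pnatr_eq0// powRrM powR_mulrn//.
by apply: ge0_ler_powR; rewrite ?invr_ge0 ?nnegrE ?exprn_ge0// ltW.
Qed.

Section QuotientBall.
Context (R : realType) (X : normedModType R) (E : closed_subspace X).
Local Notation q := (quot_proj E : X -> quot_space E).

Lemma quot_proj_le x : `|q x| <= `|x|.
Proof.
rewrite quot_normE; apply: ge_inf; last by exists x.
by exists 0 => _ [y _ <-].
Qed.

Lemma quot_lift (u : quot_space E) e : 0 < e -> exists2 x, q x = u & `|x| < `|u| + e.
Proof.
move=> e0; have Hu : has_inf [set `|x| | x in q @^-1` [set u]].
  split; first by have [x xu] := quot_proj_surj u; exists `|x|, x.
  by exists 0 => _ [y _ <-].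
by rewrite quot_normE; have [_ [x xu <-] xe] := inf_adherent e0 Hu; exists x.
Qed.

End QuotientBall.

Theorem mainTheorem1 (R : realType) :
  exists2 c0 : R, 0 < c0 &
    forall (d : measure_display) (T : measurableType d)
      (mu : {measure set T -> \bar R})
      (p p' : \bar R) (p_gt1 : (1 < p)%E) (pp' : (p^-1 + p'^-1 = 1)%E)
      (n : nat) (n_gt0 : (0 < n)%N)
      (E : closed_subspace (Lp mu (ltW p_gt1)))
      (phi : {linear quot_space E -> 'rV[R]_n}) (phi_bij : bijective phi),
    (lebesgue_rV (phi @` unit_ball (quot_space E)) `^ (n.-1%:R / n%:R) <=
      c0%:E * p' *
      ereal_sup [set lebesgue_on H
                       (phi @` unit_ball (quot_space E) `&` [set x | x \in H]) |
                   H in [set H : {vspace 'rV[R]_n} | (\dim H).+1 = n]])%E.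
Proof.
have mc0 := @moment_cst_gt0 R.
exists (48 * moment_cst); first by rewrite mulr_gt0.
move=> d T mu p p' p_gt1 pp' [//|m] _ E phi phi_bij; rewrite [m.+1.-1]/=.
have [bK _] := image_ball phi_bij; have V0 := image_ball_vol phi_bij.
set K := phi @` _ in bK V0 *; have [cK _ _] := bK.
have [Q LX [Q0 Qp']] := Lp_has_lr_sections mu p_gt1 pp'.
have p'0 : (0 < p')%E.
  rewrite -(@pmule_rgt0 _ 2%:E p') ?lte_fin//; apply: lt_le_trans Qp'; rewrite lte_fin//.
set S := ereal_sup _.
pose u : 'rV[R]_m.+1 := delta_mx 0 0; have uu : dot u u = 1 by exact: dot_delta.
have SH (H : {vspace 'rV[R]_m.+1}) : (\dim H).+1 = m.+1 ->
    (lebesgue_on H (K `&` [set x | x \in H]) <= S)%E.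
  by move=> dH; apply: ereal_sup_ubound; exists H.
have S0 : (0 <= S)%E.
  have dH : (\dim (perp u)).+1 = m.+1 by rewrite dim_perp// uu oner_neq0.
  by apply: le_trans (SH _ dH); exact: lebesgue_rV_ge0.
case: S S0 SH => [beta||] S0 SH; last by [].
  rewrite lee_fin in S0.
  have sec w : dot w w = 1 -> exists U : 'M[R]_(m, m.+1),
      [/\ U *m U^T = 1%:M, U *m w^T = 0 & vol [set v | K (v *m U)] <= beta].
    by move=> ww; apply: hyperplane_section.
  pose pi : {linear Lp mu (ltW p_gt1) -> 'rV[R]_m.+1} := phi \o quot_proj E.
  have piK x : `|x| <= 1 -> K (pi x).
    by move=> x1; exists (quot_proj E x) => //; apply: le_trans (quot_proj_le _ _) x1.
  have Kpi y : K y -> exists2 x, pi x = y & `|x| <= 2.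
    move=> [v v1 <-]; have [x xv x2] := quot_lift v (ltr01 : 0 < (1 : R)).
    by exists x; [rewrite /= xv|apply: ltW; apply: lt_le_trans x2 _; rewrite lerD2r].
  have surj y : exists x, pi x = y.
    have [psi _ psiK] := phi_bij; have [x xE] := quot_proj_surj (psi y : quot_mod E).
    by exists x; rewrite /= xE psiK.
  have H := slicing_reduction LX bK V0 Q0 S0 piK Kpi surj sec.
  rewrite -lebE; last exact: compact_mV.
  rewrite volE// poweR_EFin.
  set t := 3 * beta * (moment_cst * Q * 8) in H.
  have t0 : 0 <= t by rewrite !mulr_ge0// ltW.
  apply: (@le_trans _ _ t%:E); first by rewrite lee_fin; exact: power_root.
  have -> : t%:E = ((24 * moment_cst * beta)%:E * Q%:E)%E.
    by rewrite -EFinM /t; congr EFin; ring.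
  apply: le_trans (lee_wpmul2l _ Qp') _; first by rewrite lee_fin !mulr_ge0// ltW.
  rewrite muleA muleC -EFinM [X in (_ <= X)%E]muleAC -EFinM [X in (_ <= X)%E]muleC.
  by rewrite (_ : _ * 2 = 48 * moment_cst * beta)//; ring.
rewrite gt0_muley ?leey// mule_gt0// lte_fin mulr_gt0//.
Qed.
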